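(* For every $\beta\ge0$, the operator $\widehat T$ maps $L(\log L)^{1+\beta}$ boundedly into $L(\log L)^{\beta}$. In particular, $\widehat T\colon L\log L\to L^1$ is bounded.
   Context: All functions are complex-valued, Lebesgue measurable on $(-1,1)$, identified when equal a.e.; $L^1=L^1(-1,1)$. The decreasing rearrangement of $f$ is $f^*(t)=\inf\{\lambda\ge 0: |\{x\in(-1,1):|f(x)|>\lambda\}|\le t\}$, $0<t<2$. For $\alpha\ge0$, $L(\log L)^\alpha=L(\log L)^\alpha(-1,1)$ is the space of all measurable $f$ with $\|f\|_{L(\log L)^\alpha}:=\int_0^2 f^*(t)\log^\alpha\big(\tfrac{2e}{t}\big)\,dt<\infty$, with this norm; in particular $L(\log L)^0=L^1$ and $L(\log L)^1=L\log L$. All these spaces are contained in $L^1$. For $f\in L^1$ the finite Hilbert transform is $$T(f)(t)=\lim_{\varepsilon\to0^+}\frac1\pi\Big(\int_{-1}^{t-\varepsilon}+\int_{t+\varepsilon}^1\Big)\frac{f(x)}{x-t}\,dx ,$$ which exists for a.e. $t\in(-1,1)$ and is measurable. For $g\in L^1$ the measurable function $\widehat T(g)$ is defined by $$\widehat T(g)(x)=\frac{-1}{\sqrt{1-x^2}}\,T\big(\sqrt{1-t^2}\,g(t)\big)(x)\quad\text{for a.e. }x\in(-1,1).$$ *)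

(* Defs.v *)
From HB Require Import structures.
From mathcomp Require Import all_boot all_order all_algebra.
From mathcomp Require Import complex.
From mathcomp Require Import all_classical all_reals all_analysis.

Set Implicit Arguments.
Unset Strict Implicit.
Unset Printing Implicit Defensive.

Import Order.TTheory GRing.Theory Num.Theory.
Import numFieldNormedType.Exports.

Local Open Scope classical_set_scope.
Local Open Scope ring_scope.

(* The real line with the sigma-algebra of all Lebesgue measurable (not only
   Borel) sets, i.e. the domain of completed_lebesgue_measure. *)
Notation lebesgue_line R := (caratheodory_type (mu_ext (@wlength R idfun))).

Local Notation mu := (@completed_lebesgue_measure _).

Section FiniteHilbertTransform.
Context {R : realType}.
Implicit Types (f g : lebesgue_line R -> R[i]) (alpha t x : R).

Definition cabs (z : R[i]) : R := ComplexField.Normc.normc z.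

(* Functions are given on the whole line, but only their values on (-1,1)
   ever matter. *)
Definition dom : set (lebesgue_line R) := [set` `](-1 : R), 1[ ].

Definition cmeasurable f : Prop :=
  measurable_fun dom (fun x => complex.Re (f x) : R) /\
  measurable_fun dom (fun x => complex.Im (f x) : R).

Definition cintegral (D : set (lebesgue_line R)) f : R[i] :=
  Complex (Rintegral mu D (fun x => complex.Re (f x)))
          (Rintegral mu D (fun x => complex.Im (f x))).

Definition decreasing_rearrangement f t : \bar R :=
  ereal_inf [set l%:E | l in
    [set l : R | 0 <= l /\
      (mu (dom `&` [set x | (l < cabs (f x))%R]) <= t%:E)%E]].

Definition LlogL_norm alpha f : \bar R :=
  (\int[mu]_(t in [set` `]0%R, 2%R[ ])
     (decreasing_rearrangement f t * (ln (2 * expR 1 / t) `^ alpha)%R%:E))%E.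

Definition LlogL alpha : set (lebesgue_line R -> R[i]) :=
  [set f | cmeasurable f /\ (LlogL_norm alpha f < +oo)%E].

Definition L1_norm f : \bar R := (\int[mu]_(x in dom) (cabs (f x))%:E)%E.

Definition L1 : set (lebesgue_line R -> R[i]) :=
  [set f | cmeasurable f /\ (L1_norm f < +oo)%E].

Definition truncated_hilbert f t (eps : R) : R[i] :=
  let F := fun x : R => f x / (x - t)%:C%C in
  (pi^-1)%:C%C *
  (cintegral [set` `](-1 : R), (t - eps)[ ] F +
   cintegral [set` `](t + eps), (1 : R)[ ] F).

(* The principal value; R[i]^o carries the norm topology of R[i].  Where the
   limit does not exist (a null set of points t if f is integrable), lim
   returns a default value. *)
Definition finite_hilbert f : lebesgue_line R -> R[i] :=
  fun t : R => lim ((truncated_hilbert f t eps : R[i]^o) @[eps --> 0^'+]).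

Definition hilbert_hat g : lebesgue_line R -> R[i] :=
  fun x : R => (- 1 / Num.sqrt (1 - x ^+ 2))%:C%C *
    finite_hilbert (fun t : R => (Num.sqrt (1 - t ^+ 2))%:C%C * g t) x.

Definition maps_boundedly
    (S : (lebesgue_line R -> R[i]) -> lebesgue_line R -> R[i])
    (X : set (lebesgue_line R -> R[i])) (normX : (lebesgue_line R -> R[i]) -> \bar R)
    (Y : set (lebesgue_line R -> R[i])) (normY : (lebesgue_line R -> R[i]) -> \bar R) :=
  exists C : R, forall f, X f -> Y (S f) /\ (normY (S f) <= C%:E * normX f)%E.

End FiniteHilbertTransform.

(* Main.v *)
Require Import Defs.
From HB Require Import structures.
From mathcomp Require Import all_boot all_order all_algebra.
From mathcomp Require Import complex ring lra zify.
From mathcomp Require Import all_classical all_reals all_analysis.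
From mathcomp Require Import measurable_realfun.

(* Points where the truncations do not converge contribute 0 to T^ f, and
   elsewhere T^ f is their limit, so by Fatou it suffices to bound truncated
   operators uniformly in the truncation parameter e; the a.e. existence of the
   principal value is not needed.

   With delta t = 1 - t^2, the kernel sqrt (delta t / delta x) / (t - x) differs
   from 1 / (t - x) by an endpoint kernel dominated by positive powers of
   1 / delta, because delta t - delta x = (x - t)(x + t).  At scale e the
   truncated kernel 1 / (t - x) is a discrete Hilbert matrix up to a summable
   error.  For the matrix, Cotlar's identity u^2 = 2 H(b u) + G doubles the
   exponent of an l^q bound at the cost of doubling its constant; the resulting
   O(q) growth of the constants gives, when |psi| <= 1 has mass 2^-m and
   0 <= phi <= 1 has mass 2^-n,
     int phi |T^_e psi| <= K 2^-m kappa n m,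
   where kappa n m = m - n + 1 for n <= m and decays geometrically in n - m
   otherwise.

   Cutting f into dyadic level sets and testing against all such phi bounds the
   rearrangement of T^ f.  Summed against the increments of the logarithmic
   weight, kappa n m yields m^(1+beta), which is the weight of the
   L(log L)^(1+beta) norm on a set of measure 2^-m. *)

Set Implicit Arguments.
Unset Strict Implicit.
Unset Printing Implicit Defensive.

Import Order.TTheory GRing.Theory Num.Theory.
Import numFieldNormedType.Exports.

Local Open Scope classical_set_scope.
Local Open Scope ring_scope.

(** * The discrete Hilbert transform *)

(** Only exponents [2 ^ j] come out of the doubling, which suffices: the exponent need only match
    the logarithm of the mass ratio up to a factor 2, and [q = 2] alone serves when the test
    function has the smaller mass. There the decay is limited to the square root of the mass ratio,
    because [1 / sqrt delta] is only weakly square integrable at the endpoints; [3/4] is a rational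
    number above [1 / sqrt 2], and any ratio below 1 beats the powers of [n] in the weight.

    Working with matrices makes Cotlar's argument algebraic: all sums are finite, and the unknown
    [l^(2q)] norm can be absorbed because it is finite.

    The cutting of [f] starts at an auxiliary level [l > 0]; what lies below costs a multiple of
    [l], and letting [l] tend to 0 restores a bound homogeneous in [f]. Each majorant of a truncated
    piece is constructed before the test function is known, so that the majorants can be summed over
    the pieces first and tested afterwards. *)

Section DiscreteHilbert.
Context {R : realType}.
Implicit Types (N M j k q : nat) (a b : nat -> R).

(* The diagonal term vanishes because [0^-1 = 0]. *)
Definition dhilbert N b (y : R) : R := \sum_(i < N) b i * (y - i%:R)^-1.

(** Partial fractions; the three indicator terms are the corrections that the convention [0^-1 = 0]
    forces when two of the points [y], [s], [t] coincide. *)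
Lemma cotlar_term (y s t : R) :
  (y - s)^-1 * (y - t)^-1 =
  (s - t)^-1 * ((y - s)^-1 - (y - t)^-1) + (s == t)%:R * (y - s)^-1 ^+ 2
  + (y == t)%:R * (y - s)^-1 ^+ 2 + (y == s)%:R * (y - t)^-1 ^+ 2.
Proof.
have [->|st] := eqVneq s t.
  rewrite subrr invr0; have [->|yt] := eqVneq y t; first by rewrite subrr invr0; ring.
  by rewrite /=; ring.
have [yt|yt] := eqVneq y t.
  rewrite yt eq_sym (negbTE st) subrr invr0 -(opprB s t) invrN.
  by rewrite /=; ring.
have [ys|ys] := eqVneq y s.
  by rewrite ys subrr invr0 /=; ring.
by rewrite /=; field; rewrite !subr_eq0 st ys yt.
Qed.

(** Expand the square and apply [cotlar_term]. The factor [(s - t)^-1] summed over one index is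
    again [dhilbert N b], evaluated at the other index; antisymmetry makes the two halves equal,
    whence the factor 2. The coincidence terms form the rest. *)
Lemma cotlar_identity N b (y : R) :
  dhilbert N b y ^+ 2 =
  2 * dhilbert N (fun i => b i * dhilbert N b i%:R) y
  + \sum_(i < N) b i ^+ 2 * (y - i%:R)^-1 ^+ 2
  + 2 * (\sum_(i < N) b i * (y == i%:R)%:R)
      * (\sum_(i < N) b i * (y - i%:R)^-1 ^+ 2).
Proof.
rewrite expr2 {1 2}/dhilbert big_distrlr /=.
have E (i k : nat) : b i * (y - i%:R)^-1 * (b k * (y - k%:R)^-1) =
    b i * b k * ((i%:R - k%:R)^-1 * ((y - i%:R)^-1 - (y - k%:R)^-1))
    + b i * b k * (((i%:R : R) == k%:R)%:R * (y - i%:R)^-1 ^+ 2)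
    + b i * b k * ((y == k%:R)%:R * (y - i%:R)^-1 ^+ 2)
    + b i * b k * ((y == i%:R)%:R * (y - k%:R)^-1 ^+ 2).
  by rewrite mulrACA cotlar_term; ring.
under eq_bigr do under eq_bigr do rewrite E.
under eq_bigr do rewrite !big_split /=.
rewrite !big_split /=.
have -> : \sum_(i < N) \sum_(i0 < N) b i * b i0 *
     ((i%:R - i0%:R)^-1 * ((y - i%:R)^-1 - (y - i0%:R)^-1)) =
   2 * dhilbert N (fun i => b i * dhilbert N b i%:R) y.
  under eq_bigr do under eq_bigr do rewrite mulrBr mulrBr.
  under eq_bigr do rewrite sumrB.
  rewrite sumrB [X in _ - X]exchange_big /= -sumrB mulr_sumr.
  apply: eq_bigr => i _; rewrite -sumrB {1}/dhilbert mulr_sumr mulr_suml mulr_sumr.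
  apply: eq_bigr => k _; rewrite -(opprB i%:R k%:R) invrN; ring.
have -> : \sum_(i < N) \sum_(i0 < N) b i * b i0 *
     (((i%:R : R) == i0%:R)%:R * (y - i%:R)^-1 ^+ 2) =
   \sum_(i < N) b i ^+ 2 * (y - i%:R)^-1 ^+ 2.
  apply: eq_bigr => i _; rewrite (bigD1 i)//= eqxx mul1r big1 ?addr0 ?expr2// => k ki.
  rewrite eqr_nat.
  have -> : (nat_of_ord i == k) = false.
    by apply/negP => /eqP ik; move/negP: ki; apply; apply/eqP/val_inj.
  by rewrite mul0r mulr0.
rewrite -!addrA; congr (_ + (_ + _)).
rewrite [X in X + _]exchange_big /= -mulrA mulr_suml mulr_sumr -big_split/=.
apply: eq_bigr => i _; rewrite mulr_sumr mulr_sumr -big_split/=.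
apply: eq_bigr => k _; ring.
Qed.



Lemma sum_inv_sq n : \sum_(i < n) (i.+1%:R : R)^-1 ^+ 2 <= 2.
Proof.
case: n => [|n]; first by rewrite big_ord0.
(* The induction needs the sharper right side, by comparison with a telescoping series. *)
suff h : \sum_(i < n.+1) (i.+1%:R : R)^-1 ^+ 2 <= 2 - n.+1%:R^-1.
  by apply: (le_trans h); rewrite gerBl invr_ge0 ler0n.
elim: n => [|n IH]; first by rewrite big_ord1 invr1 expr1n; lra.
rewrite big_ord_recr /= (le_trans (lerD IH (lexx _)))//.
have -> : (n.+2%:R : R) = n.+1%:R + 1 by rewrite -natr1.
have n0 : (0 : R) < n.+1%:R by rewrite ltr0n.
move: (n.+1%:R : R) n0 => x x0; rewrite -subr_ge0.
have -> : 2 - (x + 1)^-1 - (2 - x^-1 + (x + 1)^-1 ^+ 2) = x^-1 * (x + 1)^-1 ^+ 2.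
  by field; rewrite !gt_eqF// addr_gt0.
by apply: mulr_ge0; [rewrite invr_ge0 ltW | exact: sqr_ge0].
Qed.

Lemma sum_sq_row k N : \sum_(i < N) ((k%:R : R) - i%:R)^-1 ^+ 2 <= 4.
Proof.
pose F i : R := ((k%:R : R) - i%:R)^-1 ^+ 2.
apply: (@le_trans _ _ (\sum_(i < k.+1 + N) F i)).
  rewrite addnC big_split_ord /= lerDl; apply: sumr_ge0 => i _; exact: sqr_ge0.
rewrite big_split_ord /=.
have -> : \sum_(i < k.+1) F i = \sum_(i < k) (i.+1%:R : R)^-1 ^+ 2.
  rewrite (reindex_inj rev_ord_inj) /= big_ord_recl /= /F subSS subn0 subrr invr0.
  rewrite expr0n add0r; apply: eq_bigr => i _; congr (_^-1 ^+ 2).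
  by rewrite !subSS natrB ?subKr// lift0; have := ltn_ord i.
have -> : \sum_(i < N) F (k.+1 + i)%N = \sum_(i < N) (i.+1%:R : R)^-1 ^+ 2.
  apply: eq_bigr => i _; rewrite /F -[RHS]sqrrN -invrN; congr (_^-1 ^+ 2).
  by rewrite addSnnS natrD; ring.
by rewrite (le_trans (lerD (sum_inv_sq k) (sum_inv_sq N)))// -natrD.
Qed.

(** Terms symmetric about [M + k] cancel. The window differs from a symmetric one by at most [N]
    terms, each at distance at least [M] from the centre. *)
Lemma sum_inv_centered k N (M : nat) : (0 < M)%N -> (k < N)%N ->
  `|\sum_(i < M + M + N) ((i%:R : R) - (M + k)%:R)^-1| <= N%:R / M%:R.
Proof.
move=> M0 kN; pose F i : R := ((i%:R : R) - (M + k)%:R)^-1.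
have F0 : \sum_(i < (M + k).*2.+1) F i = 0.
  suff h : \sum_(i < (M + k).*2.+1) F i = - \sum_(i < (M + k).*2.+1) F i by lra.
  rewrite [LHS](reindex_inj rev_ord_inj) /= -sumrN; apply: eq_bigr => i _.
  rewrite /F -invrN; congr (_^-1); rewrite subSS natrB; last by have := ltn_ord i; lia.
  by move: (nat_of_ord i) => j; rewrite -mul2n natrM; ring.
have bnd n : ((M + k + M) <= n)%N -> `|F n| <= M%:R^-1.
  move=> h; rewrite /F -natrB ?normfV ?normr_nat; last lia.
  rewrite lef_pV2 ?posrE ?ltr0n ?ler_nat//; lia.
have main p n : (M + k + M <= p)%N -> (n <= N)%N -> `|\sum_(i < n) F (p + i)%N| <= N%:R / M%:R.
  move=> hp hn; apply: (le_trans (ler_norm_sum _ _ _)).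
  apply: (@le_trans _ _ (\sum_(i < n) (M%:R : R)^-1)).
    apply: ler_sum => i _; apply: bnd; lia.
  rewrite sumr_const card_ord -[_ *+ n]mulr_natl ler_wpM2r ?invr_ge0 ?ler0n ?ler_nat//.
have [h|h] := leqP (M + k).*2.+1 (M + M + N).
  have E : (M + M + N = (M + k).*2.+1 + (M + M + N - (M + k).*2.+1))%N by lia.
  by rewrite E big_split_ord /= F0 add0r; apply: main; lia.
have E : ((M + k).*2.+1 = (M + M + N) + ((M + k).*2.+1 - (M + M + N)))%N by lia.
move: F0; rewrite E big_split_ord /= => /eqP; rewrite addr_eq0 => /eqP ->.
by rewrite normrN; apply: main; lia.
Qed.


(** Serves twice: it dominates the remainder of Cotlar's identity, and it measures the error of
    replacing the truncated kernel by a matrix entry. Its row sums are at most [2 * 4 + 4 = 12],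
    with [4] from [sum_sq_row]. *)
Definition near_ker (k i : nat) : R := 2 * ((k%:R : R) - i%:R)^-1 ^+ 2 + 4 * (k == i)%:R.

Lemma near_ker_ge0 k i : 0 <= near_ker k i.
Proof. by rewrite addr_ge0// mulr_ge0// ?sqr_ge0. Qed.

Lemma near_kerC k i : near_ker k i = near_ker i k.
Proof. by rewrite /near_ker eq_sym -opprB invrN sqrrN. Qed.

Lemma sum_near_ker k N : \sum_(i < N) near_ker k i <= 12.
Proof.
rewrite big_split /= -!mulr_sumr.
have h : \sum_(i < N) ((k == i)%:R : R) <= 1.
  have [kN|kN] := ltnP k N.
    rewrite (bigD1 (Ordinal kN))//= eqxx big1 ?addr0// => i.
    by rewrite -val_eqE /= eq_sym => /negbTE ->.
  by rewrite big1// => i _; case: eqP => // ki; have := ltn_ord i; lia.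
have := sum_sq_row k N; move: h; move: (\sum_(i < N) _) (\sum_(i < N) _) => x y; lra.
Qed.

(* The remainder in [cotlar_identity]. *)
Let G N b (y : R) : R :=
  \sum_(i < N) b i ^+ 2 * (y - i%:R)^-1 ^+ 2
  + 2 * (\sum_(i < N) b i * (y == i%:R)%:R)
      * (\sum_(i < N) b i * (y - i%:R)^-1 ^+ 2).

(** The cross term is present only if [k = M + j] for some [j < N]. Then
    [2 b_j b_i <= b_j^2 + b_i^2] doubles the inverse-square kernel and leaves [b_j^2] times a row
    sum, which is the diagonal term [4] of [near_ker]. The shift by [M] covers points outside the
    support of [b]. *)
Let G_bound N b (M k : nat) :
  `|G N b (k%:R - M%:R)| <= \sum_(i < N) b i ^+ 2 * near_ker k (M + i).
Proof.
have E (i : nat) : (k%:R - M%:R - i%:R : R) = k%:R - (M + i)%:R by rewrite natrD; ring.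
have E' (i : nat) : ((k%:R - M%:R : R) == i%:R) = (k == (M + i)%N).
  by rewrite subr_eq -natrD eqr_nat addnC.
rewrite /G (le_trans (ler_normD _ _))//.
under eq_bigr do rewrite E.
under [X in _ + `|_ * X * _|]eq_bigr do rewrite E'.
under [X in _ + `|_ * _ * X|]eq_bigr do rewrite E.
set v := fun i : nat => ((k%:R : R) - (M + i)%:R)^-1 ^+ 2.
have v0 i : 0 <= v i by exact: sqr_ge0.
rewrite ger0_norm; last by apply: sumr_ge0 => i _; rewrite mulr_ge0 ?sqr_ge0.
rewrite -/v.
under [leRHS]eq_bigr do rewrite /near_ker mulrDr mulrCA -/(v _).
rewrite big_split /= -mulr_sumr.
have sv : \sum_(i < N) v i <= 4.
  apply: (@le_trans _ _ (\sum_(i < M + N) ((k%:R : R) - i%:R)^-1 ^+ 2)); last exact: sum_sq_row.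
  by rewrite big_split_ord /= lerDr sumr_ge0// => i _; exact: sqr_ge0.
have [kM|kM] := boolP ((M <= k)%N && (k - M < N)%N); last first.
  have -> : \sum_(i < N) b i * (k == (M + i)%N)%:R = 0.
    rewrite big1// => i _; case: eqP => [ki|]; rewrite ?mulr0//.
    exfalso; move/negP: kM; apply; have := ltn_ord i; lia.
  have -> : \sum_(i < N) b i ^+ 2 * (4 * (k == (M + i)%N)%:R) = 0.
    rewrite big1// => i _; case: eqP => [ki|]; rewrite ?mulr0//.
    exfalso; move/negP: kM; apply; have := ltn_ord i; lia.
  rewrite mulr0 mul0r normr0 !addr0.
  have : 0 <= \sum_(i < N) b i ^+ 2 * v i by apply: sumr_ge0 => i _; rewrite mulr_ge0 ?sqr_ge0.
  by move: (\sum_(i < N) _) => x x0; lra.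
case/andP: kM => kM kN; pose j := Ordinal kN.
have kj : k = (M + j)%N by rewrite /j /=; lia.
have -> : \sum_(i < N) b i * (k == (M + i)%N)%:R = b j.
  rewrite (bigD1 j)//= -[X in X == _]/k subnKC// eqxx mulr1 big1 ?addr0// => i ij.
  case: eqP => [ki|]; rewrite ?mulr0//; exfalso; move/negP: ij; apply; apply/eqP/val_inj => /=; lia.
have -> : \sum_(i < N) b i ^+ 2 * (4 * (k == (M + i)%N)%:R) = 4 * b j ^+ 2.
  rewrite (bigD1 j)//= subnKC// eqxx mulr1 big1 ?addr0 1?mulrC// => i ij.
  case: eqP => [ki|]; rewrite ?mulr0//; exfalso; move/negP: ij; apply; apply/eqP/val_inj => /=; lia.
rewrite [X in `|X|]mulr_sumr (le_trans (lerD (lexx _) (ler_norm_sum _ _ _)))//.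
have h (i : nat) : `|2 * b j * (b i * v i)| <= b j ^+ 2 * v i + b i ^+ 2 * v i.
  rewrite -mulrDl mulrA normrM (ger0_norm (v0 i)) ler_wpM2r// ler_norml.
  by have := sqr_ge0 (b j + b i); have := sqr_ge0 (b j - b i); lra.
apply: (@le_trans _ _ (\sum_(i < N) b i ^+ 2 * v i +
    \sum_(i < N) (b j ^+ 2 * v i + b i ^+ 2 * v i))).
  by rewrite lerD2l; apply: ler_sum => i _; exact: h.
rewrite big_split /= -mulr_sumr.
have : b j ^+ 2 * \sum_(i < N) v i <= b j ^+ 2 * 4 by rewrite ler_wpM2l ?sqr_ge0.
rewrite /j /=; set X := \sum_(i < N) v i; set Y := \sum_(i < N) _; set Z := b _ ^+ 2; nra.
Qed.


Let cotlar N b (y : R) : dhilbert N b y ^+ 2 =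
  2 * dhilbert N (fun i => b i * dhilbert N b i%:R) y + G N b y.
Proof. by rewrite cotlar_identity addrA. Qed.

(* Summing [cotlar_identity] over a window of length [2 M + N] and letting [M]
   tend to infinity kills the first term. *)
Lemma dhilbert_l2 N b :
  \sum_(k < N) dhilbert N b k%:R ^+ 2 <= 12 * \sum_(i < N) b i ^+ 2.
Proof.
set u := dhilbert N b.
pose A := 2 * \sum_(i < N) `|b i * u i%:R| * N%:R.
have A0 : 0 <= A.
  by rewrite mulr_ge0// sumr_ge0// => i _; rewrite mulr_ge0.
have main M : (0 < M)%N ->
    \sum_(k < N) u k%:R ^+ 2 <= A / M%:R + 12 * \sum_(i < N) b i ^+ 2.
  move=> M0; pose L := (M + M + N)%N.
  apply: (@le_trans _ _ (\sum_(k < L) u (k%:R - M%:R) ^+ 2)).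
    rewrite /L -addnA big_split_ord /= -[leLHS]add0r lerD ?sumr_ge0// => [i _|].
      exact: sqr_ge0.
    rewrite addnC big_split_ord /= -[leLHS]addr0 lerD ?sumr_ge0// => [|i _]; last exact: sqr_ge0.
    apply: ler_sum => i _; rewrite natrD addrC addrA [- _ + _]addrC subrr add0r; exact: lexx.
  under eq_bigr do rewrite /u cotlar.
  rewrite big_split /= lerD//.
    rewrite -mulr_sumr /A -mulrA ler_pM2l// mulr_suml exchange_big /=.
    apply: ler_sum => i _; rewrite -mulr_sumr.
    apply: (le_trans (ler_norm _)); rewrite normrM -mulrA ler_wpM2l//.
    have := sum_inv_centered M0 (ltn_ord i); rewrite -/L; congr (`|_| <= _).
    apply: eq_bigr => k _; rewrite natrD; congr (_^-1); ring.
  apply: (@le_trans _ _ (\sum_(k < L) \sum_(i < N) b i ^+ 2 * near_ker k (M + i))).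
    by apply: ler_sum => k _; apply: (le_trans (ler_norm _)); exact: G_bound.
  rewrite exchange_big /= mulr_sumr; apply: ler_sum => i _.
  rewrite -mulr_sumr mulrC ler_wpM2r ?sqr_ge0//.
  by under eq_bigr do rewrite near_kerC; exact: sum_near_ker.
rewrite leNgt; apply/negP => lt.
move: main lt; move: (\sum_(k < N) u k%:R ^+ 2) (12 * _) => X Y main lt.
pose M := (Num.bound (A / (X - Y))).+1.
have XY : 0 < X - Y by rewrite subr_gt0.
have AM : A / (X - Y) < M%:R.
  rewrite (le_lt_trans (ler_norm _))// (lt_trans (archi_boundP _)) ?normr_ge0//.
  by rewrite ger0_norm ?divr_ge0// ?ltW// ltr_nat.
have := main M isT; rewrite -lerBlDr leNgt => /negP; apply.
rewrite ltr_pdivrMr ?ltr0n// mulrC -ltr_pdivrMr//.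
Qed.

(** The convexity of the square, iterated; from the second step on the arguments are even powers, so
    monotonicity of squaring applies to them. *)
Lemma pow2_convex j (t x y : R) : (0 < j)%N -> 0 <= t <= 1 ->
  (t * x + (1 - t) * y) ^+ (2 ^ j) <= t * x ^+ (2 ^ j) + (1 - t) * y ^+ (2 ^ j).
Proof.
move=> + /andP[t0 t1]; elim: j => // j IH _.
have sq (u v : R) : (t * u + (1 - t) * v) ^+ 2 <= t * u ^+ 2 + (1 - t) * v ^+ 2.
  rewrite -subr_ge0; have -> : t * u ^+ 2 + (1 - t) * v ^+ 2 - (t * u + (1 - t) * v) ^+ 2
    = t * (1 - t) * (u - v) ^+ 2 by ring.
  by apply: mulr_ge0; [apply: mulr_ge0; lra | exact: sqr_ge0].
have [->|j0] := posnP j; first exact: sq.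
rewrite expnSr !exprM (le_trans _ (sq _ _))//.
have e2 : ~~ odd (2 ^ j) by case: j j0 {IH} => // j _; rewrite oddX.
rewrite lerXn2r ?nnegrE ?exprn_even_ge0// ?addr_ge0 ?mulr_ge0 ?subr_ge0 ?exprn_even_ge0//.
exact: IH.
Qed.


(** The weighted variance about [S / V] is nonnegative. The total mass of [v] enters it with a
    nonnegative coefficient and may be replaced by its bound [V]. *)
Lemma weighted_cs N (v x : nat -> R) (V : R) : 0 < V -> (forall i, 0 <= v i) ->
  \sum_(i < N) v i <= V ->
  (\sum_(i < N) x i * v i) ^+ 2 <= V * \sum_(i < N) x i ^+ 2 * v i.
Proof.
move=> V0 v0 vV; set S := \sum_(i < N) x i * v i.
have : 0 <= \sum_(i < N) v i * (x i - S / V) ^+ 2.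
  by apply: sumr_ge0 => i _; rewrite mulr_ge0 ?sqr_ge0.
have -> : \sum_(i < N) v i * (x i - S / V) ^+ 2 = \sum_(i < N) x i ^+ 2 * v i
   - 2 * (S / V) * S + (S / V) ^+ 2 * \sum_(i < N) v i.
  rewrite {3}/S !mulr_sumr -sumrB -big_split /=; apply: eq_bigr => i _; ring.
set T := \sum_(i < N) x i ^+ 2 * v i => h.
have {h} h : 0 <= T - 2 * (S / V) * S + (S / V) ^+ 2 * V.
  by apply: (le_trans h); rewrite lerD2l ler_wpM2l ?sqr_ge0.
have : 0 <= V * (T - 2 * (S / V) * S + (S / V) ^+ 2 * V) by rewrite mulr_ge0// ltW.
have -> : V * (T - 2 * (S / V) * S + (S / V) ^+ 2 * V) = V * T - S ^+ 2.
  by field; rewrite gt_eqF.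
by rewrite subr_ge0.
Qed.

(** Jensen's inequality for a measure of mass at most [V], by iterating [weighted_cs]; cleared of
    denominators so that the induction multiplies by [V] instead of dividing. *)
Lemma pow2_jensen N (v x : nat -> R) (V : R) j : 0 < V -> (forall i, 0 <= v i) ->
  \sum_(i < N) v i <= V -> (forall i, 0 <= x i) ->
  (\sum_(i < N) x i * v i) ^+ (2 ^ j) * V <= V ^+ (2 ^ j) * \sum_(i < N) x i ^+ (2 ^ j) * v i.
Proof.
move=> V0 v0 vV x0; elim: j => [|j IH]; first by rewrite !expr1 mulrC.
rewrite -(ler_pM2r V0) expnSr !exprM.
set S := \sum_(i < N) x i * v i in IH *.
have S0 : 0 <= S by apply: sumr_ge0 => i _; rewrite mulr_ge0.
have cs := @weighted_cs N v (fun i => x i ^+ (2 ^ j)) V V0 v0 vV.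
set T := \sum_(i < N) x i ^+ (2 ^ j) * v i in IH cs.
have T0 : 0 <= T by apply: sumr_ge0 => i _; rewrite mulr_ge0// exprn_ge0.
apply: (@le_trans _ _ ((V ^+ (2 ^ j) * T) ^+ 2)).
  rewrite -mulrA -expr2 -exprMn lerXn2r// nnegrE ?mulr_ge0 ?exprn_ge0 ?(ltW V0)//.
rewrite exprMn -[leRHS]mulrA; apply: ler_wpM2l; first exact: sqr_ge0.
rewrite mulrC; move: cs; rewrite /=; congr (_ <= _ * _).
by apply: eq_bigr => i _; rewrite exprM.
Qed.

(* Cotlar's induction: the identity [u^2 = 2 H(b u) + G] turns an [l^q] bound
   into an [l^(2q)] bound whose constant is essentially twice as large. *)
Lemma dhilbert_lq N j b : (0 < j)%N ->
  \sum_(k < N) dhilbert N b k%:R ^+ (2 ^ j) <=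
  (8 * 2 ^+ j - 12) ^+ (2 ^ j) * \sum_(i < N) b i ^+ (2 ^ j).
Proof.
elim: j b => // j IH b _; have [->|j0] := posnP j.
  apply: (le_trans (dhilbert_l2 N b)); rewrite expn1 expr1.
  have -> : (8 * 2 - 12 : R) ^+ 2 = 16 by ring.
  by rewrite ler_wpM2r ?sumr_ge0// => [i _|]; [exact: sqr_ge0|rewrite ler_nat].
set u := dhilbert N b; pose q := (2 ^ j)%N; pose L : R := 8 * 2 ^+ j - 12.
(* Cotlar's identity costs [2 L] for the main term and [12], the row sum of [near_ker], for the
   remainder. The solution of this recursion with value [4] at [j = 1] is [8 * 2 ^+ j - 12], and
   [4 ^+ 2 = 16] covers the constant of [dhilbert_l2]. *)
pose K : R := 2 * L + 12.
have qe : ~~ odd q by rewrite /q; case: (j) j0 => // ? _; rewrite oddX.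
have L4 : 4 <= L.
  rewrite /L; have : (2 : R) <= 2 ^+ j by rewrite -[leLHS]expr1 ler_weXn2l// ler1n.
  by move: (2 ^+ j) => z; lra.
have EK : 8 * 2 ^+ j.+1 - 12 = K by rewrite /K /L exprS; ring.
rewrite EK.
have K0 : 0 < K by rewrite /K; lra.
have L0 : 0 <= L by apply: le_trans L4.
have L1 : 0 < L by apply: lt_le_trans L4.
(* The weights [2 L / K] and [12 / K] add up to 1. They turn [u^2] into a convex combination of the
   two terms, each rescaled by its own constant, so that both contribute at the same scale. *)
pose t := 2 * L / K.
have t01 : 0 <= t <= 1.
  rewrite /t divr_ge0 ?ler_pdivrMr//= ?ltW// /K; lra.
have E1 : 1 - t = 12 / K by rewrite /t /K; field; rewrite gt_eqF.
pose X := \sum_(k < N) u k%:R ^+ (2 ^ j.+1).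
pose Y := \sum_(i < N) b i ^+ (2 ^ j.+1).
have XE : X = \sum_(k < N) (u k%:R ^+ 2) ^+ q.
  by apply: eq_bigr => k _; rewrite -exprM expnS.
have Y0 : 0 <= Y.
  by apply: sumr_ge0 => i _; rewrite expnS exprM exprn_ge0// sqr_ge0.
pose v := fun i => b i * u i%:R.
have step1 : X <= t * (K / L) ^+ q * (\sum_(k < N) dhilbert N v k%:R ^+ q)
   + (1 - t) * (K / 12) ^+ q * \sum_(k < N) G N b k%:R ^+ q.
  rewrite XE !mulr_sumr -big_split /=; apply: ler_sum => k _.
  rewrite /u cotlar -/u -/v -[t * _ * _]mulrA -[(1 - t) * _ * _]mulrA -!exprMn.
  apply: le_trans _ (pow2_convex _ _ j0 t01).
  rewrite le_eqVlt; apply/orP; left; apply/eqP; congr (_ ^+ _).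
  by rewrite E1 /t; field; rewrite !gt_eqF//; lra.
have step2 : \sum_(k < N) G N b k%:R ^+ q <= 12 ^+ q * Y.
  apply: (@le_trans _ _ (\sum_(k < N) 12 ^+ q / 12 * \sum_(i < N) (b i ^+ 2) ^+ q * near_ker k i)).
    apply: ler_sum => k _.
    rewrite -[leRHS]mulrAC ler_pdivlMr//.
    have jen := @pow2_jensen N (near_ker k) (fun i => b i ^+ 2) 12 j (ltr0Sn R 11) (near_ker_ge0 k) (sum_near_ker k N)
      (fun i => sqr_ge0 (b i)).
    apply: le_trans jen; rewrite ler_wpM2r//.
    rewrite -(ger0_norm (exprn_even_ge0 (G N b k%:R) qe)) normrX lerXn2r ?nnegrE//.
      by apply: sumr_ge0 => i _; rewrite mulr_ge0 ?sqr_ge0 ?near_ker_ge0.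
    by have := G_bound N b 0 k; rewrite subr0.
  rewrite -mulr_sumr exchange_big /= -mulrA ler_wpM2l ?exprn_ge0//.
  rewrite mulrC ler_pdivrMr// mulr_suml; apply: ler_sum => i _.
  rewrite -mulr_sumr -exprM -expnS ler_wpM2l//.
    by rewrite expnS exprM exprn_ge0// sqr_ge0.
  by under eq_bigr do rewrite near_kerC; exact: sum_near_ker.
(* Young's inequality, weighted by [K ^+ q] so that after multiplication by this factor the unknown
   [X] carries coefficient [1/2]. *)
have step3 : \sum_(k < N) v k ^+ q <= (K ^+ q * Y + K ^- q * X) / 2.
  rewrite /X /Y !mulr_sumr -big_split /= mulr_suml; apply: ler_sum => k _.
  rewrite /v exprMn !expnS !exprM -/q -!(exprAC _ q 2).
  have Kq : 0 < K ^+ q by rewrite exprn_gt0.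
  move: (K ^+ q) (b k ^+ q) (u k%:R ^+ q) Kq => z x y z0.
  rewrite -subr_ge0.
  have -> : (z * x ^+ 2 + z^-1 * y ^+ 2) / 2 - x * y = (z * x - y) ^+ 2 / (2 * z).
    by field; rewrite gt_eqF.
  by rewrite divr_ge0 ?sqr_ge0// mulr_ge0// ltW.
have {step3} step3 := le_trans (IH v j0) (ler_wpM2l _ step3).
have {}step3 : \sum_(k < N) dhilbert N v k%:R ^+ q <= L ^+ q * ((K ^+ q * Y + K ^- q * X) / 2).
  by apply: step3; rewrite exprn_ge0//; lra.
have {step1} : X <= t * ((K ^+ (2 * q) * Y + X) / 2) + (1 - t) * (K ^+ q * Y).
  apply: (le_trans step1); rewrite lerD//.
    rewrite -mulrA ler_wpM2l//; first by case/andP: t01.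
    apply: (le_trans (ler_wpM2l _ step3)); first by rewrite exprn_ge0// divr_ge0// ltW.
    rewrite le_eqVlt; apply/orP; left; apply/eqP.
    rewrite expr_div_n mulnC exprM.
    have : K ^+ q != 0 by rewrite gt_eqF// exprn_gt0.
    have : L ^+ q != 0 by rewrite gt_eqF// exprn_gt0.
    by move=> ? ?; field; apply/andP.
  rewrite -mulrA ler_wpM2l//; first by rewrite subr_ge0; case/andP: t01.
  apply: (le_trans (ler_wpM2l _ step2)); first by rewrite exprn_ge0// divr_ge0// ltW.
  by rewrite expr_div_n mulrA divfK// gt_eqF// exprn_gt0.
rewrite -/X -/Y expnS -/q.
have : K ^+ q * Y <= K ^+ (2 * q) * Y.
  by rewrite ler_wpM2r// ler_weXn2l// ?leq_pmull//; rewrite /K; lra.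
move: (K ^+ (2 * q) * Y) (K ^+ q * Y) => P Q PQ h.
have tQ : (1 - t) * Q <= (1 - t) * P.
  by rewrite ler_wpM2l// subr_ge0; case/andP: t01.
(* The share [t / 2] of [X] is absorbed on the left; [t <= 1] keeps the remaining coefficient
   positive. *)
have : (1 - t / 2) * X <= (1 - t / 2) * P by lra.
by rewrite ler_pM2l//; case/andP: t01; lra.
Qed.


Lemma dhilbert_antisym N b (c : nat -> R) :
  \sum_(i < N) c i * dhilbert N b i%:R = - \sum_(i < N) b i * dhilbert N c i%:R.
Proof.
under eq_bigr do rewrite /dhilbert mulr_sumr.
under [in RHS]eq_bigr do rewrite /dhilbert mulr_sumr.
rewrite exchange_big /= -sumrN; apply: eq_bigr => i _; rewrite -sumrN.
by apply: eq_bigr => k _; rewrite -(opprB i%:R k%:R) invrN; ring.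
Qed.

(** By antisymmetry the matrix is moved onto [a], with the signs of [dhilbert N b] attached.
    Hölder's inequality is replaced by [y <= 1 + y ^ q] at a scale [s]: the [1] pays with the mass
    of [b], the power with the [l^q] bound for [a]. The free parameter [r] balances the two
    masses. *)
Lemma dhilbert_pair N j a b (r : R) : (0 < j)%N -> 0 < r ->
  (forall i, `|a i| <= 1) -> (forall i, `|b i| <= 1) ->
  \sum_(i < N) `|a i| * `|dhilbert N b i%:R| <=
  8 * 2 ^+ j * r * (\sum_(i < N) `|b i| + r ^- (2 ^ j) * \sum_(i < N) `|a i|).
Proof.
move=> j0 r0 a1 b1; pose c i := `|a i| * Num.sg (dhilbert N b i%:R).
have c1 i : `|c i| <= `|a i|.
  rewrite /c normrM normr_id normr_sg -[leRHS]mulr1 ler_wpM2l//.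
  by case: (_ != 0).
have qe : ~~ odd (2 ^ j)%N by case: (j) j0 => // ? _; rewrite oddX.
(* The scale is [r] times an upper bound of the [l^q] constant, so that only [r ^- q] survives in
   front of the mass of [a]. *)
have [s sE] : exists s : R, s = 8 * 2 ^+ j * r by eexists.
set q := (2 ^ j)%N in qe *.
have s0 : 0 < s by rewrite sE !mulr_gt0// exprn_gt0.
have le1 (y : R) : 0 <= y -> y <= 1 + y ^+ q.
  move=> y0; have [y1|y1] := leP y 1.
    by rewrite (le_trans y1)// lerDl exprn_ge0.
  rewrite (@le_trans _ _ (y ^+ q))// ?lerDr//.
  by rewrite -[leLHS]expr1 ler_weXn2l// ?expn_gt0// ltW.
have -> : \sum_(i < N) `|a i| * `|dhilbert N b i%:R| = - \sum_(i < N) b i * dhilbert N c i%:R.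
  by rewrite -dhilbert_antisym; apply: eq_bigr => i _; rewrite /c -mulrA -normrEsg.
rewrite -sumrN -sE.
apply: (@le_trans _ _ (\sum_(i < N) (s * `|b i| + s * s ^- q * dhilbert N c i%:R ^+ q))).
  apply: ler_sum => i _; rewrite (le_trans (ler_norm _))// normrN normrM.
  have := le1 (`|dhilbert N c i%:R| / s).
  rewrite divr_ge0 ?(ltW s0)// => /(_ isT); rewrite ler_pdivrMr// mulrDl mul1r => h.
  rewrite (le_trans (ler_wpM2l _ h))// mulrDr mulrC lerD2l.
  rewrite -[leRHS]mul1r ler_pM// ?mulr_ge0 ?exprn_ge0 ?divr_ge0 ?(ltW s0)//.
  by rewrite expr_div_n -normrX ger0_norm ?exprn_even_ge0// mulrC mulrA mulrAC.
rewrite big_split /= -!mulr_sumr mulrDr lerD2l -mulrA ler_pM2l//.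
have h : \sum_(i < N) dhilbert N c i%:R ^+ q <= (8 * 2 ^+ j) ^+ q * \sum_(i < N) `|a i|.
  apply: (le_trans (dhilbert_lq N c j0)); apply: ler_pM.
  - by rewrite exprn_even_ge0.
  - by apply: sumr_ge0 => i _; rewrite exprn_even_ge0.
  - have z2 : (2 : R) <= 2 ^+ j by rewrite -[leLHS]expr1 ler_weXn2l// ler1n.
    rewrite lerXn2r ?nnegrE//; move: (2 ^+ j) z2 => z z2; lra.
  - apply: ler_sum => i _.
    rewrite (le_trans (ler_norm _))// normrX (le_trans _ (c1 i))//.
    rewrite -[leRHS]expr1 ler_wiXn2l// ?(le_trans (c1 i))// expn_gt0//.
rewrite (le_trans (ler_wpM2l _ h)) ?invr_ge0 ?exprn_ge0 ?(ltW s0)//.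
by rewrite mulrA ler_wpM2r ?sumr_ge0// sE exprMn invfM mulrAC mulVf ?mul1r// expf_neq0// gt_eqF// mulr_gt0.
Qed.

End DiscreteHilbert.

(** * The truncated Hilbert transform *)

Local Notation mu := (@completed_lebesgue_measure _).

(** * Bounded measurable functions on [(-1, 1)] *)

Section Line.
Context {R : realType}.
Local Notation line := (lebesgue_line R).

Lemma measurable_id_line (D : set line) : measurable_fun D (fun x : line => x : R).
Proof.
move=> mD B mB; apply: measurableI => //.
exact: (@sub_caratheodory _ _ _ (@wlength R idfun) B mB).
Qed.

Lemma measurable_line (A : set R) : measurable A -> measurable (A : set line).
Proof. by move=> mA; exact: (@sub_caratheodory _ _ _ (@wlength R idfun) A mA). Qed.

Lemma measurable_itv_line (i : interval R) : measurable ([set` i] : set line).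
Proof. exact: (measurable_line (measurable_itv i)). Qed.

Lemma measurable_dom : measurable (@dom R).
Proof. exact: measurable_itv_line. Qed.

Lemma mu_itv (a b : R) (x y : bool) : a <= b ->
  mu ([set` Interval (BSide x a) (BSide y b)] : set line) = (b - a)%:E.
Proof.
move=> ab; rewrite -[LHS]/(lebesgue_measure [set` Interval (BSide x a) (BSide y b)]).
rewrite lebesgue_measure_itv /= lte_fin; have [ltab|ba] := ltP a b; first by rewrite EFinB.
by rewrite [in RHS](_ : b - a = 0)//; apply/eqP; rewrite subr_eq0 eq_le ab ba.
Qed.

Lemma mu_dom : mu (@dom R) = 2%:E.
Proof. by rewrite mu_itv; [congr (_%:E); ring|lra]. Qed.


Lemma mu_dom_lty : (mu (@dom R) < +oo)%E.
Proof. by rewrite mu_dom ltry. Qed.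

(** On a domain of finite measure such functions are integrable, and they form an algebra; this
    settles the integrability conditions for all truncated kernels and pieces. *)
Definition bmf (f : line -> R) :=
  measurable_fun dom f /\ exists M, forall x, dom x -> `|f x| <= M.

Lemma bmfM f g : bmf f -> bmf g -> bmf (fun x => f x * g x).
Proof.
move=> [mf [M fM]] [mg [N gN]]; split; first exact: measurable_funM.
by exists (M * N) => x dx; rewrite normrM ler_pM ?fM ?gN.
Qed.

Lemma bmfD f g : bmf f -> bmf g -> bmf (fun x => f x + g x).
Proof.
move=> [mf [M fM]] [mg [N gN]]; split; first exact: measurable_funD.
by exists (M + N) => x dx; rewrite (le_trans (ler_normD _ _))// lerD ?fM ?gN.
Qed.

Lemma bmf_cst (r : R) : bmf (fun=> r).
Proof. by split=> //; exists `|r|. Qed.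

Lemma bmf_indic (A : set line) : measurable A -> bmf (\1_A).
Proof.
move=> mA; split; first exact: measurable_indic.
by exists 1 => x _; rewrite indicE; case: (_ \in _); rewrite ?normr1 ?normr0.
Qed.

Lemma bmf_norm f : bmf f -> bmf (fun x => `|f x|).
Proof.
move=> [mf [M fM]]; split; first exact: measurableT_comp.
by exists M => x dx; rewrite normr_id fM.
Qed.

Lemma bmf_sum (I : Type) (s : seq I) (F : I -> line -> R) :
  (forall i, bmf (F i)) -> bmf (fun x => \sum_(i <- s) F i x).
Proof.
move=> h; elim: s => [|i s IH].
  by rewrite (_ : (fun _ => _) = fun=> 0) ?funeqE; [exact: bmf_cst|move=> x; rewrite big_nil].
rewrite (_ : (fun _ => _) = fun x => F i x + \sum_(j <- s) F j x); first exact: bmfD.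
by apply/funext => x; rewrite big_cons.
Qed.

Lemma bmf_integrable f : bmf f -> mu.-integrable dom (EFin \o f).
Proof.
move=> [mf [M fM]]; apply: measurable_bounded_integrable => //.
- exact: measurable_dom.
- exact: mu_dom_lty.
- exists M; split; first exact: num_real.
  by move=> y My x dx; rewrite /= (le_trans (fM x dx))// ltW.
Qed.

Lemma Rintegral_bmf_sum (I : Type) (s : seq I) (F : I -> line -> R) :
  (forall i, bmf (F i)) -> \int[mu]_(x in dom) (\sum_(i <- s) F i x) =
  \sum_(i <- s) \int[mu]_(x in dom) F i x.
Proof.
move=> h; elim: s => [|i s IH].
  rewrite big_nil; under eq_Rintegral do rewrite big_nil.
  by rewrite Rintegral_cst ?mul0r//; exact: measurable_dom.
rewrite big_cons -IH -RintegralD; [| exact: measurable_dom | exact: bmf_integrable| exact/bmf_integrable/bmf_sum].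
by apply: eq_Rintegral => x _; rewrite big_cons.
Qed.

Lemma RintegralZ_bmf (r : R) f : bmf f ->
  \int[mu]_(x in dom) (r * f x) = r * \int[mu]_(x in dom) f x.
Proof. by move=> h; rewrite RintegralZl//; [exact: measurable_dom|exact: bmf_integrable]. Qed.

Lemma le_Rintegral_bmf f g : bmf f -> bmf g -> (forall x, dom x -> f x <= g x) ->
  \int[mu]_(x in dom) f x <= \int[mu]_(x in dom) g x.
Proof.
by move=> bf bg fg; apply: le_Rintegral => //; [exact: measurable_dom|exact: bmf_integrable|exact: bmf_integrable].
Qed.

Lemma norm_Rintegral_bmf f : bmf f ->
  `|\int[mu]_(x in dom) f x| <= \int[mu]_(x in dom) `|f x|.
Proof. by move=> bf; apply: le_normr_Rintegral; [exact: measurable_dom|exact: bmf_integrable]. Qed.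

Lemma EFin_Rintegral_bmf f : bmf f ->
  (\int[mu]_(x in dom) f x)%:E = (\int[mu]_(x in dom) (f x)%:E)%E.
Proof.
move=> bf; rewrite fineK//; apply: integrable_fin_num; first exact: measurable_dom.
exact: bmf_integrable.
Qed.

End Line.

(** Inversion is not continuous at 0. Writing it as [f x] times a real power of the nonnegative
    [f x ^+ 2] reduces to the measurability of [powR], and the factor [f x] gives the right value
    where [f] vanishes. *)
Lemma measurable_funV d (T : measurableType d) (R : realType) (D : set T) (f : T -> R) :
  measurable_fun D f -> measurable_fun D (fun x => (f x)^-1).
Proof.
move=> mf.
have -> : (fun x => (f x)^-1) = (fun x => f x * (f x ^+ 2) `^ (-1)).
  apply/funext => x; rewrite powR_inv1 ?sqr_ge0//.
  have [->|fx] := eqVneq (f x) 0; first by rewrite invr0 mul0r.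
  by field.
apply: measurable_funM; first exact: mf.
by apply: (measurableT_comp (measurable_powR (-1))); apply: measurable_funX.
Qed.

Section TruncatedHilbert.
Context {R : realType}.
Local Notation line := (lebesgue_line R).

Definition cutoff_inv (e x t : R) : R := if e < `|t - x| then (t - x)^-1 else 0.

Lemma cutoff_inv_bound e x t : 0 < e -> `|cutoff_inv e x t| <= e^-1.
Proof.
rewrite /cutoff_inv => e0; case: ifPn => h; last by rewrite normr0 invr_ge0 ltW.
by rewrite normfV lef_pV2 ?posrE ?(lt_trans e0 h)// ltW.
Qed.

Lemma bmf_cutoff_inv e x : 0 < e -> bmf (cutoff_inv e x).
Proof.
move=> e0; split; last by exists e^-1 => t _; exact: cutoff_inv_bound.
rewrite (_ : cutoff_inv e x = fun t => (t - x)^-1 * \1_(~` [set` `[x - e, x + e]]) t).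
  apply: measurable_funM; last exact/measurable_indic/measurableC/measurable_itv_line.
  apply: measurable_funV; apply: measurable_funB; [exact: measurable_id_line|exact: measurable_cst].
apply/funext => t; rewrite /cutoff_inv indicE in_setC mem_setE /= in_itv /= -ler_distlC distrC leNgt.
by case: (e < `|x - t|) => /=; rewrite ?mulr1 ?mulr0.
Qed.

Definition cell (e : R) (j : nat) : set line :=
  [set` `[-1 + j%:R * e, -1 + j.+1%:R * e[ ].

Lemma measurable_cell e j : measurable (cell e j).
Proof. exact: measurable_itv_line. Qed.

Lemma mu_cell e j : 0 < e -> mu (cell e j) = e%:E.
Proof.
move=> e0; rewrite mu_itv; last by rewrite lerD2l ler_pM2r// ler_nat.
by congr (_%:E); rewrite -natr1; ring.
Qed.

Lemma cellP e (x : R) j : 0 < e -> -1 <= x ->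
  cell e j x <-> Num.truncn ((x + 1) / e) = j.
Proof.
move=> e0 x1; have x0 : 0 <= (x + 1) / e by apply: divr_ge0; [lra|exact: ltW].
rewrite -[_ = j]/(_ = j :> nat).
have -> : cell e j x = (j%:R <= (x + 1) / e < j.+1%:R) :> Prop.
  rewrite /cell/= in_itv/= ler_pdivlMr// ltr_pdivrMr//.
  by rewrite addrC -lerBrDr opprK [in ltRHS]addrC -ltrBlDr opprK.
rewrite -truncn_eq//; split=> /eqP//.
Qed.

(** In units of [e], [y] is the true distance and [d] the difference of cell indices. If [d = 0]
    both the cutoff and the bound are constants; if [|y| <= 1] the cutoff vanishes and [|d| <= 2];
    otherwise the difference of inverses is at most [1 / (|y| |d|)], and [|d| <= 2 |y|]. *)
Let cutoff_inv1_bound (y d : R) : d = 0 \/ 1 <= `|d| -> `|y - d| < 1 ->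
  `|cutoff_inv 1 0 y - d^-1| <= 2 * d^-1 ^+ 2 + 4 * (d == 0)%:R.
Proof.
move=> + yd; have [->|dn0 [/eqP|d1]] := eqVneq d 0.
- move=> _; rewrite invr0 subr0 (le_trans (cutoff_inv_bound _ _ ltr01))// invr1 expr0n /=.
  by rewrite mulr0 mulr1 add0r; lra.
- by rewrite (negbTE dn0).
rewrite mulr0 addr0 -[d^-1 ^+ 2]ger0_norm ?sqr_ge0// normrX normfV.
have dV : 0 < `|d|^-1 by rewrite invr_gt0 normr_gt0.
have dp := lt_le_trans ltr01 d1.
have dy : `|d| - 1 <= `|y|.
  have h : `|d| <= `|d - y| + `|y| by rewrite -[in leLHS](subrK y d) ler_normD.
  by rewrite distrC in h; move: h yd; move: `|d| `|y - d| `|y| => p q r; lra.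
rewrite /cutoff_inv subr0; case: ifPn => [y1|]; last first.
  rewrite -leNgt => y1; rewrite sub0r normrN normfV.
  have d2 : `|d| <= 2 by move: dy y1; move: `|d| `|y| => p q; lra.
  rewrite expr2 mulrA -[leLHS]mul1r (ler_pM2r dV).
  by rewrite -[leRHS]/(2 / `|d|) ler_pdivlMr// mul1r.
have y0 : y != 0 by rewrite -normr_gt0 (lt_trans ltr01).
have -> : y^-1 - d^-1 = (d - y) / (y * d) by field; rewrite dn0 y0.
have h2 : `|d| <= 2 * `|y| by move: dy y1; move: `|d| `|y| => p q; lra.
have yp := lt_trans ltr01 y1.
rewrite normrM distrC normfV normrM expr2 invfM mulrA [leRHS]mulrA (ler_pM2r dV).
rewrite ler_pdivrMr// mulrAC ler_pdivlMr//.
by rewrite (le_trans _ h2)// ler_piMl// ltW.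
Qed.

Lemma cutoff_inv_cell e (x t : R) i j : 0 < e -> cell e i x -> cell e j t ->
  `|cutoff_inv e x t - e^-1 * (j%:R - i%:R)^-1| <= e^-1 * near_ker i j.
Proof.
move=> e0; rewrite /cell/= !in_itv/= => /andP[x1 x2] /andP[t1 t2].
have [y yE] : exists y, y = (t - x) / e by eexists.
pose d : R := j%:R - i%:R.
have tE : t - x = e * y by rewrite yE mulrC divfK// gt_eqF.
have yd : `|y - d| < 1.
  move: x1 x2 t1 t2; rewrite -!natr1 ltr_norml /d.
  move: (i%:R : R) (j%:R : R) => a b; rewrite !mulrDl !mul1r => x1 x2 t1 t2.
  have ye : y * e = t - x by rewrite tE mulrC.
  apply/andP; split; rewrite -(ltr_pM2r e0) mulrBl ye mulrBl ?mulN1r ?mul1r.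
    by move: (a * e) (b * e) x1 x2 t1 t2 => p q; lra.
  by move: (a * e) (b * e) x1 x2 t1 t2 => p q; lra.
have -> : cutoff_inv e x t = e^-1 * cutoff_inv 1 0 y.
  rewrite /cutoff_inv subr0 tE normrM gtr0_norm// -[X in X < _]mulr1 ltr_pM2l//.
  by case: ifP; rewrite ?mulr0// invfM.
rewrite -/d -mulrBr normrM gtr0_norm ?invr_gt0// ler_pM2l ?invr_gt0//.
have -> : near_ker i j = 2 * d^-1 ^+ 2 + 4 * (i == j)%:R.
  by rewrite /near_ker -[in LHS]sqrrN -invrN opprB.
have -> : (i == j) = (d == 0) by rewrite /d subr_eq0 eqr_nat eq_sym.
apply: cutoff_inv1_bound => //.
have [ij|ij] := eqVneq i j; [by left; rewrite /d ij subrr|right].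
rewrite /d; have [h|h] := ltnP i j.
  by rewrite -natrB 1?ltnW// normr_nat ler1n subn_gt0.
by rewrite distrC -natrB// normr_nat ler1n subn_gt0 ltn_neqAle eq_sym ij.
Qed.

Section CellAverages.
Variable (e : R).
Hypothesis e0 : 0 < e.

Definition ncells := (Num.truncn (2 / e)).+1.
Local Notation N := ncells.

(** The last cell reaches beyond [1]; integrating over [dom] amounts to extending [f] by zero
    there. *)
Definition cavg (f : line -> R) (j : nat) : R :=
  e^-1 * \int[mu]_(x in dom) (f x * \1_(cell e j) x).

Let idx (x : R) := Num.truncn ((x + 1) / e).

Let domP (x : R) : dom x -> -1 <= x < 1.
Proof. by rewrite /dom /= in_itv /= => /andP[/ltW -> ->]. Qed.

Let idx_lt (x : R) : dom x -> (idx x < N)%N.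
Proof.
move=> /domP /andP[x1 x2]; rewrite /N ltnS /idx; apply: le_truncn.
by rewrite ler_pM2r ?invr_gt0//; lra.
Qed.

Let bmf_cell j : bmf (\1_(cell e j)).
Proof. by apply: bmf_indic; exact: measurable_cell. Qed.

Let bmfM_cell f j : bmf f -> bmf (fun x => f x * \1_(cell e j) x).
Proof. by move=> bf; apply: bmfM; [exact: bf|exact: bmf_cell]. Qed.

Lemma sum_cell (F : nat -> R) (x : R) : dom x ->
  exists2 i, cell e i x & \sum_(j < N) F j * \1_(cell e j) x = F i.
Proof.
move=> dx; have /andP[x1 _] := domP dx; exists (idx x); first exact/cellP.
rewrite (bigD1 (Ordinal (idx_lt dx)))//= big1 ?addr0 => [|j ji].
  by rewrite indicE mem_set ?mulr1//; exact/cellP.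
rewrite indicE memNset ?mulr0// => /(cellP j e0 x1) jx.
by move/eqP: ji; apply; apply/val_inj.
Qed.

Lemma bmf_cells (F : nat -> R) : bmf (fun x => \sum_(j < N) F j * \1_(cell e j) x).
Proof. by apply: bmf_sum => j; apply: bmfM; [exact: bmf_cst|exact: bmf_cell]. Qed.

Lemma Rintegral_cells (F : nat -> R) f : bmf f ->
  \int[mu]_(x in dom) (f x * \sum_(j < N) F j * \1_(cell e j) x) =
  e * \sum_(j < N) F j * cavg f j.
Proof.
move=> bf; under eq_Rintegral do rewrite mulr_sumr.
rewrite Rintegral_bmf_sum => [|i]; last first.
  by apply: bmfM; [exact: bf|apply: bmfM; [exact: bmf_cst|exact: bmf_cell]].
rewrite mulr_sumr; apply: eq_bigr => j _; under eq_Rintegral do rewrite mulrCA.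
rewrite RintegralZ_bmf; last exact: bmfM_cell bf.
by rewrite /cavg mulrCA mulVKf ?gt_eqF.
Qed.

Lemma sum_cavg f : bmf f -> e * \sum_(j < N) cavg f j = \int[mu]_(x in dom) f x.
Proof.
move=> bf; have := Rintegral_cells (fun=> 1) bf; under eq_bigr do rewrite mul1r.
move=> <-; apply: eq_Rintegral => x; rewrite inE => dx.
by have [i _ ->] := sum_cell (fun=> 1) dx; rewrite mulr1.
Qed.

Lemma cavg_norm f j : bmf f -> `|cavg f j| <= cavg (fun x => `|f x|) j.
Proof.
move=> bf; rewrite /cavg normrM gtr0_norm ?invr_gt0// ler_pM2l ?invr_gt0//.
apply: (le_trans (norm_Rintegral_bmf (bmfM_cell j bf))).
rewrite le_eqVlt; apply/orP; left; apply/eqP; apply: eq_Rintegral => x _.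
by rewrite normrM [X in _ * X]ger0_norm// indicE ler0n.
Qed.

Lemma cavg_ge0 f j : (forall x, dom x -> 0 <= f x) -> 0 <= cavg f j.
Proof.
move=> f0; apply: mulr_ge0; [by rewrite invr_ge0 ltW|apply: Rintegral_ge0 => x dx].
by rewrite mulr_ge0 ?f0// indicE ler0n.
Qed.

Lemma cavg_le1 f j : bmf f -> (forall x, dom x -> f x <= 1) -> cavg f j <= 1.
Proof.
move=> bf f1; rewrite /cavg mulrC ler_pdivrMr// mul1r.
apply: (@le_trans _ _ (\int[mu]_(x in dom) \1_(cell e j) x)).
  apply: le_Rintegral_bmf => [||x dx]; first exact: bmfM_cell bf.
    exact: bmf_cell.
  by rewrite ler_piMl ?f1// indicE ler0n.
rewrite -lee_fin EFin_Rintegral_bmf; last exact: bmf_cell.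
rewrite integral_indic; [|exact: measurable_dom|exact: measurable_cell].
rewrite -[leRHS](mu_cell j e0); apply: le_measure; rewrite ?inE.
- by apply: measurableI; [exact: measurable_cell|exact: measurable_dom].
- exact: measurable_cell.
- exact: subIsetl.
Qed.

End CellAverages.

(** On a cell, the truncated transform is the discrete transform of the averages of [psi], up to
    [near_ker] applied to the averages of [|psi|]. The majorant [G] is constant on cells, so that
    pairing it with [phi] only involves the averages of [phi]. It is fixed before [phi], [j] and
    [r], since the best [j] and [r] depend on the mass of [phi]. *)
Lemma hilbert_trunc_bound (e : R) (psi : line -> R) :
  0 < e -> bmf psi -> (forall x, dom x -> `|psi x| <= 1) ->
  exists G : line -> R, [/\ bmf G, (forall x, 0 <= G x),
    (forall x, dom x ->
      `|\int[mu]_(t in dom) (psi t * cutoff_inv e x t)| <= G x) &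
    forall (phi : line -> R), bmf phi -> (forall x, dom x -> 0 <= phi x <= 1) ->
    forall j (r : R), (0 < j)%N -> 0 < r ->
    \int[mu]_(x in dom) (phi x * G x) <=
    8 * 2 ^+ j * r * (\int[mu]_(x in dom) `|psi x|
                      + r ^- (2 ^ j) * \int[mu]_(x in dom) phi x)
    + 12 * Num.min (\int[mu]_(x in dom) `|psi x|) (\int[mu]_(x in dom) phi x)].
Proof.
move=> e0 bpsi psi1; pose N := ncells e; pose b := cavg e psi.
pose apsi (x : line) := `|psi x|.
have bapsi : bmf apsi by exact: bmf_norm.
pose v := cavg e apsi.
have v0 j : 0 <= v j by apply: cavg_ge0 => // x _; exact: normr_ge0.
have v1 j : v j <= 1 by exact: cavg_le1.
have bv j : `|b j| <= v j by exact: cavg_norm.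
pose h i := \sum_(j < N) near_ker i j * v j.
have h0 i : 0 <= h i by apply: sumr_ge0 => j _; rewrite mulr_ge0 ?near_ker_ge0.
pose g i := `|dhilbert N b i%:R| + h i.
have g0 i : 0 <= g i by rewrite addr_ge0.
exists (fun x => \sum_(i < N) g i * \1_(cell e i) x); split.
- exact: bmf_cells.
- by move=> x; apply: sumr_ge0 => i _; rewrite mulr_ge0// indicE ler0n.
- move=> x dx; have [i ix ->] := sum_cell e0 g dx.
  pose K (t : line) := \sum_(j < N) (e^-1 * (j%:R - i%:R)^-1) * \1_(cell e j) t.
  have bK : bmf K by exact: (bmf_cells e (fun j : nat => e^-1 * (j%:R - i%:R)^-1)).
  have bC : bmf (cutoff_inv e x) by exact: bmf_cutoff_inv e0.
  have bD : bmf (fun t => psi t * (cutoff_inv e x t - K t)).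
    apply: bmfM; first exact: bpsi.
    rewrite (_ : (fun _ => _) = fun t => cutoff_inv e x t + -1 * K t).
      by apply: bmfD; [exact: bC|apply: bmfM; [exact: bmf_cst|exact: bK]].
    by apply/funext => t; rewrite mulN1r.
  have -> : \int[mu]_(t in dom) (psi t * cutoff_inv e x t) =
    \int[mu]_(t in dom) (psi t * (cutoff_inv e x t - K t)) +
    \int[mu]_(t in dom) (psi t * K t).
    rewrite -RintegralD; [|exact: measurable_dom|exact: bmf_integrable|]; last first.
      by apply: bmf_integrable; exact: bmfM.
    by apply: eq_Rintegral => t _; rewrite -mulrDr subrK.
  rewrite /g [leRHS]addrC (le_trans (ler_normD _ _))// lerD//.
    rewrite (le_trans (norm_Rintegral_bmf bD))//.
    pose L (t : line) := \sum_(j < N) (e^-1 * near_ker i j) * \1_(cell e j) t.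
    have bL : bmf L by exact: (bmf_cells e (fun j : nat => e^-1 * near_ker i j)).
    apply: (@le_trans _ _ (\int[mu]_(t in dom) (apsi t * L t))).
      apply: le_Rintegral_bmf; [exact: bmf_norm|exact: bmfM|move=> t dt].
      rewrite normrM ler_wpM2l// /K /L.
      have [j jt ->] := sum_cell e0 (fun j => e^-1 * (j%:R - i%:R)^-1) dt.
      have [k kt ->] := sum_cell e0 (fun j => e^-1 * near_ker i j) dt.
      have /andP[t1 _] : -1 <= t < 1 by move: dt; rewrite /dom /= in_itv /= => /andP[/ltW -> ->].
      have -> : k = j by rewrite -(cellP k e0 t1).1// -(cellP j e0 t1).1.
      exact: cutoff_inv_cell.
    rewrite (Rintegral_cells e0 (fun j : nat => e^-1 * near_ker i j) bapsi).
    rewrite mulr_sumr le_eqVlt; apply/orP; left; apply/eqP.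
    by apply: eq_bigr => j _; rewrite -mulrA mulVKf// gt_eqF.
  rewrite (Rintegral_cells e0 (fun j : nat => e^-1 * (j%:R - i%:R)^-1) bpsi).
  rewrite mulr_sumr /dhilbert -normrN -sumrN le_eqVlt.
  apply/orP; left; apply/eqP; congr (`| _ |); apply: eq_bigr => j _.
  rewrite -/(b j) -mulrA mulVKf ?gt_eqF// -(opprB i%:R) invrN; ring.
move=> phi bphi phi01 j r j0 r0; pose a := cavg e phi.
set I := \int[mu]_(x in dom) `|psi x|; set J := \int[mu]_(x in dom) phi x.
have a0 i : 0 <= a i by apply: cavg_ge0 => // x dx; case/andP: (phi01 x dx).
have a1 i : a i <= 1 by apply: cavg_le1 => // x dx; case/andP: (phi01 x dx).
rewrite (Rintegral_cells e0 g bphi) -/a.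
have SI : e * \sum_(i < N) v i = I by exact: sum_cavg.
have SJ : e * \sum_(i < N) a i = J by exact: sum_cavg.
under eq_bigr do rewrite /g mulrDl.
rewrite big_split /= mulrDr lerD//.
  have a1' i : `|a i| <= 1 by rewrite ger0_norm.
  have b1 i : `|b i| <= 1 by exact: le_trans (bv i) (v1 i).
  have dp := dhilbert_pair N j0 r0 a1' b1.
  apply: (le_trans (_ : _ <= e * (8 * 2 ^+ j * r *
     (\sum_(i < N) `|b i| + r ^- (2 ^ j) * \sum_(i < N) `|a i|)))).
    rewrite ler_pM2l// (le_trans _ dp)//.
    by apply: ler_sum => i _; rewrite mulrC [`|a i|]ger0_norm.
  rewrite -SI -SJ mulrCA ler_wpM2l//; first by rewrite mulr_ge0 ?mulr_ge0 ?exprn_ge0 ?ltW.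
  rewrite mulrDr; apply: lerD.
    by rewrite ler_pM2l//; apply: ler_sum => i _; exact: bv.
  rewrite mulrCA; apply: ler_wpM2l; first by rewrite invr_ge0 exprn_ge0// ltW.
  by rewrite ler_pM2l//; apply: ler_sum => i _; rewrite ger0_norm.
(* [near_ker] is symmetric and both families of averages are at most 1, so one may be bounded by 1
   and the row sum taken over its index. This gives each of the two bounds. *)
rewrite /Order.min; case: ifP => _.
  rewrite -SI mulrCA ler_pM2l// /h.
  under eq_bigr do rewrite mulr_suml.
  rewrite exchange_big /= mulr_sumr; apply: ler_sum => i _.
  apply: (@le_trans _ _ (\sum_(k < N) near_ker k i * v i)).
    by apply: ler_sum => k _; rewrite ler_piMr// mulr_ge0 ?near_ker_ge0.
  rewrite -mulr_suml ler_wpM2r//; under eq_bigr do rewrite near_kerC.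
  exact: sum_near_ker.
rewrite -SJ mulrCA ler_pM2l// mulr_sumr; apply: ler_sum => i _.
rewrite ler_wpM2r// /h (le_trans _ (sum_near_ker i N))//; apply: ler_sum => k _.
by rewrite ler_piMr// near_ker_ge0.
Qed.
End TruncatedHilbert.

(** * The endpoint kernel *)

Section Endpoints.
Context {R : realType}.
Local Notation line := (lebesgue_line R).

Definition delta (x : R) : R := 1 - x ^+ 2.

Lemma domP (x : R) : dom x <-> -1 < x < 1.
Proof. by rewrite /dom /= in_itv. Qed.

Lemma delta_gt0 (x : R) : dom x -> 0 < delta x.
Proof. by move=> /domP /andP[x1 x2]; rewrite /delta; nra. Qed.

Lemma measurable_delta : measurable_fun dom (fun x : line => delta x).
Proof.
apply: measurable_funB; first exact: measurable_cst.
by apply: measurable_funX; exact: measurable_id_line.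
Qed.

Definition near_end (r : R) : set line := dom `&` [set x : line | delta x < r].

Lemma measurable_near_end r : measurable (near_end r).
Proof.
exact: (measurable_delta measurable_dom (measurable_itv `]-oo, r[)).
Qed.

(** On [dom] one has [delta x >= 1 - |x|], so the set lies within [r] of the endpoints. *)
Lemma mu_near_end (r : R) : 0 < r -> (mu (near_end r) <= (2 * r)%:E)%E.
Proof.
move=> r0; pose A : set line := [set` `](-1 : R), (-1 + r)[ ].
pose B : set line := [set` `](1 - r : R), 1[ ].
have mA : measurable A by exact: measurable_itv_line.
have mB : measurable B by exact: measurable_itv_line.
have : (mu (near_end r) <= mu (A `|` B))%E.
  apply: le_measure; rewrite ?inE; [exact: measurable_near_end|exact: measurableU|].
  move=> x [/domP /andP[x1 x2]]; rewrite /= /A /B /delta /= !in_itv /= x1 x2 andbT /= => xr.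
  have [x0|x0] := leP x 0; [left|right]; nra.
move=> /le_trans; apply; apply: (le_trans (measureU2 _ mA mB)).
have muA : mu A = r%:E by rewrite mu_itv; [congr (_%:E); ring|lra].
have muB : mu B = r%:E by rewrite mu_itv; [congr (_%:E); ring|lra].
rewrite (_ : 2 * r = r + r); last ring.
by rewrite EFinD -{1}muA -muB.
Qed.

Lemma nneseries_le (u : nat -> \bar R) (C : \bar R) :
  (forall i, 0 <= u i)%E -> (forall n, \sum_(0 <= i < n) u i <= C)%E ->
  (\sum_(0 <= i <oo) u i <= C)%E.
Proof.
move=> u0 uC; apply: lime_le; first exact: is_cvg_nneseries.
by near=> n; exact: uC.
Unshelve. all: by end_near. Qed.

Lemma sum_half n : \sum_(0 <= i < n) ((2 : R) ^- i) <= 2.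
Proof.
suff -> : \sum_(0 <= i < n) ((2 : R) ^- i) = 2 - 2 * 2 ^- n.
  by rewrite gerBl mulr_ge0// invr_ge0 exprn_ge0.
elim: n => [|n IH]; first by rewrite big_geq// expr0 invr1; ring.
rewrite big_nat_recr//= IH exprSr invfM; field.
by rewrite expf_neq0.
Qed.

Lemma measurable_rsqrt_delta :
  measurable_fun dom (fun x : line => (Num.sqrt (delta x))^-1).
Proof.
apply: measurable_funV.
apply: (measurableT_comp (continuous_measurable_fun _) measurable_delta).
exact: sqrt_continuous.
Qed.

(** A relaxation of the indicators of sets of measure at most [s]: with functions, a level set that
    is too large is scaled down instead of being replaced by a subset of prescribed measure. *)
Definition weight_le (phi : line -> R) (s : R) :=
  [/\ measurable_fun dom phi, (forall x, dom x -> 0 <= phi x <= 1) &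
      (\int[mu]_(x in dom) (phi x)%:E <= s%:E)%E].

Lemma scale4_bracket (s d : R) : 0 < s -> 0 < d -> d < s ->
  exists i, d < s * 4 ^- i /\ s * 4 ^- i.+1 <= d.
Proof.
move=> s0 d0 ds.
have ex : exists k, s * 4 ^- k <= d.
  pose k := (Num.bound (s / d)); exists k.
  have h : s / d < k%:R by rewrite archi_boundP// divr_ge0// ltW.
  rewrite ler_pdivrMr ?exprn_gt0// mulrC -ler_pdivrMr// (le_trans (ltW h))//.
  by rewrite -natrX ler_nat ltnW// ltn_expl.
have [[|k] hk kmin] := ex_minnP ex.
  by move: hk; rewrite expr0 invr1 mulr1 leNgt ds.
exists k; split => //; rewrite ltNge; apply/negP => /kmin; by rewrite ltnn.
Qed.

(** With layers of ratio 4, the bound for [1 / sqrt delta] doubles from one layer to the next while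
    the measure drops by a factor 4, so the integrated series is geometric. *)
Lemma rsqrt_delta_le (s x : R) : 0 < s -> dom x ->
  ((Num.sqrt (delta x))^-1%:E <= (Num.sqrt s)^-1%:E +
    \sum_(0 <= i <oo) (2 ^+ i.+1 / Num.sqrt s * \1_(near_end (s * 4 ^- i)) x)%:E)%E.
Proof.
move=> s0 dx; have d0 := delta_gt0 dx.
have S0 i : (0 <= (2 ^+ i.+1 / Num.sqrt s * \1_(near_end (s * 4 ^- i)) x)%:E)%E.
  by rewrite lee_fin mulr_ge0 ?divr_ge0 ?exprn_ge0 ?sqrtr_ge0// indicE ler0n.
have [sd|ds] := leP s (delta x).
  rewrite (@le_trans _ _ ((Num.sqrt s)^-1%:E))//.
    by rewrite lee_fin lef_pV2 ?posrE ?sqrtr_gt0// ler_wsqrtr.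
  by rewrite leeDl// nneseries_ge0.
have [i [di id]] := scale4_bracket s0 d0 ds.
apply: (@le_trans _ _ (2 ^+ i.+1 / Num.sqrt s * \1_(near_end (s * 4 ^- i)) x)%:E).
  rewrite indicE mem_set ?mulr1; last by split.
  rewrite lee_fin -[leLHS]mul1r ler_pdivrMr ?sqrtr_gt0// mulrAC ler_pdivlMr ?sqrtr_gt0// mul1r.
  have -> : 2 ^+ i.+1 * Num.sqrt (delta x) = Num.sqrt (4 ^+ i.+1 * delta x).
    rewrite sqrtrM ?exprn_ge0// (_ : 4 = 2 ^+ 2); last ring.
    by rewrite exprAC sqrtr_sqr ger0_norm// exprn_ge0.
  by rewrite ler_wsqrtr// -ler_pdivrMl ?exprn_gt0// mulrC.
apply: (le_trans _ (leeDr _ _)); last by rewrite lee_fin invr_ge0 sqrtr_ge0.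
pose u k := (2 ^+ k.+1 / Num.sqrt s * \1_(near_end (s * 4 ^- k)) x)%:E.
rewrite -/(u i); apply: (@le_trans _ _ (\sum_(0 <= k < i.+1) u k)%E).
  by rewrite big_nat_recr//= leeDr// sume_ge0// => k _; exact: S0.
by apply: nneseries_lim_ge => k _ _; exact: S0.
Qed.

Lemma mu_weight_near_end (phi : line -> R) (r : R) : 0 < r ->
  measurable_fun dom phi -> (forall x, dom x -> 0 <= phi x <= 1) ->
  (\int[mu]_(x in dom) (phi x * \1_(near_end r) x)%:E <= (2 * r)%:E)%E.
Proof.
move=> r0 mphi phi01; apply: le_trans (mu_near_end r0).
have m1 : measurable_fun dom (\1_(near_end r) : line -> R).
  by apply: measurable_indic; exact: measurable_near_end.
have -> : mu (near_end r) = (\int[mu]_(x in dom) (\1_(near_end r) x)%:E)%E.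
  rewrite integral_indic; [|exact: measurable_dom|exact: measurable_near_end].
  by congr (mu _); rewrite /near_end setIAC setIid.
apply: ge0_le_integral.
- exact: measurable_dom.
- by move=> x dx; rewrite lee_fin mulr_ge0// ?indicE ?ler0n//; case/andP: (phi01 x dx).
- by apply/measurable_EFinP; apply: measurable_funM; [exact: mphi|exact: m1].
- by apply/measurable_EFinP; exact: m1.
- by move=> x dx; rewrite lee_fin ler_piMl// ?indicE ?ler0n//; case/andP: (phi01 x dx).
Qed.

(** Weak square integrability of [1 / sqrt delta], in dual form. In [9 = 1 + 8], the [1] comes from
    the constant [1 / sqrt s] against mass [s], the [8] from the layers. *)
Lemma integral_rsqrt_delta (phi : line -> R) (s : R) : 0 < s -> weight_le phi s ->
  (\int[mu]_(x in dom) (phi x / Num.sqrt (delta x))%:E <= (9 * Num.sqrt s)%:E)%E.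
Proof.
move=> s0 [mphi phi01 phis].
have mind r : measurable_fun dom (\1_(near_end r) : line -> R).
  by apply: measurable_indic; exact: measurable_near_end.
pose c i := 2 ^+ i.+1 / Num.sqrt s.
have c0 i : 0 <= c i by rewrite divr_ge0 ?exprn_ge0 ?sqrtr_ge0.
pose F i (x : line) := ((c i)%:E * (phi x * \1_(near_end (s * 4 ^- i)) x)%:E)%E.
have phi0 x : dom x -> 0 <= phi x by move=> /phi01/andP[].
have mp i : measurable_fun dom (fun x => (phi x * \1_(near_end (s * 4 ^- i)) x)%:E).
  by apply/measurable_EFinP; apply: measurable_funM; [exact: mphi|exact: mind].
have mF i : measurable_fun dom (F i).
  by apply: emeasurable_funM; [exact: measurable_cst|exact: mp].
have p0 i x : dom x -> (0 <= (phi x * \1_(near_end (s * 4 ^- i)) x)%:E)%E.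
  by move=> dx; rewrite lee_fin mulr_ge0 ?phi0// indicE ler0n.
have F0 i x : dom x -> (0 <= F i x)%E.
  by move=> dx; rewrite /F mule_ge0 ?p0// lee_fin.
pose P (x : line) := ((Num.sqrt s)^-1%:E * (phi x)%:E)%E.
have mP : measurable_fun dom P.
  by apply: emeasurable_funM; [exact: measurable_cst|apply/measurable_EFinP; exact: mphi].
have P0 x : dom x -> (0 <= P x)%E.
  by move=> dx; rewrite /P mule_ge0// lee_fin ?invr_ge0 ?sqrtr_ge0 ?phi0.
have mS : measurable_fun dom (fun x => \sum_(0 <= i <oo) F i x)%E.
  by apply: ge0_emeasurable_sum => [i x dx _|i _]; [exact: F0|exact: mF].
apply: (@le_trans _ _ (\int[mu]_(x in dom) (P x + \sum_(0 <= i <oo) F i x))%E).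
  apply: ge0_le_integral.
  - exact: measurable_dom.
  - by move=> x dx; rewrite lee_fin divr_ge0 ?phi0 ?sqrtr_ge0.
  - apply/measurable_EFinP; apply: measurable_funM; [exact: mphi|exact: measurable_rsqrt_delta].
  - by apply: emeasurable_funD; [exact: mP|exact: mS].
  - move=> x dx; rewrite EFinM.
    rewrite (le_trans (lee_wpmul2l _ (rsqrt_delta_le s0 dx)))//; first by rewrite lee_fin phi0.
    rewrite ge0_muleDr; [|by rewrite lee_fin invr_ge0 sqrtr_ge0|]; last first.
      by apply: nneseries_ge0 => i _ _; rewrite lee_fin mulr_ge0 ?c0// indicE ler0n.
    rewrite /P [X in (X + _)%E]muleC leeD2l// -nneseriesZl; last first.
      by move=> i _; rewrite lee_fin mulr_ge0 ?c0// indicE ler0n.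
    apply: lee_nneseries => i _ => [_|].
      by rewrite mule_ge0 ?lee_fin ?phi0// mulr_ge0 ?c0// indicE ler0n.
    by rewrite /F -!EFinM mulrCA.
rewrite ge0_integralD//; [|exact: measurable_dom|by move=> x dx; rewrite nneseries_ge0// => i _ _; exact: F0].
rewrite integral_nneseries; [|exact: measurable_dom|exact: mF|exact: F0].
rewrite (_ : 9 * Num.sqrt s = Num.sqrt s + 8 * Num.sqrt s); last ring.
rewrite EFinD; apply: leeD.
  rewrite /P ge0_integralZl_EFin; [|exact: measurable_dom|by move=> x dx; rewrite lee_fin phi0
    |by apply/measurable_EFinP; exact: mphi|by rewrite invr_ge0 sqrtr_ge0].
  apply: le_trans (lee_wpmul2l _ phis) _; first by rewrite lee_fin invr_ge0 sqrtr_ge0.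
  rewrite -EFinM lee_fin -[X in _ * X](sqr_sqrtr (ltW s0)) expr2 mulKf//.
  by rewrite gt_eqF// sqrtr_gt0.
apply: nneseries_le => [i|n].
  by apply: integral_ge0 => x dx; exact: F0.
apply: (@le_trans _ _ (\sum_(0 <= i < n) (4 * Num.sqrt s * 2 ^- i)%:E)%E).
  apply: lee_sum => i _; rewrite /F ge0_integralZl_EFin; [|exact: measurable_dom
    |by move=> x dx; exact: p0|exact: mp|exact: c0].
  have si : 0 < s * 4 ^- i by rewrite mulr_gt0// invr_gt0 exprn_gt0.
  apply: le_trans (lee_wpmul2l _ (mu_weight_near_end si mphi phi01)) _.
    by rewrite lee_fin c0.
  rewrite -EFinM lee_fin /c -[X in _ * (_ * (X * _))](sqr_sqrtr (ltW s0)).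
  rewrite (_ : 4 ^- i = (2 ^- i) ^+ 2); last first.
    by rewrite (_ : 4 = 2 ^+ 2) ?exprVn -?exprM 1?mulnC//; ring.
  have t0 : Num.sqrt s != 0 by rewrite gt_eqF// sqrtr_gt0.
  have u0 : (2 : R) ^+ i != 0 by rewrite expf_neq0.
  rewrite le_eqVlt; apply/orP; left; apply/eqP; rewrite exprS.
  by field; rewrite t0 u0.
rewrite sumEFin lee_fin -mulr_sumr (_ : 8 * Num.sqrt s = 4 * Num.sqrt s * 2); last ring.
by rewrite ler_wpM2l ?sum_half// mulr_ge0// sqrtr_ge0.
Qed.

End Endpoints.

(** * The profile of the endpoint kernel *)

Section HatKernel.
Context {R : realType}.
Local Notation line := (lebesgue_line R).

(** Up to a constant, a bound at [x] for the endpoint kernel applied to a weight of mass [E]; the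
    two members agree where [delta x = E]. *)
Definition end_profile (E x : R) : R :=
  Num.min (E / delta x) (Num.sqrt E / Num.sqrt (delta x)).

Lemma end_profile_ge0 E (x : R) : 0 <= E -> dom x -> 0 <= end_profile E x.
Proof.
by move=> E0 dx; rewrite le_min !divr_ge0 ?sqrtr_ge0// ltW// delta_gt0.
Qed.

Lemma measurable_end_profile E : measurable_fun dom (fun x : line => end_profile E x).
Proof.
apply: measurable_minr; apply: measurable_funM.
- exact: measurable_cst.
- by apply: measurable_funV; exact: measurable_delta.
- exact: measurable_cst.
- exact: measurable_rsqrt_delta.
Qed.

Let measurable_near_indic r : measurable_fun dom (\1_(near_end r) : line -> R).
Proof. by apply: measurable_indic; exact: measurable_near_end. Qed.

Lemma integral_end_profile_sqrt (phi : line -> R) (E s : R) : 0 < E -> 0 < s ->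
  weight_le phi s ->
  (\int[mu]_(x in dom) (phi x * end_profile E x)%:E <= (9 * Num.sqrt E * Num.sqrt s)%:E)%E.
Proof.
move=> E0 s0 w; have [mphi phi01 phis] := w.
have phi0 x : dom x -> 0 <= phi x by move=> /phi01/andP[].
have mq : measurable_fun dom (fun x : line => phi x / Num.sqrt (delta x)).
  by apply: measurable_funM; [exact: mphi|exact: measurable_rsqrt_delta].
apply: (@le_trans _ _ (\int[mu]_(x in dom) ((Num.sqrt E)%:E * (phi x / Num.sqrt (delta x))%:E))%E).
  apply: ge0_le_integral.
  - exact: measurable_dom.
  - by move=> x dx; rewrite lee_fin mulr_ge0 ?phi0 ?end_profile_ge0// ltW.
  - by apply/measurable_EFinP; apply: measurable_funM; [exact: mphi|exact: measurable_end_profile].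
  - by apply: emeasurable_funM; [exact: measurable_cst|exact/measurable_EFinP].
  - by move=> x dx; rewrite -EFinM lee_fin mulrCA ler_wpM2l ?phi0// ge_min lexx orbT.
rewrite ge0_integralZl_EFin; [|exact: measurable_dom
  |by move=> x dx; rewrite lee_fin divr_ge0 ?phi0 ?sqrtr_ge0|exact/measurable_EFinP|exact: sqrtr_ge0].
rewrite mulrAC mulrC EFinM; apply: lee_wpmul2l; first by rewrite lee_fin sqrtr_ge0.
exact: integral_rsqrt_delta.
Qed.

(** Three ranges: [delta x < E], where the square root is used; [d] dyadic shells, where [E / delta]
    halves from one to the next; and the rest, where it is at most [2 ^- d]. *)
Lemma end_profile_le E d (x : R) : 0 < E -> dom x ->
  end_profile E x <= Num.sqrt E * (\1_(near_end E) x / Num.sqrt (delta x)) +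
    (\sum_(i < d) 2 ^- i * \1_(near_end (E * 2 ^+ i.+1)) x + 2 ^- d).
Proof.
move=> E0 dx; have d0 := delta_gt0 dx.
have S0 i : 0 <= (2 : R) ^- i * \1_(near_end (E * 2 ^+ i.+1)) x.
  by rewrite mulr_ge0// ?invr_ge0 ?exprn_ge0// indicE ler0n.
have T0 : 0 <= \sum_(i < d) (2 : R) ^- i * \1_(near_end (E * 2 ^+ i.+1)) x by apply: sumr_ge0.
have [dE|Ed] := ltP (delta x) E.
  rewrite [X in _ * (X / _)]indicE mem_set; last by split.
  rewrite mul1r ge_min; apply/orP; right; rewrite lerDl addr_ge0// invr_ge0 exprn_ge0//.
rewrite [X in _ * (X / _)]indicE memNset ?mul0r ?mulr0 ?add0r; last by rewrite /near_end /= => -[_]; rewrite ltNge Ed.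
rewrite ge_min; apply/orP; left.
have [h|h] := leP (E * 2 ^+ d) (delta x).
  rewrite (@le_trans _ _ (2 ^- d))// ?lerDr//.
  by rewrite ler_pdivrMr// mulrC ler_pdivlMr ?exprn_gt0.
have ex : exists k, delta x < E * 2 ^+ k by exists d.
have [[|k] hk kmin] := ex_minnP ex.
  by move: hk; rewrite expr0 mulr1 ltNge Ed.
have kd : (k < d)%N by apply: kmin.
have lo : E * 2 ^+ k <= delta x by rewrite leNgt; apply/negP => /kmin; rewrite ltnn.
apply: (@le_trans _ _ (2 ^- k * \1_(near_end (E * 2 ^+ k.+1)) x)).
  rewrite indicE mem_set ?mulr1; last by split.
  by rewrite ler_pdivrMr// mulrC ler_pdivlMr ?exprn_gt0.
rewrite (bigD1 (Ordinal kd))//= -addrA lerDl.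
by apply: addr_ge0; [apply: sumr_ge0|rewrite invr_ge0 exprn_ge0].
Qed.

(** Each of the [d] shells contributes the same [4 E], which is the logarithm. The region beyond the
    shells costs [2 ^- d] times the mass, that is [E], and the part with [delta x < E] has mass at
    most [2 E] and costs [18 E]. *)
Lemma integral_end_profile_log (phi : line -> R) (E : R) d : 0 < E ->
  weight_le phi (E * 2 ^+ d) ->
  (\int[mu]_(x in dom) (phi x * end_profile E x)%:E <= ((19 + 4 * d%:R) * E)%:E)%E.
Proof.
move=> E0 [mphi phi01 phis].
have phi0 x : dom x -> 0 <= phi x by move=> /phi01/andP[].
have i0 r x : 0 <= \1_(near_end r) x :> R by rewrite indicE ler0n.
have pE r : measurable_fun dom (fun x => phi x * \1_(near_end r) x).
  by apply: measurable_funM; [exact: mphi|exact: measurable_near_indic].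
pose F (x : line) := ((Num.sqrt E)%:E * (phi x * \1_(near_end E) x / Num.sqrt (delta x))%:E)%E.
pose H i (x : line) := (((2 : R) ^- i)%:E * (phi x * \1_(near_end (E * 2 ^+ i.+1)) x)%:E)%E.
pose K (x : line) := (((2 : R) ^- d)%:E * (phi x)%:E)%E.
have mF' : measurable_fun dom (fun x : line => (phi x * \1_(near_end E) x / Num.sqrt (delta x))%:E).
  by apply/measurable_EFinP; apply: measurable_funM; [exact: pE|exact: measurable_rsqrt_delta].
have mF : measurable_fun dom F.
  by apply: emeasurable_funM; [exact: measurable_cst|exact: mF'].
have mH i : measurable_fun dom (H i).
  by apply: emeasurable_funM; [exact: measurable_cst|apply/measurable_EFinP; exact: pE].
have mK : measurable_fun dom K.
  by apply: emeasurable_funM; [exact: measurable_cst|apply/measurable_EFinP; exact: mphi].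
have F0 x : dom x -> (0 <= F x)%E.
  move=> dx; rewrite /F mule_ge0// lee_fin ?sqrtr_ge0//.
  by rewrite divr_ge0 ?sqrtr_ge0// mulr_ge0 ?phi0.
have H0 i x : dom x -> (0 <= H i x)%E.
  by move=> dx; rewrite /H mule_ge0// lee_fin ?invr_ge0 ?exprn_ge0// mulr_ge0 ?phi0.
have K0 x : dom x -> (0 <= K x)%E.
  by move=> dx; rewrite /K mule_ge0// lee_fin ?invr_ge0 ?exprn_ge0// phi0.
have mSH : measurable_fun dom (fun x => \sum_(i < d) H i x)%E.
  by apply: emeasurable_sum => i; exact: mH.
have SH0 x : dom x -> (0 <= \sum_(i < d) H i x)%E.
  by move=> dx; apply: sume_ge0 => i _; exact: H0.
apply: (@le_trans _ _ (\int[mu]_(x in dom) (F x + (\sum_(i < d) H i x + K x)))%E).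
  apply: ge0_le_integral.
  - exact: measurable_dom.
  - by move=> x dx; rewrite lee_fin mulr_ge0 ?phi0 ?end_profile_ge0// ltW.
  - by apply/measurable_EFinP; apply: measurable_funM; [exact: mphi|exact: measurable_end_profile].
  - by apply: emeasurable_funD; [exact: mF|apply: emeasurable_funD; [exact: mSH|exact: mK]].
  - move=> x dx; rewrite /F /H /K -!EFinM sumEFin -!EFinD lee_fin.
    rewrite (le_trans (ler_wpM2l (phi0 _ dx) (end_profile_le d E0 dx)))//.
    rewrite le_eqVlt; apply/orP; left; apply/eqP.
    rewrite !mulrDr mulr_sumr; congr (_ + (_ + _)); [ring| |ring].
    by apply: eq_bigr => i _; ring.
rewrite ge0_integralD; [|exact: measurable_dom|exact: F0|exact: mF
  |by move=> x dx; rewrite adde_ge0 ?SH0 ?K0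
  |by apply: emeasurable_funD; [exact: mSH|exact: mK]].
rewrite ge0_integralD; [|exact: measurable_dom|exact: SH0|exact: mSH|exact: K0|exact: mK].
rewrite (_ : (19 + 4 * d%:R) * E = 18 * E + (d%:R * (4 * E) + E)); last ring.
rewrite 2!EFinD; apply: leeD; [|apply: leeD].
- rewrite /F ge0_integralZl_EFin; [|exact: measurable_dom| |exact: mF'|exact: sqrtr_ge0]; last first.
    by move=> x dx; rewrite lee_fin divr_ge0 ?sqrtr_ge0// mulr_ge0 ?phi0.
  have w : weight_le (fun x => phi x * \1_(near_end E) x) (2 * E).
    split; [exact: pE| |exact: mu_weight_near_end].
    move=> x dx; rewrite mulr_ge0 ?phi0//= (le_trans _ (_ : phi x <= 1))//; last by case/andP: (phi01 x dx).
    by rewrite ler_piMr ?phi0// indicE; case: (_ \in _).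
  have E2 : 0 < 2 * E by rewrite mulr_gt0.
  apply: le_trans (lee_wpmul2l _ (integral_rsqrt_delta E2 w)) _; first by rewrite lee_fin sqrtr_ge0.
  rewrite -EFinM lee_fin.
  have h : Num.sqrt (2 * E) <= 2 * Num.sqrt E.
    rewrite -[X in _ <= X * _]ger0_norm// -sqrtr_sqr -sqrtrM ?sqr_ge0// ler_wsqrtr// ler_pM2r//.
    by rewrite expr2; lra.
  apply: le_trans (_ : _ <= Num.sqrt E * (9 * (2 * Num.sqrt E))) _.
    by rewrite ler_wpM2l ?sqrtr_ge0// ler_wpM2l.
  rewrite -[X in _ <= 18 * X](sqr_sqrtr (ltW E0)) le_eqVlt; apply/orP; left; apply/eqP; ring.
- rewrite ge0_integral_sum; [|exact: measurable_dom|by move=> i; exact: mH|by move=> i x dx; exact: H0].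
  have -> : d%:R * (4 * E) = \sum_(i < d) (4 * E) by rewrite sumr_const card_ord mulr_natl.
  rewrite -sumEFin.
  apply: lee_sum => i _; rewrite /H ge0_integralZl_EFin; [|exact: measurable_dom
    |by move=> x dx; rewrite lee_fin mulr_ge0 ?phi0|by apply/measurable_EFinP; exact: pE|by rewrite invr_ge0 exprn_ge0].
  have si : 0 < E * 2 ^+ i.+1 by rewrite mulr_gt0// exprn_gt0.
  apply: le_trans (lee_wpmul2l _ (mu_weight_near_end si mphi phi01)) _.
    by rewrite lee_fin invr_ge0 exprn_ge0.
  rewrite -EFinM lee_fin exprS le_eqVlt; apply/orP; left; apply/eqP; field.
  by rewrite expf_neq0.
- rewrite /K ge0_integralZl_EFin; [|exact: measurable_dom
    |by move=> x dx; rewrite lee_fin phi0|by apply/measurable_EFinP; exact: mphi|by rewrite invr_ge0 exprn_ge0].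
  apply: le_trans (lee_wpmul2l _ phis) _; first by rewrite lee_fin invr_ge0 exprn_ge0.
  by rewrite -EFinM lee_fin mulrC mulfK// expf_neq0.
Qed.

End HatKernel.

(** * Pieces of level-set size *)

Section Piece.
Context {R : realType}.
Local Notation line := (lebesgue_line R).

(** A truncation of T^ without the factor [- pi^-1], which [hat_pv] restores. *)
Definition hat_trunc (e : R) (psi : line -> R) (x : R) : R :=
  (Num.sqrt (delta x))^-1 *
  \int[mu]_(t in dom) (Num.sqrt (delta t) * psi t * cutoff_inv e x t).

Lemma sqrt_delta_gt0 (x : R) : dom x -> 0 < Num.sqrt (delta x).
Proof. by move=> dx; rewrite sqrtr_gt0 delta_gt0. Qed.

Lemma measurable_sqrt_delta : measurable_fun dom (fun x : line => Num.sqrt (delta x)).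
Proof.
apply: (measurableT_comp (continuous_measurable_fun _) measurable_delta).
exact: sqrt_continuous.
Qed.

Lemma bmf_sqrt_delta : bmf (fun x : line => Num.sqrt (delta x)).
Proof.
split; first exact: measurable_sqrt_delta.
exists 1 => x dx; rewrite ger0_norm ?sqrtr_ge0// -[leRHS]sqrtr1 ler_wsqrtr//.
by rewrite /delta gerBl sqr_ge0.
Qed.

Lemma weight_le_bmf (phi : line -> R) s : weight_le phi s -> bmf phi.
Proof.
move=> [mphi phi01 _]; split; first exact: mphi.
by exists 1 => x /phi01/andP[p0 p1]; rewrite ger0_norm.
Qed.

Lemma weight_le_Rintegral (phi : line -> R) s : weight_le phi s ->
  \int[mu]_(x in dom) phi x <= s.
Proof.
move=> w; rewrite -lee_fin EFin_Rintegral_bmf; last exact: weight_le_bmf w.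
by case: w.
Qed.

(** The size of [(sqrt (delta t) / sqrt (delta x) - 1) / (t - x)] after cancellation of [t - x],
    with [|t + x|] replaced by 2. *)
Definition end_ker (x t : R) : R :=
  2 / (Num.sqrt (delta x) * (Num.sqrt (delta t) + Num.sqrt (delta x))).

Lemma end_ker_ge0 x t : 0 <= end_ker x t.
Proof. by rewrite divr_ge0// mulr_ge0 ?addr_ge0 ?sqrtr_ge0. Qed.

Lemma end_ker_le1 x t : dom x -> end_ker x t <= 2 / delta x.
Proof.
move=> dx; have d0 := sqrt_delta_gt0 dx.
rewrite /end_ker ler_wpM2l// lef_pV2 ?posrE ?delta_gt0//; last first.
  by rewrite mulr_gt0// ltr_wpDl// sqrtr_ge0.
by rewrite -{1}(sqr_sqrtr (ltW (delta_gt0 dx))) expr2 ler_pM2l// lerDr sqrtr_ge0.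
Qed.

Lemma end_ker_le2 x t : dom x -> dom t ->
  end_ker x t <= 2 / Num.sqrt (delta x) * (Num.sqrt (delta t))^-1.
Proof.
move=> dx dt; have d0 := sqrt_delta_gt0 dx; have t0 := sqrt_delta_gt0 dt.
rewrite /end_ker invfM mulrA ler_pM2l ?divr_gt0//.
by rewrite lef_pV2 ?posrE ?addr_gt0// lerDl ltW.
Qed.

Lemma bmf_end_ker x : dom x -> bmf (end_ker x).
Proof.
move=> dx; split; last first.
  by exists (2 / delta x) => t _; rewrite ger0_norm ?end_ker_ge0 ?end_ker_le1.
apply: measurable_funM; first exact: measurable_cst.
apply: measurable_funV; apply: measurable_funM; first exact: measurable_cst.
by apply: measurable_funD; [exact: measurable_sqrt_delta|exact: measurable_cst].
Qed.

(** Dropping one or the other summand of [sqrt (delta t) + sqrt (delta x)] in the kernel yields the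
    two members of [end_profile]. In the second case [18 = 2 * 9], with [9] from
    [integral_rsqrt_delta]. *)
Lemma Rintegral_end_ker (psi : line -> R) (E x : R) : 0 < E -> dom x ->
  weight_le psi E ->
  \int[mu]_(t in dom) (psi t * end_ker x t) <= 18 * end_profile E x.
Proof.
move=> E0 dx w; have d0 := sqrt_delta_gt0 dx; have dd := delta_gt0 dx.
have bpsi := weight_le_bmf w; have bk := bmf_end_ker dx.
have [mpsi psi01 psiE] := w.
have psi0 t : dom t -> 0 <= psi t by move=> /psi01/andP[].
have bpk := bmfM bpsi bk.
rewrite /end_profile; case: (leP (E / delta x)) => _.
  apply: (@le_trans _ _ (\int[mu]_(t in dom) (2 / delta x * psi t))).
    apply: le_Rintegral_bmf; [exact: bpk|apply: bmfM; [exact: bmf_cst|exact: bpsi]|].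
    by move=> t dt; rewrite mulrC ler_wpM2r ?psi0// end_ker_le1.
  rewrite RintegralZ_bmf//.
  have := weight_le_Rintegral w; set I := Rintegral _ _ _ => IE.
  rewrite mulrAC [18 * _]mulrA ler_pM2r ?invr_gt0//.
  by rewrite (@le_trans _ _ (2 * E))// ?ler_pM2l// ler_pM2r//; lra.
rewrite -lee_fin EFin_Rintegral_bmf//.
have mq : measurable_fun dom (fun x : line => psi x / Num.sqrt (delta x)).
  by apply: measurable_funM; [exact: mpsi|exact: measurable_rsqrt_delta].
apply: (@le_trans _ _ (\int[mu]_(t in dom)
    ((2 / Num.sqrt (delta x))%:E * (psi t / Num.sqrt (delta t))%:E))%E).
  apply: ge0_le_integral.
  - exact: measurable_dom.
  - by move=> t dt; rewrite lee_fin mulr_ge0 ?psi0 ?end_ker_ge0.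
  - by apply/measurable_EFinP; case: bpk.
  - by apply: emeasurable_funM; [exact: measurable_cst|exact/measurable_EFinP].
  - move=> t dt; rewrite -EFinM lee_fin [leRHS]mulrCA ler_wpM2l ?psi0//.
    exact: end_ker_le2.
rewrite ge0_integralZl_EFin; [|exact: measurable_dom
  |by move=> t dt; rewrite lee_fin divr_ge0 ?psi0 ?sqrtr_ge0|exact/measurable_EFinP
  |by rewrite divr_ge0 ?sqrtr_ge0].
apply: le_trans (lee_wpmul2l _ (integral_rsqrt_delta E0 w)) _.
  by rewrite lee_fin divr_ge0 ?sqrtr_ge0.
by rewrite -EFinM lee_fin le_eqVlt; apply/orP; left; apply/eqP; field; rewrite gt_eqF.
Qed.

(* [sqrt (delta t) / sqrt (delta x) - 1] vanishes on the diagonal, because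
   [delta t - delta x = (x - t) (x + t)]. *)
Lemma hat_kernel_diff (e x t : R) : 0 < e -> dom x -> dom t ->
  `|(Num.sqrt (delta t) / Num.sqrt (delta x) - 1) * cutoff_inv e x t| <= end_ker x t.
Proof.
move=> e0 dx dt; have d0 := sqrt_delta_gt0 dx; have t0 := sqrt_delta_gt0 dt.
rewrite /cutoff_inv; case: ifPn => [h|_]; last by rewrite mulr0 normr0 end_ker_ge0.
have tx : t - x != 0 by rewrite -normr_gt0 (lt_trans e0).
have sq : (Num.sqrt (delta t) - Num.sqrt (delta x)) *
    (Num.sqrt (delta t) + Num.sqrt (delta x)) = - (t - x) * (t + x).
  rewrite -subr_sqr !sqr_sqrtr ?ltW ?delta_gt0// /delta; ring.
have -> : (Num.sqrt (delta t) / Num.sqrt (delta x) - 1) * (t - x)^-1 =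
  - (t + x) / (Num.sqrt (delta x) * (Num.sqrt (delta t) + Num.sqrt (delta x))).
  have s0 : Num.sqrt (delta t) + Num.sqrt (delta x) != 0 by rewrite gt_eqF// addr_gt0.
  have -> : Num.sqrt (delta t) / Num.sqrt (delta x) - 1 =
    - (t - x) * (t + x) / ((Num.sqrt (delta t) + Num.sqrt (delta x)) * Num.sqrt (delta x)).
    by rewrite -sq; field; rewrite s0 gt_eqF.
  by field; rewrite tx s0 gt_eqF.
rewrite normrM normrN normfV [X in _ / X]ger0_norm; last by rewrite mulr_ge0 ?addr_ge0 ?sqrtr_ge0.
rewrite ler_wpM2r ?invr_ge0 ?mulr_ge0 ?addr_ge0 ?sqrtr_ge0//.
move/domP: dx => /andP[? ?]; move/domP: dt => /andP[? ?].
by rewrite ler_norml; apply/andP; split; lra.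
Qed.

Lemma hat_trunc_le (e : R) (psi : line -> R) (x : R) : 0 < e -> dom x -> bmf psi ->
  `|hat_trunc e psi x| <= `|\int[mu]_(t in dom) (psi t * cutoff_inv e x t)|
    + \int[mu]_(t in dom) (`|psi t| * end_ker x t).
Proof.
move=> e0 dx bpsi; have d0 := sqrt_delta_gt0 dx.
have bC : bmf (cutoff_inv e x) by exact: bmf_cutoff_inv.
have bpC := bmfM bpsi bC; have bk := bmf_end_ker dx.
pose D (t : line) := psi t * ((Num.sqrt (delta t) / Num.sqrt (delta x) - 1) * cutoff_inv e x t).
have bD : bmf D.
  apply: bmfM; first exact: bpsi.
  apply: bmfM; last exact: bC.
  apply: bmfD; last exact: (bmf_cst (-1)).
  by apply: bmfM; [exact: bmf_sqrt_delta|exact: bmf_cst].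
have -> : hat_trunc e psi x = \int[mu]_(t in dom) (psi t * cutoff_inv e x t) +
    \int[mu]_(t in dom) D t.
  rewrite -RintegralD; [|exact: measurable_dom|exact: bmf_integrable|exact: bmf_integrable].
  rewrite /hat_trunc -RintegralZ_bmf; last first.
    by apply: bmfM; [apply: bmfM; [exact: bmf_sqrt_delta|exact: bpsi]|exact: bC].
  by apply: eq_Rintegral => t _; rewrite /D; ring.
apply: (le_trans (ler_normD _ _)); rewrite lerD2l.
apply: (le_trans (norm_Rintegral_bmf bD)); apply: le_Rintegral_bmf.
- exact: bmf_norm.
- by apply: bmfM; [exact: bmf_norm|exact: bk].
- by move=> t dt; rewrite normrM ler_wpM2l// hat_kernel_diff.
Qed.

(** For [n > m] the true gain is [2 ^ (- (n - m) / 2)]; the rounding [3/4] satisfies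
    [(3/4)^2 >= 1/2] and leaves room for a growth of ratio [7/6]. *)
Definition kappa (n m : nat) : R :=
  if (n <= m)%N then (m - n).+1%:R else (3 / 4) ^+ (n - m).

Lemma kappa_ge0 n m : 0 <= kappa n m.
Proof. by rewrite /kappa; case: ifP => // _; rewrite exprn_ge0. Qed.

Lemma pow_half_split (a d : nat) : (2 : R) / 2 ^+ a = 2 / 2 ^+ (a + d) * 2 ^+ d.
Proof. by rewrite exprD invfM mulrA mulfVK// expf_neq0. Qed.

(* The exponent [2 ^ j] and the parameter [r] of [hilbert_trunc_bound] are
   chosen comparable to the logarithm of the ratio of the two masses, resp.
   to a small power of that ratio. *)
Lemma hilbert_part (I J : R) n m : 0 <= I -> 0 <= J -> I <= 2 / 2 ^+ m -> J <= 2 / 2 ^+ n ->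
  exists j r, [/\ (0 < j)%N, 0 < r &
   8 * 2 ^+ j * r * (I + r ^- (2 ^ j) * J) + 12 * Num.min I J <= 280 * 2 ^- m * kappa n m].
Proof.
move=> I0 J0 Im Jn; have m0 : 0 < (2 : R) ^- m by rewrite invr_gt0 exprn_gt0.
rewrite /kappa; case: ifPn => [nm|]; last first.
  rewrite -ltnNge => mn; pose d := (n - m)%N.
  have nE : n = (m + d)%N by rewrite subnKC// ltnW.
  (* With exponent 2 and this [r], the factor [r ^- 2] is at most the mass ratio [2 ^ d], so both
     masses count as [2 * 2 ^- m] and a factor [r] is gained. *)
  pose r : R := (3 / 4) ^+ d; have r0 : 0 < r by rewrite exprn_gt0.
  exists 1%N, r; split=> //; rewrite -/d -/r.
  have J1 : J <= 2 * 2 ^- m * r ^+ 2.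
    rewrite (le_trans Jn)// nE exprD invfM mulrA ler_wpM2l// ?mulr_ge0 ?(ltW m0)//.
    by rewrite -exprM mulnC exprM -exprVn lerXn2r ?nnegrE//; lra.
  have J2 : r ^- (2 ^ 1) * J <= 2 * 2 ^- m.
    by rewrite mulrC ler_pdivrMr ?exprn_gt0.
  have J3 : Num.min I J <= 2 * 2 ^- m * r.
    rewrite ge_min (le_trans J1) ?orbT// ler_wpM2l ?mulr_ge0 ?(ltW m0)//.
    by rewrite expr2 ler_piMl ?(ltW r0)// exprn_ile1//; lra.
  have h : 8 * 2 ^+ 1 * r * (I + r ^- (2 ^ 1) * J) <= 8 * 2 ^+ 1 * r * (2 * 2 ^- m + 2 * 2 ^- m).
    by rewrite ler_wpM2l ?mulr_ge0 ?(ltW r0)// lerD// (le_trans Im).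
  apply: (le_trans (lerD h (ler_wpM2l _ J3))) => //; rewrite expr1.
  have : 0 <= 2 ^- m * r by rewrite mulr_ge0 ?ltW.
  by move: (2 ^- m) => z; nra.
pose d := (m - n)%N; have mE : m = (n + d)%N by rewrite subnKC.
(* [2 ^ j] exceeds [d + 1], so that [4 ^- (2 ^ j)] outweighs the mass ratio [2 ^ d], and is at most
   [2 (d + 1)], so that the bound is linear in [d + 1]. The constant is
   [280 = 8 * 2 * 4 * 4 + 12 * 2]. *)
pose j := (trunc_log 2 d.+1).+1.
have /andP[jl ju] : ((2 ^ (trunc_log 2 d.+1) <= d.+1) && (d.+1 < 2 ^ j))%N by exact: trunc_log_bounds.
exists j, 4; split=> //; rewrite -/d.
have jq : (2 ^+ j : R) <= 2 * d.+1%:R.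
  by rewrite exprS ler_pM2l// -natrX ler_nat.
have J2 : 4 ^- (2 ^ j) * J <= 2 * 2 ^- m.
  rewrite mulrC ler_pdivrMr ?exprn_gt0// (le_trans Jn)// (pow_half_split n d) -mE.
  rewrite ler_wpM2l ?mulr_ge0 ?(ltW m0)//.
  apply: (@le_trans _ _ (4 ^+ d)); first by rewrite lerXn2r ?nnegrE// ler_nat.
  by rewrite ler_weXn2l ?ler1n// ltnW// (leq_trans _ ju)// ltnW.
have h : 8 * 2 ^+ j * 4 * (I + 4 ^- (2 ^ j) * J) <= 8 * (2 * d.+1%:R) * 4 * (2 * 2 ^- m + 2 * 2 ^- m).
  apply: ler_pM.
  - by rewrite !mulr_ge0 ?exprn_ge0.
  - by rewrite addr_ge0// mulr_ge0// invr_ge0 exprn_ge0.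
  - by rewrite ler_pM2r// ler_pM2l.
  - exact: lerD.
have J3 : Num.min I J <= 2 * 2 ^- m * d.+1%:R.
  by rewrite ge_min (le_trans Im)// ler_peMr ?mulr_ge0 ?(ltW m0)// ler1n.
apply: (le_trans (lerD h (ler_wpM2l _ J3))) => //.
have : 0 <= 2 ^- m * (d.+1%:R : R) by rewrite mulr_ge0 ?(ltW m0).
by move: (2 ^- m) (d.+1%:R : R) => z u; nra.
Qed.

Lemma profile_part (phi : line -> R) n m : weight_le phi (2 / 2 ^+ n) ->
  (\int[mu]_(x in dom) (phi x * end_profile (2 / 2 ^+ m) x)%:E <= (38 * 2 ^- m * kappa n m)%:E)%E.
Proof.
move=> w; have p2 k : 0 < (2 : R) / 2 ^+ k by rewrite divr_gt0 ?exprn_gt0.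
have m0 : 0 < (2 : R) ^- m by rewrite invr_gt0 exprn_gt0.
rewrite /kappa; case: ifPn => [nm|].
  pose d := (m - n)%N; have mE : m = (n + d)%N by rewrite subnKC.
  rewrite (pow_half_split n d) -mE in w.
  apply: (le_trans (integral_end_profile_log (p2 m) w)); rewrite -/d lee_fin -[d.+1%:R]natr1.
  by have := ler0n R d; move: (2 ^- m) m0 (d%:R : R) => z z0 u u0; nra.
rewrite -ltnNge => mn; pose d := (n - m)%N.
have nE : n = (m + d)%N by rewrite subnKC// ltnW.
apply: (le_trans (integral_end_profile_sqrt (p2 m) (p2 n) w)); rewrite lee_fin -/d.
have : Num.sqrt ((2 : R) / 2 ^+ n) <= Num.sqrt (2 / 2 ^+ m) * (3 / 4) ^+ d.
  rewrite -[X in _ <= _ * X]ger0_norm ?exprn_ge0// -sqrtr_sqr -sqrtrM ?(ltW (p2 m))//.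
  rewrite ler_wsqrtr// nE exprD invfM mulrA ler_wpM2l ?(ltW (p2 m))//.
  by rewrite -exprM mulnC exprM -exprVn lerXn2r ?nnegrE//; lra.
move=> h; apply: le_trans (ler_wpM2l _ h) _; first by rewrite mulr_ge0 ?sqrtr_ge0.
rewrite mulrA -[9 * _ * _]mulrA -expr2 sqr_sqrtr ?(ltW (p2 m))//.
rewrite ler_wpM2r ?exprn_ge0//; move: (2 ^- m) m0 => z z0; lra.
Qed.

(** The majorant is that of [hilbert_trunc_bound] plus [18] times [end_profile], and it does not
    depend on the test function. The constant rounds up [280 + 18 * 38]. *)
Lemma piece_bound (e : R) (psi : line -> R) (m : nat) : 0 < e -> bmf psi ->
  weight_le (fun x => `|psi x|) (2 / 2 ^+ m) ->
  exists G : line -> R, [/\ measurable_fun dom G, (forall x, dom x -> 0 <= G x),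
    (forall x, dom x -> `|hat_trunc e psi x| <= G x) &
    forall n (phi : line -> R), weight_le phi (2 / 2 ^+ n) ->
    (\int[mu]_(x in dom) (phi x * G x)%:E <= (1000 * 2 ^- m * kappa n m)%:E)%E].
Proof.
move=> e0 bpsi w; pose E : R := 2 / 2 ^+ m.
have E0 : 0 < E by rewrite divr_gt0 ?exprn_gt0.
have psi1 x : dom x -> `|psi x| <= 1 by case: w => _ h _ /h/andP[].
have [G [bG G0 GT GI]] := hilbert_trunc_bound e0 bpsi psi1.
have P0 x : dom x -> 0 <= end_profile E x by move=> dx; rewrite end_profile_ge0// ltW.
have mP := measurable_end_profile E.
have mG : measurable_fun dom G by case: bG.
exists (fun x => G x + 18 * end_profile E x); split.
- apply: measurable_funD; first exact: mG.
  by apply: measurable_funM; [exact: measurable_cst|exact: mP].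
- by move=> x dx; rewrite addr_ge0// mulr_ge0// P0.
- move=> x dx; apply: (le_trans (hat_trunc_le e0 dx bpsi)).
  by apply: lerD; [exact: GT|exact: Rintegral_end_ker].
move=> n phi wphi; have bphi := weight_le_bmf wphi; have [mphi phi01 _] := wphi.
have phi0 x : dom x -> 0 <= phi x by move=> /phi01/andP[].
have mphiP : measurable_fun dom (fun x : line => phi x * end_profile E x).
  by apply: measurable_funM; [exact: mphi|exact: mP].
have -> : (\int[mu]_(x in dom) (phi x * (G x + 18 * end_profile E x))%:E =
  \int[mu]_(x in dom) (phi x * G x)%:E + 18%:E * \int[mu]_(x in dom) (phi x * end_profile E x)%:E)%E.
  rewrite -ge0_integralZl_EFin; [|exact: measurable_dom
    |by move=> x dx; rewrite lee_fin mulr_ge0 ?phi0 ?P0|exact/measurable_EFinP|by []].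
  rewrite -ge0_integralD; [|exact: measurable_dom
    |by move=> x dx; rewrite lee_fin mulr_ge0 ?phi0
    |by apply/measurable_EFinP; apply: measurable_funM; [exact: mphi|exact: mG]
    |by move=> x dx; rewrite -EFinM lee_fin !mulr_ge0 ?phi0 ?P0
    |by apply: emeasurable_funM; [exact: measurable_cst|exact/measurable_EFinP]].
  by apply: eq_integral => x _; rewrite -EFinM -EFinD; congr (_%:E); ring.
have [||||j [r [j0 r0 jr]]] := @hilbert_part (\int[mu]_(x in dom) `|psi x|) (\int[mu]_(x in dom) phi x) n m.
- by apply: Rintegral_ge0.
- by apply: Rintegral_ge0 => x dx; exact: phi0.
- exact: weight_le_Rintegral w.
- exact: weight_le_Rintegral wphi.
have hT : (\int[mu]_(x in dom) (phi x * G x)%:E <= (280 * 2 ^- m * kappa n m)%:E)%E.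
  rewrite -EFin_Rintegral_bmf; last by apply: bmfM; [exact: bphi|exact: bG].
  by rewrite lee_fin (le_trans (GI _ bphi phi01 j r j0 r0)).
have hS := lee_wpmul2l (_ : 0 <= 18%:E)%E (profile_part m wphi).
apply: (le_trans (leeD hT (hS _))); first by rewrite lee_fin.
rewrite -EFinM -EFinD lee_fin.
have : 0 <= 2 ^- m * kappa n m by rewrite mulr_ge0 ?kappa_ge0// invr_ge0 exprn_ge0.
by rewrite -!mulrA; move: (2 ^- m * kappa n m) => z; lra.
Qed.

End Piece.

(** * Rearrangements and logarithmic weights *)

Section Weights.
Context {R : realType}.
Variable beta : R.
Hypothesis beta0 : 0 <= beta.

(** An upper bound of the weight [ln (2 e / t) ^ beta] for [t >= 2 / 2 ^ (n + 1)]. *)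
Definition wlevel (n : nat) : R := (n.+2%:R : R) `^ beta.

(** The increments, starting with the whole of [wlevel 0], majorize the weight by a superposition of
    indicators of the intervals [(0, 2 / 2 ^ n)]. *)
Definition wstep (n : nat) : R := wlevel n - (if n is n'.+1 then wlevel n' else 0).

Lemma wlevel_ge0 n : 0 <= wlevel n. Proof. exact: powR_ge0. Qed.

Lemma le_wlevel n p : (n <= p)%N -> wlevel n <= wlevel p.
Proof. by move=> np; apply: ge0_ler_powR; rewrite ?nnegrE ?ler0n// ler_nat. Qed.

Lemma wstep_ge0 n : 0 <= wstep n.
Proof.
by case: n => [|n]; rewrite /wstep ?subr0 ?wlevel_ge0// subr_ge0 le_wlevel.
Qed.

Lemma wstep_le n : wstep n <= wlevel n.
Proof. by case: n => [|n]; rewrite /wstep ?subr0// gerBl wlevel_ge0. Qed.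

Lemma sum_wstep n : \sum_(0 <= i < n.+1) wstep i = wlevel n.
Proof.
elim: n => [|n IH]; first by rewrite big_nat1 /wstep subr0.
by rewrite big_nat_recr//= IH /wstep addrC subrK.
Qed.

Lemma expR_half_le2 : expR (2^-1 : R) <= 2.
Proof.
have h : (2^-1 : R) <= expR (- 2^-1) by rewrite (le_trans _ (expR_ge1Dx _))//; lra.
by rewrite expRN lef_pV2 ?posrE ?expR_gt0// in h.
Qed.

Lemma two_le_e : (2 : R) <= expR 1.
Proof. by rewrite (le_trans _ (expR_ge1Dx _))// -natrD. Qed.

Lemma ln_weight_le (t : R) n : 0 < t -> 2 / 2 ^+ n.+1 <= t -> ln (2 * expR 1 / t) <= n.+2%:R.
Proof.
move=> t0 nt; rewrite -[leRHS]expRK ler_ln ?posrE ?expR_gt0 ?divr_gt0 ?mulr_gt0 ?expR_gt0//.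
rewrite ler_pdivrMr// -[n.+2%:R]mulr1 expRM_natl exprS mulrC -mulrA ler_pM2l ?expR_gt0//.
rewrite -ler_pdivrMl ?exprn_gt0 ?expR_gt0// (le_trans _ nt)// mulrC ler_wpM2l//.
by rewrite lef_pV2 ?posrE ?exprn_gt0 ?expR_gt0// lerXn2r ?nnegrE ?two_le_e// ltW// expR_gt0.
Qed.

(** Instead of the value of [ln 2], only [sqrt e <= 2] is used. The lost factor 2 reappears as
    [2 ^ (1 + beta)] in [sum_wstep_level_bound]. *)
Lemma ln_weight_ge (t : R) m : 0 < t -> t <= 2 / 2 ^+ m -> m.+1%:R / 2 <= ln (2 * expR 1 / t).
Proof.
move=> t0 tm; rewrite -[leLHS]expRK ler_ln ?posrE ?expR_gt0 ?divr_gt0 ?mulr_gt0 ?expR_gt0//.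
rewrite expRM_natl ler_pdivlMr//.
apply: (@le_trans _ _ (expR 1 * 2 ^+ m * (2 / 2 ^+ m))).
  apply: ler_pM; [by rewrite exprn_ge0// expR_ge0|exact: ltW| |exact: tm].
  rewrite exprS ler_pM ?exprn_ge0 ?(ltW (expR_gt0 _))//; first by rewrite ler_expR; lra.
  by rewrite lerXn2r ?nnegrE ?(ltW (expR_gt0 _))// expR_half_le2.
rewrite le_eqVlt; apply/orP; left; apply/eqP; field.
by rewrite expf_neq0.
Qed.

Lemma dyadic_bracket (t : R) : 0 < t -> t < 2 ->
  exists n, 2 / 2 ^+ n.+1 <= t /\ t < 2 / 2 ^+ n.
Proof.
move=> t0 t2.
have ex : exists k, (2 : R) / 2 ^+ k <= t.
  pose k := (Num.bound (2 / t)); exists k.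
  have h : 2 / t < k%:R by rewrite archi_boundP// divr_ge0// ltW.
  rewrite ler_pdivrMr ?exprn_gt0// mulrC -ler_pdivrMr// (le_trans (ltW h))//.
  by rewrite -natrX ler_nat ltnW// ltn_expl.
have [[|k] hk kmin] := ex_minnP ex.
  by move: hk; rewrite expr0 divr1 leNgt t2.
by exists k; split => //; rewrite ltNge; apply/negP => /kmin; rewrite ltnn.
Qed.

Lemma powR_geometric : exists2 A : R, 0 <= A &
  forall j : nat, (j.+3%:R : R) `^ beta <= A * (7 / 6) ^+ j.
Proof.
(* From [y <= eta^-1 * exp (eta * y)] the [beta]-th power grows with rate [eta * beta], which is
   below [ln (7/6)]; the [+ 1] includes [beta = 0]. The ratio [7/6] is chosen because
   [7/6 * 3/4 = 7/8] is still below 1. *)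
pose eta : R := ln (7 / 6) / (beta + 1).
have b1 : 0 < beta + 1 by rewrite ltr_wpDl.
have l0 : 0 < ln (7 / 6 : R) by rewrite ln_gt0//; lra.
have e0 : 0 < eta by rewrite divr_gt0.
exists (eta^-1 `^ beta * (7 / 6) ^+ 3); first by rewrite mulr_ge0 ?powR_ge0// exprn_ge0.
move=> j; rewrite -mulrA -exprD addnC addn3.
have h : j.+3%:R <= eta^-1 * expR (eta * j.+3%:R).
  rewrite -ler_pdivrMl ?invr_gt0// invrK (le_trans _ (expR_ge1Dx _))//.
  by rewrite lerDr.
have {}h := ge0_ler_powR beta0 (_ : _ \in Num.nneg) (_ : _ \in Num.nneg) h.
apply: le_trans (h _ _) _; rewrite ?nnegrE ?mulr_ge0 ?invr_ge0 ?(ltW e0) ?expR_ge0//.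
rewrite powRM ?invr_ge0 ?(ltW e0) ?expR_ge0// ler_wpM2l ?powR_ge0//.
rewrite -expRM -[X in _ <= X ^+ _](@lnK _ (7 / 6 : R)) ?posrE//.
rewrite -expRM_natl ler_expR.
have -> : eta * j.+3%:R * beta = j.+3%:R * ln (7 / 6) * (beta / (beta + 1)) :> R.
  by rewrite /eta; ring.
by rewrite ler_piMr ?mulr_ge0 ?(ltW l0)// ler_pdivrMr// mul1r lerDl.
Qed.

(** The loss of one logarithm occurs here. For [n <= m], [kappa] is at most [m + 1] and the
    increments telescope to [wlevel m]. For [n = m + 1 + j], the inequality
    [m + j + 3 <= (m + 1) (j + 3)] separates the power of [m + 1] from a series in [j], of ratio
    [7/8] and sum [8]. *)
Lemma sum_wstep_kappa : exists2 C : R, 0 <= C &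
  forall m N, \sum_(0 <= n < N) wstep n * kappa n m <= C * (m.+1%:R : R) `^ (1 + beta).
Proof.
have [A A0 hA] := powR_geometric; exists (2 `^ beta + 8 * A).
  by rewrite addr_ge0 ?powR_ge0// mulr_ge0.
move=> m N.
have m1 : 0 <= (m.+1%:R : R) `^ beta by exact: powR_ge0.
have wk0 n : 0 <= wstep n * kappa n m by rewrite mulr_ge0 ?wstep_ge0 ?kappa_ge0.
have split2 (p q : nat) : (p.+1 * q.+1 >= p + q.+1)%N by lia.
have powS : (m.+1%:R : R) `^ (1 + beta) = m.+1%:R * m.+1%:R `^ beta.
  by rewrite powRD ?powRr1//; apply/implyP => _; rewrite pnatr_eq0.
apply: (@le_trans _ _ (\sum_(0 <= n < m.+1 + N) wstep n * kappa n m)).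
  rewrite addnC [leRHS](big_cat_nat _ (n := N))//= ?leq_addr// lerDl; apply: sumr_ge0 => n _; exact: wk0.
rewrite (big_cat_nat _ (n := m.+1))//= ?leq_addr// mulrDl; apply: lerD.
  apply: (@le_trans _ _ (\sum_(0 <= n < m.+1) wstep n * m.+1%:R)).
    rewrite !big_nat; apply: ler_sum => n /andP[_ nm].
    by rewrite ler_wpM2l ?wstep_ge0// /kappa -ltnS nm ler_nat ltnS leq_subr.
  rewrite -mulr_suml sum_wstep powS mulrC mulrCA ler_wpM2l ?ler0n//.
  rewrite -powRM ?ler0n// ge0_ler_powR ?nnegrE ?mulr_ge0 ?ler0n// -natrM ler_nat; lia.
rewrite -{1}[m.+1]add0n big_addn addKn.
apply: (@le_trans _ _ (\sum_(0 <= j < N) (A * m.+1%:R `^ beta) * (7 / 8) ^+ j)).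
  apply: ler_sum => j _.
  have -> : kappa (j + m.+1) m = (3 / 4) ^+ j.+1 :> R.
    rewrite /kappa leqNgt addnS ltnS leq_addl /=; congr (_ ^+ _); lia.
  apply: (@le_trans _ _ (wlevel (j + m.+1) * (3 / 4) ^+ j.+1)).
    by rewrite ler_wpM2r ?exprn_ge0// wstep_le.
  have h1 : wlevel (j + m.+1) <= m.+1%:R `^ beta * (j.+3%:R `^ beta).
    rewrite -powRM ?ler0n// ge0_ler_powR ?nnegrE ?mulr_ge0 ?ler0n// -natrM ler_nat; nia.
  apply: le_trans (ler_wpM2r _ h1) _; first by rewrite exprn_ge0.
  have h2 := ler_wpM2l m1 (hA j).
  apply: le_trans (ler_wpM2r _ h2) _; first by rewrite exprn_ge0.
  have -> : (7 / 8 : R) ^+ j = (7 / 6) ^+ j * (3 / 4) ^+ j.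
    by rewrite -exprMn; congr (_ ^+ _); field.
  rewrite [(3 / 4) ^+ j.+1]exprS.
  have : 0 <= A * m.+1%:R `^ beta * ((7 / 6) ^+ j * (3 / 4) ^+ j) by rewrite !mulr_ge0 ?exprn_ge0.
  move: (m.+1%:R `^ beta) ((7 / 6) ^+ j) ((3 / 4) ^+ j) => u v z h.
  have -> : u * (A * v) * (3 / 4 * z) = 3 / 4 * (A * u * (v * z)) by ring.
  by rewrite ler_piMl//; lra.
rewrite -mulr_sumr [8 * A]mulrC -[leRHS]mulrA -[leLHS]mulrA ler_wpM2l//.
rewrite [leRHS]mulrC powS; apply: ler_pM => //.
- by apply: sumr_ge0 => j _; rewrite exprn_ge0.
- by rewrite ler_peMl// ler1n.
- suff -> : \sum_(0 <= j < N) ((7 : R) / 8) ^+ j = 8 - 8 * (7 / 8) ^+ N.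
    by rewrite gerBl mulr_ge0// exprn_ge0.
  elim: (N) => [|k IH]; first by rewrite big_geq// expr0; ring.
  by rewrite big_nat_recr//= IH exprS; field.
Qed.

End Weights.

Section Monotone.
Context d (T : measurableType d) (R : realType) (m : {measure set T -> \bar R}).

(* Unlike [ge0_le_integral], no measurability is required, so that it applies
   to the decreasing rearrangement. *)
Lemma ge0_le_integral_nomeas (D : set T) (f g : T -> \bar R) :
  (forall x, D x -> (0 <= f x)%E) -> (forall x, D x -> (f x <= g x)%E) ->
  (\int[m]_(x in D) f x <= \int[m]_(x in D) g x)%E.
Proof.
move=> f0 fg; rewrite integral_mkcond [leRHS]integral_mkcond.
have p0 x : (0 <= (f \_ D) x)%E by rewrite patchE; case: ifPn => // /set_mem /f0.
have pq x : ((f \_ D) x <= (g \_ D) x)%E.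
  by rewrite !patchE; case: ifPn => // /set_mem /fg.
rewrite !ge0_integralTE//; last by move=> x; exact: le_trans (pq x).
apply: le_ereal_sup => _ [h hf <-]; exists h => // x; exact: le_trans (pq x).
Qed.
End Monotone.

(** * Dyadic level sets and the distribution function *)

Section Levels.
Context {R : realType}.
Local Notation line := (lebesgue_line R).
Implicit Types (f h : line -> R[i]) (l t y : R).

Definition dyad (l : R) (k : nat) : R := l * 2 ^+ k.

Lemma dyad_gt0 l k : 0 < l -> 0 < dyad l k.
Proof. by move=> l0; rewrite /dyad mulr_gt0// exprn_gt0. Qed.

Lemma dyadS l k : dyad l k.+1 = 2 * dyad l k.
Proof. by rewrite /dyad exprS mulrCA. Qed.

Lemma sum_dyad l n : l + \sum_(0 <= k < n) dyad l k = dyad l n.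
Proof.
elim: n => [|n IH]; first by rewrite big_geq// addr0 /dyad expr0 mulr1.
by rewrite big_nat_recr//= addrA IH dyadS; ring.
Qed.

Lemma sum_dyad_le l y n : 0 < l -> 0 <= y ->
  \sum_(0 <= k < n) dyad l k * (dyad l k <= y)%R%:R <= 2 * y.
Proof.
move=> l0 y0; elim: n => [|n IH]; first by rewrite big_geq// mulr_ge0.
rewrite big_nat_recr//=; case: (leP (dyad l n) y) => h; last by rewrite mulr0 addr0.
rewrite mulr1 -lerBrDr (@le_trans _ _ (\sum_(0 <= k < n) dyad l k))//.
  by apply: ler_sum => k _; rewrite ler_piMr ?(ltW (dyad_gt0 _ l0))// lern1 leq_b1.
by have := sum_dyad l n; move: (\sum_(0 <= k < n) dyad l k) => S e; lra.
Qed.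

Lemma cabs_ge0 (z : R[i]) : 0 <= cabs z.
Proof. by case: z => a b; rewrite /cabs /= sqrtr_ge0. Qed.

Lemma measurable_cabs f : cmeasurable f -> measurable_fun dom (fun x => cabs (f x)).
Proof.
move=> [mr mi].
have -> : (fun x => cabs (f x)) =
    (fun x => Num.sqrt (complex.Re (f x) ^+ 2 + complex.Im (f x) ^+ 2)).
  by apply/funext => x; case: (f x).
have mc : measurable_fun [set: R] (@Num.sqrt R).
  by apply: continuous_measurable_fun; exact: sqrt_continuous.
apply: (measurableT_comp mc).
by apply: measurable_funD; apply: measurable_funX; [exact: mr|exact: mi].
Qed.

Definition lset f l : set line := dom `&` [set x | l < cabs (f x)].

Lemma measurable_lset f l : cmeasurable f -> measurable (lset f l).
Proof.
move=> mf; rewrite /lset.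
rewrite (_ : _ `&` _ = dom `&` (fun x => cabs (f x)) @^-1` [set` `]l, +oo[ ]).
  exact: (measurable_cabs mf measurable_dom (measurable_itv _)).
by congr (_ `&` _); apply/seteqP; split => x /=; rewrite in_itv /= andbT.
Qed.

Definition dist f l : R := fine (mu (lset f l)).

Lemma mu_lset f l : cmeasurable f -> mu (lset f l) = (dist f l)%:E.
Proof.
move=> mf; rewrite /dist fineK// ge0_fin_numE ?measure_ge0//.
apply: le_lt_trans mu_dom_lty; apply: le_measure; rewrite ?inE.
- exact: measurable_lset.
- exact: measurable_dom.
- exact: subIsetl.
Qed.

Lemma dist_ge0 f l : 0 <= dist f l.
Proof. by rewrite /dist fine_ge0. Qed.

Lemma le_dist f l l' : cmeasurable f -> l <= l' -> dist f l' <= dist f l.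
Proof.
move=> mf ll; rewrite -lee_fin -!mu_lset//.
apply: le_measure; rewrite ?inE; [exact: measurable_lset|exact: measurable_lset|].
by move=> x [dx /= h]; split => //=; exact: le_lt_trans h.
Qed.

Lemma dist_le2 f l : cmeasurable f -> dist f l <= 2.
Proof.
move=> mf; rewrite -lee_fin -mu_lset// -mu_dom.
apply: le_measure; rewrite ?inE; [exact: measurable_lset|exact: measurable_dom|exact: subIsetl].
Qed.

Lemma rearr_ge0 f t : (0 <= decreasing_rearrangement f t)%E.
Proof. by apply/ereal_infP => _ [l [l0 _] <-]; rewrite lee_fin. Qed.

Lemma rearr_le f l t : cmeasurable f -> 0 <= l -> dist f l <= t ->
  (decreasing_rearrangement f t <= l%:E)%E.
Proof.
move=> mf l0 lt; apply: ereal_inf_lbound; exists l => //; split => //.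
by rewrite -/(lset f l) mu_lset// lee_fin.
Qed.

Lemma rearr_ge f l t : cmeasurable f -> t < dist f l ->
  (l%:E <= decreasing_rearrangement f t)%E.
Proof.
move=> mf lt; apply/ereal_infP => _ [l' [l0 h] <-]; rewrite lee_fin leNgt.
apply/negP => ll; move: h; rewrite -/(lset f l') mu_lset// lee_fin leNgt => /negP; apply.
by apply: (lt_le_trans lt); apply: le_dist => //; exact: ltW.
Qed.

(** If [K] is the first index whose level set has measure at most [t], the rearrangement is at most
    [dyad l K], which is [l] plus the sum of the earlier levels, all of them counted. If there is no
    such [K], the series diverges. *)
Lemma rearr_dyad f l t : cmeasurable f -> 0 < l ->
  (decreasing_rearrangement f t <=
   l%:E + \sum_(0 <= k <oo) (dyad l k * (t < dist f (dyad l k))%R%:R)%:E)%E.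
Proof.
move=> mf l0; pose P k := ~~ (t < dist f (dyad l k))%R.
have u0 k : (0 <= (dyad l k * (t < dist f (dyad l k))%R%:R)%:E)%E.
  by rewrite lee_fin mulr_ge0// ltW// dyad_gt0.
have main n : (forall k, (k < n)%N -> ~~ P k) ->
    ((dyad l n)%:E <= l%:E + \sum_(0 <= k <oo) (dyad l k * (t < dist f (dyad l k))%R%:R)%:E)%E.
  move=> h; rewrite -sum_dyad EFinD leeD2l//.
  apply: le_trans (nneseries_lim_ge n (fun k _ _ => u0 k)).
  rewrite sumEFin lee_fin !big_nat; apply: ler_sum => k /andP[_ kn].
  by have := h k kn; rewrite /P negbK => ->; rewrite mulr1.
have [ex|nex] := pselect (exists k, P k).
  have [K PK Kmin] := ex_minnP ex.
  apply: (@le_trans _ _ (dyad l K)%:E).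
    apply: rearr_le => //; first by rewrite ltW// dyad_gt0.
    by move: PK; rewrite /P -leNgt.
  by apply: main => k kK; apply/negP => /Kmin; rewrite leqNgt kK.
suff -> : (l%:E + \sum_(0 <= k <oo) (dyad l k * (t < dist f (dyad l k))%R%:R)%:E = +oo)%E.
  by rewrite leey.
apply: eq_infty => r; pose n := Num.bound (r / l).
apply: le_trans (main n _); last by move=> k _; apply/negP => Pk; apply: nex; exists k.
rewrite lee_fin /dyad -ler_pdivrMl// mulrC (@le_trans _ _ n%:R)//.
  have [r0|r0] := leP 0 r; first by rewrite ltW// archi_boundP// divr_ge0// ltW.
  by rewrite (@le_trans _ _ 0)// pmulr_lle0 ?invr_gt0// ltW.
by rewrite -natrX ler_nat ltnW// ltn_expl.
Qed.

(** Chebyshev's inequality, with a factor [c] that scales down level sets larger than the admissible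
    mass. *)
Lemma mul_dist_le f (phi : line -> R) l (c : R) (Q : \bar R) : cmeasurable f -> 0 <= l -> 0 <= c ->
  (forall x, dom x -> phi x = c * \1_(lset f l) x) ->
  (\int[mu]_(x in dom) (phi x * cabs (f x))%:E <= Q)%E ->
  ((c * l * dist f l)%:E <= Q)%E.
Proof.
move=> mf l0 c0 phiE; apply: le_trans.
have -> : (c * l * dist f l)%:E =
    (\int[mu]_(x in dom) ((c * l)%:E * (\1_(lset f l) x)%:E))%E.
  rewrite ge0_integralZl_EFin; [|exact: measurable_dom|by move=> x _; rewrite lee_fin indicE ler0n
    |by apply/measurable_EFinP; apply: measurable_indic; exact: measurable_lset|exact: mulr_ge0].
  rewrite integral_indic; [|exact: measurable_dom|exact: measurable_lset].
  have -> : lset f l `&` dom = lset f l by rewrite /lset setIAC setIid.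
  by rewrite EFinM; congr (_ * _)%E; apply/esym; exact: mu_lset.
apply: ge0_le_integral_nomeas => x dx.
  by rewrite -EFinM lee_fin mulr_ge0 ?mulr_ge0// indicE ler0n.
rewrite phiE// -EFinM lee_fin !indicE; case: (boolP (x \in _)) => [/set_mem[_ /= h]|_]; last by rewrite !mulr0 mul0r.
by rewrite !mulr1 ler_wpM2l// ltW.
Qed.

End Levels.

Section LevelSums.
Context {R : realType}.
Local Notation line := (lebesgue_line R).
Implicit Types (f h : line -> R[i]) (l t y s : R).

Lemma bmf_lset f l : cmeasurable f -> bmf (\1_(lset f l) : line -> R).
Proof. by move=> mf; apply: bmf_indic; exact: measurable_lset. Qed.

Lemma weight_le_lset f l (c s : R) : cmeasurable f -> 0 <= c <= 1 ->
  c * dist f l <= s -> weight_le (fun x => c * \1_(lset f l) x) s.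
Proof.
move=> mf /andP[c0 c1] cs.
have mi : measurable_fun dom (\1_(lset f l) : line -> R) by case: (bmf_lset l mf).
split.
- by apply: measurable_funM; [exact: measurable_cst|exact: mi].
- by move=> x _; rewrite indicE mulr_ge0//= mulr_ile1// lern1 leq_b1.
under eq_integral do rewrite EFinM.
rewrite ge0_integralZl_EFin; [|exact: measurable_dom|by move=> x _; rewrite lee_fin indicE ler0n
  |exact/measurable_EFinP|exact: c0].
rewrite integral_indic; [|exact: measurable_dom|exact: measurable_lset].
have -> : lset f l `&` dom = lset f l by rewrite /lset setIAC setIid.
rewrite [X in (_ * X <= _)%E](_ : _ = (dist f l)%:E); last exact: mu_lset.
by rewrite -EFinM lee_fin.
Qed.

(** The left side integrates the series of [rearr_dyad] over [(0, s)]. Levels of measure above [s]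
    form a geometric sum dominated by its last term, which is tested with an indicator scaled to
    mass [s]. The first level set of measure at most [s] is itself an admissible weight and contains
    all higher ones, whose sum is pointwise at most [2 * cabs (f x)]. Hence [4 = 2 + 2]. *)
Lemma level_sum f l s (Q : \bar R) : cmeasurable f -> 0 < l -> 0 < s ->
  (forall phi : line -> R, weight_le phi s ->
     (\int[mu]_(x in dom) (phi x * cabs (f x))%:E <= Q)%E) ->
  (\sum_(0 <= k <oo) (dyad l k * Num.min s (dist f (dyad l k)))%:E <= 4%:E * Q)%E.
Proof.
move=> mf l0 s0 hQ; have l1 k := dyad_gt0 k l0.
have Q0 : (0 <= Q)%E.
  apply: le_trans (hQ (fun=> 0) _); last first.
    split; [exact: measurable_cst|by move=> x _; rewrite lexx ler01|].
    by rewrite integral0_eq ?lee_fin ?ltW.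
  by rewrite integral0_eq// => x _; rewrite mul0r.
have big k : s <= dist f (dyad l k) -> ((s * dyad l k)%:E <= Q)%E.
  move=> sd; have d0 : 0 < dist f (dyad l k) by exact: lt_le_trans sd.
  have c01 : 0 <= s / dist f (dyad l k) <= 1.
    by rewrite divr_ge0 ?(ltW s0) ?(ltW d0)//= ler_pdivrMr// mul1r.
  have -> : s * dyad l k = s / dist f (dyad l k) * dyad l k * dist f (dyad l k).
    by field; rewrite gt_eqF.
  apply: (@mul_dist_le _ f (fun x => s / dist f (dyad l k) * \1_(lset f (dyad l k)) x)) => //.
  - exact: ltW.
  - by case/andP: c01.
  - by apply: hQ; apply: weight_le_lset => //; rewrite divfK// gt_eqF.
have sumbig J : (forall k, (k < J)%N -> s < dist f (dyad l k)) ->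
    ((\sum_(0 <= k < J) dyad l k * s)%:E <= 2%:E * Q)%E.
  case: J => [|J] h; first by rewrite big_geq// mule_ge0.
  apply: (@le_trans _ _ (2%:E * (s * dyad l J)%:E)%E); last first.
    by rewrite lee_wpmul2l// big// ltW// h.
  rewrite -EFinM lee_fin -mulr_suml mulrCA [leRHS]mulrC ler_wpM2r ?(ltW s0)//.
  by rewrite -dyadS -sum_dyad lerDr ltW.
apply: nneseries_le => [k|J].
  by rewrite lee_fin mulr_ge0 ?(ltW (l1 k))// le_min (ltW s0) dist_ge0.
pose P k := (k < J)%N && (dist f (dyad l k) <= s)%R.
have [ex|nex] := pselect (exists k, P k); last first.
  apply: (@le_trans _ _ (2%:E * Q)%E); last by rewrite lee_wpmul2r// lee_fin ler_nat.
  apply: le_trans (sumbig J _); last first.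
    by move=> k kJ; rewrite ltNge; apply/negP => h; apply: nex; exists k; rewrite /P kJ.
  by rewrite sumEFin lee_fin; apply: ler_sum => k _; rewrite ler_wpM2l ?(ltW (l1 k))// ge_min lexx.
have [K /andP[KJ dK] Kmin] := ex_minnP ex.
have h1 : ((\sum_(0 <= k < K) dyad l k * s)%:E <= 2%:E * Q)%E.
  apply: sumbig => k kK; rewrite ltNge; apply/negP => h.
  by have := Kmin k; rewrite /P (ltn_trans kK KJ) h leqNgt kK => /(_ isT).
have wK : weight_le (fun x => 1 * \1_(lset f (dyad l K)) x) s.
  by apply: weight_le_lset => //; rewrite ?mul1r// ler01 lexx.
have h2 : ((\sum_(K <= k < J) dyad l k * dist f (dyad l k))%:E <= 2%:E * Q)%E.
  apply: le_trans (lee_wpmul2l _ (hQ _ wK)); last by rewrite lee_fin.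
  have mi k : measurable_fun dom (fun x => (\1_(lset f (dyad l k)) x)%:E : \bar R).
    by apply/measurable_EFinP; case: (bmf_lset (dyad l k) mf).
  have mlk k : measurable_fun dom (fun x => ((dyad l k)%:E * (\1_(lset f (dyad l k)) x)%:E)%E).
    by apply: emeasurable_funM; [exact: measurable_cst|exact: mi].
  have i0 k x : (0 <= (\1_(lset f (dyad l k)) x)%:E :> \bar R)%E by rewrite lee_fin indicE ler0n.
  have -> : (\sum_(K <= k < J) dyad l k * dist f (dyad l k))%:E =
     (\int[mu]_(x in dom) \sum_(k <- index_iota K J) ((dyad l k)%:E * (\1_(lset f (dyad l k)) x)%:E))%E.
    rewrite ge0_integral_sum; [|exact: measurable_dom|by move=> k; exact: mlk
      |by move=> k x _; rewrite mule_ge0 ?i0// lee_fin ltW].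
    rewrite -sumEFin; apply: eq_bigr => k _.
    rewrite ge0_integralZl_EFin; [|exact: measurable_dom|by move=> x _; exact: i0|exact: mi|exact: ltW].
    rewrite integral_indic; [|exact: measurable_dom|exact: measurable_lset].
    have -> : lset f (dyad l k) `&` dom = lset f (dyad l k) by rewrite /lset setIAC setIid.
    by rewrite EFinM; congr (_ * _)%E; apply/esym; exact: mu_lset.
  have mc : measurable_fun dom (fun x => (1 * \1_(lset f (dyad l K)) x * cabs (f x))%:E : \bar R).
    apply/measurable_EFinP; apply: measurable_funM; last exact: measurable_cabs.
    by apply: measurable_funM; [exact: measurable_cst|case: (bmf_lset (dyad l K) mf)].
  rewrite -ge0_integralZl_EFin; [|exact: measurable_dom
    |by move=> x _; rewrite lee_fin mul1r mulr_ge0 ?cabs_ge0// indicE ler0n|exact: mc|by []].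
  apply: ge0_le_integral_nomeas => x dx.
    by apply: sume_ge0 => k _; rewrite mule_ge0 ?i0// lee_fin ltW.
  under eq_bigr do rewrite -EFinM.
  rewrite sumEFin -EFinM lee_fin mul1r.
  have [xK|xK] := boolP (x \in lset f (dyad l K)).
    rewrite [X in 2 * (X * _)]indicE xK mul1r.
    apply: le_trans (sum_dyad_le J l0 (cabs_ge0 (f x))).
    rewrite [leRHS](big_cat_nat _ (n := K))//= ?(ltnW KJ)// -[leLHS]add0r; apply: lerD.
      by apply: sumr_ge0 => k _; rewrite mulr_ge0 ?(ltW (l1 k)).
    apply: ler_sum => k _; rewrite ler_wpM2l ?(ltW (l1 k))// indicE ler_nat.
    by case: (boolP (x \in _)) => // /set_mem[_ /= /ltW ->].
  rewrite [X in 2 * (X * _)]indicE (negbTE xK) mul0r mulr0 big_nat big1// => k /andP[Kk _].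
  rewrite indicE; case: (boolP (x \in _)) => [/set_mem[_ /= h]|_]; last by rewrite mulr0.
  exfalso; move/negP: xK; apply; apply/mem_set; split => //=; apply: le_lt_trans h.
  by rewrite /dyad ler_pM2l// ler_weXn2l// ler1n.
apply: (@le_trans _ _ ((\sum_(0 <= k < K) dyad l k * s)%:E +
   (\sum_(K <= k < J) dyad l k * dist f (dyad l k))%:E)%E).
  rewrite sumEFin -EFinD lee_fin (big_cat_nat _ (n := K))//= ?(ltnW KJ)//.
  by apply: lerD; apply: ler_sum => k _; rewrite ler_wpM2l ?(ltW (l1 k))// ge_min lexx ?orbT.
apply: (le_trans (leeD h1 h2)); rewrite -ge0_muleDl ?lee_fin// -EFinD.
by rewrite (_ : 2 + 2 = 4 :> R)// -natrD.
Qed.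

End LevelSums.

(** * Comparison of the norms with dyadic sums *)

Section NormBounds.
Context {R : realType}.
Local Notation line := (lebesgue_line R).
Implicit Types (f h : line -> R[i]) (l t y s : R).

Local Notation I02 := ([set` `](0:R), 2[ ] : set line).

Let sn (n : nat) : R := 2 / 2 ^+ n.

Let sn_gt0 n : 0 < sn n. Proof. by rewrite divr_gt0// exprn_gt0. Qed.

Lemma weight_le_sum (beta t : R) : 0 <= beta -> 0 < t < 2 ->
  exists n, ln (2 * expR 1 / t) `^ beta <=
            \sum_(0 <= k < n) wstep beta k * (t < sn k)%R%:R.
Proof.
move=> b0 /andP[t0 t2]; have [n [nt tn]] := dyadic_bracket t0 t2.
exists n.+1.
have -> : \sum_(0 <= k < n.+1) wstep beta k * (t < sn k)%R%:R = wlevel beta n.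
  rewrite -sum_wstep !big_nat; apply: eq_bigr => k /andP[_ kn].
  rewrite (lt_le_trans tn) ?mulr1// /sn ler_pM2l// lef_pV2 ?posrE ?exprn_gt0//.
  by rewrite ler_weXn2l// ler1n.
have ln0 : 0 <= ln (2 * expR 1 / t).
  rewrite ln_ge0// ler_pdivlMr// mul1r (le_trans (ltW t2))//.
  by rewrite ler_peMr// (le_trans _ two_le_e)// ler1n.
by apply: ge0_ler_powR; rewrite ?nnegrE// ln_weight_le.
Qed.

(** Decomposing the weight into indicators of [(0, sn n)] reduces the norm to integrals of the
    rearrangement over these intervals, which [rearr_dyad] and [level_sum] control. The term
    [l * sn n] accounts for the values below [l]. *)
Lemma norm_upper (beta : R) h l (Q : nat -> \bar R) : 0 <= beta -> cmeasurable h -> 0 < l ->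
  (forall n (phi : line -> R), weight_le phi (sn n) ->
     (\int[mu]_(x in dom) (phi x * cabs (h x))%:E <= Q n)%E) ->
  (LlogL_norm beta h <=
   \sum_(0 <= n <oo) ((wstep beta n)%:E * ((l * sn n)%:E + 4%:E * Q n)))%E.
Proof.
move=> b0 mh l0 hQ; have l1 k := dyad_gt0 k l0.
have c0 n : 0 <= wstep beta n by exact: wstep_ge0.
pose B n k : set line := [set` `]-oo, (Num.min (sn n) (dist h (dyad l k)))[ ].
pose A n : set line := [set` `]-oo, (sn n)[ ].
have mA n : measurable (A n) by exact: measurable_itv_line.
have mB n k : measurable (B n k) by exact: measurable_itv_line.
have mI : measurable I02 by exact: measurable_itv_line.
pose u n k (t : line) := ((dyad l k)%:E * (\1_(B n k) t)%:E)%E.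
pose F n (t : line) := (l%:E * (\1_(A n) t)%:E + \sum_(0 <= k <oo) u n k t)%E.
have i0 (C : set line) x : (0 <= (\1_C x)%:E :> \bar R)%E by rewrite lee_fin indicE ler0n.
have mi (C : set line) : measurable C -> measurable_fun I02 (fun x => (\1_C x)%:E : \bar R).
  by move=> mC; apply/measurable_EFinP; exact: measurable_indic.
have u0 n k t : (0 <= u n k t)%E by rewrite mule_ge0 ?i0// lee_fin ltW.
have mu' n k : measurable_fun I02 (u n k).
  by apply: emeasurable_funM; [exact: measurable_cst|exact: mi].
have SU0 n t : (0 <= \sum_(0 <= k <oo) u n k t)%E by apply: nneseries_ge0.
have mSU n : measurable_fun I02 (fun t => \sum_(0 <= k <oo) u n k t)%E.
  by apply: ge0_emeasurable_sum => [k t _ _|k _]; [exact: u0|exact: mu'].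
have mlA n : measurable_fun I02 (fun t => l%:E * (\1_(A n) t)%:E)%E.
  by apply: emeasurable_funM; [exact: measurable_cst|exact: mi].
have lA0 n t : (0 <= l%:E * (\1_(A n) t)%:E)%E by rewrite mule_ge0 ?i0// lee_fin ltW.
have F0 n t : (0 <= F n t)%E by rewrite adde_ge0.
have mF n : measurable_fun I02 (F n) by apply: emeasurable_funD; [exact: mlA|exact: mSU].
have muI (r : R) : 0 <= r -> (mu ([set` `]-oo, r[ ] `&` I02) <= r%:E)%E.
  move=> r0; have -> : r%:E = mu ([set` `](0:R), r[ ] : set line).
    by rewrite mu_itv// subr0.
  apply: le_measure; rewrite ?inE.
  - by apply: measurableI; [exact: measurable_itv_line|exact: mI].
  - exact: measurable_itv_line.
  - by move=> x /= []; rewrite !in_itv /= => -> /andP[->].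
have iF n : (\int[mu]_(t in I02) F n t <= (l * sn n)%:E + 4%:E * Q n)%E.
  rewrite ge0_integralD; [|exact: mI|by move=> t _; exact: lA0|exact: mlA|by move=> t _; exact: SU0|exact: mSU].
  apply: leeD.
    rewrite ge0_integralZl_EFin; [|exact: mI|by move=> t _; exact: i0|exact: mi|exact: ltW].
    rewrite integral_indic; [|exact: mI|exact: mA].
    by rewrite EFinM; apply: lee_wpmul2l; [rewrite lee_fin ltW|apply: muI; exact: ltW].
  rewrite integral_nneseries; [|exact: mI|by move=> k; exact: mu'|by move=> k t _; exact: u0].
  apply: le_trans (level_sum mh l0 (sn_gt0 n) (hQ n)).
  apply: lee_nneseries => k _ => [_|]; first by apply: integral_ge0 => t _; exact: u0.
  rewrite ge0_integralZl_EFin; [|exact: mI|by move=> t _; exact: i0|exact: mi|exact: ltW].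
  rewrite integral_indic; [|exact: mI|exact: mB].
  rewrite [leRHS]EFinM; apply: lee_wpmul2l; first by rewrite lee_fin ltW.
  by apply: muI; rewrite le_min (ltW (sn_gt0 n)) dist_ge0.
apply: (@le_trans _ _ (\int[mu]_(t in I02) \sum_(0 <= n <oo) ((wstep beta n)%:E * F n t))%E).
  apply: ge0_le_integral_nomeas => t; rewrite /= in_itv /= => t02.
    by rewrite mule_ge0 ?rearr_ge0// lee_fin powR_ge0.
  have [p w] := weight_le_sum b0 t02.
  have cF0 k : (0 <= (wstep beta k)%:E * F k t)%E by rewrite mule_ge0 ?F0// lee_fin.
  apply: le_trans (nneseries_lim_ge p (fun k _ _ => cF0 k)).
  apply: (@le_trans _ _ (decreasing_rearrangement h t *
     \sum_(0 <= k < p) (wstep beta k * (t < sn k)%R%:R)%:E)%E).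
    by rewrite lee_wpmul2l ?rearr_ge0// sumEFin lee_fin.
  rewrite ge0_sume_distrr => [|k _]; last by rewrite lee_fin mulr_ge0.
  apply: lee_sum => k _; case: (ltP t (sn k)) => tk; last by rewrite mulr0 mule0.
  rewrite mulr1 muleC lee_wpmul2l ?lee_fin//.
  apply: (le_trans (rearr_dyad t mh l0)); apply: leeD.
    by rewrite indicE mem_set ?mule1//= in_itv.
  apply: lee_nneseries => i _ => [_|]; first by rewrite lee_fin mulr_ge0 ?(ltW (l1 i)).
  rewrite /u -EFinM lee_fin ler_wpM2l ?(ltW (l1 i))// indicE ler_nat.
  case: (boolP (t < _)) => // td.
  by rewrite (mem_set (_ : B k i t))// /B /= in_itv /= lt_min tk td.
rewrite integral_nneseries; [|exact: mI
  |by move=> n; apply: emeasurable_funM; [exact: measurable_cst|exact: mF]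
  |by move=> n t _; rewrite mule_ge0 ?F0// lee_fin].
apply: lee_nneseries => n _ => [_|].
  by apply: integral_ge0 => t _; rewrite mule_ge0 ?F0// lee_fin.
rewrite ge0_integralZl_EFin; [|exact: mI|by move=> t _; exact: F0|exact: mF|exact: c0].
by rewrite lee_wpmul2l ?lee_fin.
Qed.

(** For [t < 2 ^- m k] the rearrangement is at least [dyad l k]. Several levels may be active at the
    same [t], but half of their sum is still below the rearrangement, being geometric; so no
    disjointness of the intervals is required. *)
Lemma norm_lower (alpha : R) f l (m : nat -> nat) (z : nat -> bool) J :
  0 <= alpha -> cmeasurable f -> 0 < l ->
  (forall k, z k -> 2 ^- m k <= dist f (dyad l k)) ->
  ((\sum_(0 <= k < J) (z k)%:R * (dyad l k / 2 * 2 ^- m k * ((m k).+1%:R / 2) `^ alpha))%:E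
    <= LlogL_norm alpha f)%E.
Proof.
move=> a0 mf l0 zm; have l1 k := dyad_gt0 k l0.
pose C k : R := (z k)%:R * (dyad l k / 2 * ((m k).+1%:R / 2) `^ alpha).
have C0 k : 0 <= C k.
  by apply: mulr_ge0 => //; apply: mulr_ge0; [rewrite divr_ge0// ltW|exact: powR_ge0].
pose A k : set line := [set` `](0:R), (2 ^- m k)[ ].
have mA k : measurable (A k) by exact: measurable_itv_line.
have mI : measurable I02 by exact: measurable_itv_line.
have i0 (B : set line) x : (0 <= (\1_B x)%:E :> \bar R)%E by rewrite lee_fin indicE ler0n.
have mi k : measurable_fun I02 (fun x => (\1_(A k) x)%:E : \bar R).
  by apply/measurable_EFinP; exact: measurable_indic.
have AI k : A k `&` I02 = A k.
  apply/seteqP; split => [x []//|x Ax]; split => //; move: Ax; rewrite /A /= !in_itv /= => /andP[-> h] /=.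
  by rewrite (lt_le_trans h)// (@le_trans _ _ 1)// ?invf_le1 ?exprn_gt0 ?exprn_ege1 ?ler1n.
have muA k : mu (A k) = (2 ^- m k)%:E by rewrite mu_itv ?subr0// invr_ge0 exprn_ge0.
have -> : (\sum_(0 <= k < J) (z k)%:R * (dyad l k / 2 * 2 ^- m k * ((m k).+1%:R / 2) `^ alpha))%:E
   = (\int[mu]_(t in I02) \sum_(k <- index_iota 0 J) ((C k)%:E * (\1_(A k) t)%:E))%E.
  rewrite ge0_integral_sum; [|exact: mI
    |by move=> k; apply: emeasurable_funM; [exact: measurable_cst|exact: mi]
    |by move=> k t _; rewrite mule_ge0 ?i0// lee_fin].
  rewrite -sumEFin; apply: eq_bigr => k _.
  rewrite ge0_integralZl_EFin; [|exact: mI|by move=> t _; exact: i0|exact: mi|exact: C0].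
  rewrite integral_indic; [|exact: mI|exact: mA].
  rewrite AI [X in (_ = _ * X)%E](_ : _ = (2 ^- m k)%:E); last exact: muA.
  by rewrite -EFinM; congr (_%:E); rewrite /C; ring.
apply: ge0_le_integral_nomeas => t; rewrite /= in_itv /= => /andP[t0 t2].
  by apply: sume_ge0 => k _; rewrite mule_ge0 ?i0// lee_fin.
set w := ln (2 * expR 1 / t) `^ alpha.
have w0 : 0 <= w by exact: powR_ge0.
pose S := \sum_(0 <= k < J) dyad l k / 2 * (t < dist f (dyad l k))%R%:R.
have S0 : 0 <= S by apply: sumr_ge0 => k _; rewrite mulr_ge0// divr_ge0// ltW.
apply: (@le_trans _ _ (S * w)%:E).
  under eq_bigr do rewrite -EFinM.
  rewrite sumEFin lee_fin mulr_suml; apply: ler_sum => k _.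
  rewrite indicE; case: (boolP (t \in A k)) => [/set_mem|_]; last by rewrite mulr0 !mulr_ge0// ltW.
  rewrite /A /= in_itv /= => /andP[_ tm]; rewrite mulr1 /C.
  case: (boolP (z k)) => zk; last by rewrite mul0r !mulr_ge0// ltW.
  rewrite mul1r (lt_le_trans tm (zm k zk)) mulr1 ler_wpM2l// ?divr_ge0 ?(ltW (l1 k))//.
  have tm2 : t <= 2 / 2 ^+ m k by rewrite (le_trans (ltW tm))// ler_peMl ?ler1n// invr_ge0 exprn_ge0.
  have h := ln_weight_ge t0 tm2.
  by apply: ge0_ler_powR; rewrite ?nnegrE ?divr_ge0// (le_trans _ h)// divr_ge0.
rewrite EFinM lee_wpmul2r ?lee_fin//.
have h0 := rearr_ge0 f t.
case Er : (decreasing_rearrangement f t) h0 => [y| |] // y0; last by rewrite leey.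
rewrite lee_fin in y0 *.
have := sum_dyad_le J l0 y0; rewrite -ler_pdivrMl// mulrC.
apply: le_trans; rewrite /S mulr_suml; apply: ler_sum => k _.
rewrite mulrAC ler_wpM2r ?invr_ge0// ler_wpM2l ?(ltW (l1 k))// ler_nat.
case: (boolP (t < _)) => // td.
by have := rearr_ge mf td; rewrite Er lee_fin => ->.
Qed.

End NormBounds.

(** * Uniform bounds for truncations *)

Section Pieces.
Context {R : realType}.
Local Notation line := (lebesgue_line R).
Implicit Types (r p q : line -> R) (e l x : R).

Let bmf_hat_arg e x p : 0 < e -> bmf p ->
  bmf (fun t => Num.sqrt (delta t) * p t * cutoff_inv e x t).
Proof.
move=> e0 bp; apply: bmfM; last exact: bmf_cutoff_inv.
by apply: bmfM; [exact: bmf_sqrt_delta|exact: bp].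
Qed.

Lemma hat_truncD e p q x : 0 < e -> bmf p -> bmf q ->
  hat_trunc e (fun t => p t + q t) x = hat_trunc e p x + hat_trunc e q x.
Proof.
move=> e0 bp bq; rewrite /hat_trunc -mulrDr -RintegralD; [|exact: measurable_dom
  |by apply: bmf_integrable; exact: bmf_hat_arg|by apply: bmf_integrable; exact: bmf_hat_arg].
by congr (_ * _); apply: eq_Rintegral => t _; ring.
Qed.

Lemma hat_truncZ e (c : R) p x : 0 < e -> bmf p ->
  hat_trunc e (fun t => c * p t) x = c * hat_trunc e p x.
Proof.
move=> e0 bp; rewrite /hat_trunc [RHS]mulrCA -[c * _]RintegralZ_bmf; last exact: (bmf_hat_arg x e0 bp).
by congr (_ * _); apply: eq_Rintegral => t _; ring.
Qed.

Lemma hat_trunc_eq0 e p x : 0 < e -> bmf p ->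
  \int[mu]_(t in dom) `|p t| = 0 -> hat_trunc e p x = 0.
Proof.
move=> e0 bp p0; rewrite /hat_trunc; apply/eqP; rewrite mulf_eq0; apply/orP; right.
rewrite -normr_le0 (le_trans (norm_Rintegral_bmf (bmf_hat_arg x e0 bp)))//.
rewrite -(mulr0 e^-1) -p0 -RintegralZ_bmf; last exact: bmf_norm.
apply: le_Rintegral_bmf.
- by apply: bmf_norm; exact: bmf_hat_arg.
- by apply: bmfM; [exact: bmf_cst|exact: bmf_norm].
- move=> t dt; rewrite normrM [leLHS]mulrC; apply: ler_pM => //; first exact: cutoff_inv_bound.
  rewrite normrM ler_piMl// ger0_norm ?sqrtr_ge0// -[leRHS]sqrtr1 ler_wsqrtr//.
  by rewrite /delta gerBl sqr_ge0.
Qed.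

(** [piece_bound] after division by [c]. The flag [b] is false for pieces supported on a null set,
    to which no exponent [m] could be assigned and for which the transform vanishes. *)
Lemma piece_bound0 (p : line -> R) (c : R) (e : R) (b : bool) (m : nat) : 0 < e -> 0 < c -> bmf p ->
  (forall x, dom x -> `|p x| <= c) ->
  \int[mu]_(x in dom) `|p x| <= c * (b%:R * (2 / 2 ^+ m)) ->
  exists G : line -> R, [/\ measurable_fun dom G, (forall x, dom x -> 0 <= G x),
    (forall x, dom x -> `|hat_trunc e p x| <= G x) &
    forall n (phi : line -> R), weight_le phi (2 / 2 ^+ n) ->
    (\int[mu]_(x in dom) (phi x * G x)%:E <=
      (1000 * c * (b%:R * 2 ^- m) * kappa n m)%:E)%E].
Proof.
move=> e0 c0 bp pc; case: b => ip; last first.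
  exists (fun=> 0); split=> [||x dx|n phi w].
  - exact: measurable_cst.
  - by [].
  - rewrite hat_trunc_eq0 ?normr0//; apply/eqP; rewrite eq_le Rintegral_ge0// andbT.
    by rewrite (le_trans ip)// mul0r mulr0.
  - by rewrite mul0r mulr0 mul0r integral0_eq// => x _; rewrite mulr0.
pose psi (x : line) := c^-1 * p x.
have bpsi : bmf psi by apply: bmfM; [exact: bmf_cst|exact: bp].
have bn := bmf_norm bpsi.
have w : weight_le (fun x => `|psi x|) (2 / 2 ^+ m).
  split.
  - by case: bn.
  - move=> x dx; rewrite normr_ge0 /psi normrM gtr0_norm ?invr_gt0// mulrC.
    by rewrite ler_pdivrMr// mul1r pc.
  - rewrite -EFin_Rintegral_bmf// lee_fin /psi.
    under eq_Rintegral do rewrite normrM gtr0_norm ?invr_gt0//.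
    rewrite RintegralZ_bmf; last exact: bmf_norm.
    by rewrite mulrC ler_pdivrMr// (le_trans ip)// mul1r mulrC.
have [G [mG G0 hG iG]] := piece_bound e0 bpsi w.
exists (fun x => c * G x); split.
- by apply: measurable_funM; [exact: measurable_cst|exact: mG].
- by move=> x dx; rewrite mulr_ge0 ?G0// ltW.
- move=> x dx; have := hG x dx; rewrite hat_truncZ// normrM gtr0_norm ?invr_gt0//.
  by rewrite mulrC ler_pdivrMr// mulrC.
move=> n phi wphi; have [mphi phi01 _] := wphi.
have -> : (\int[mu]_(x in dom) (phi x * (c * G x))%:E = c%:E * \int[mu]_(x in dom) (phi x * G x)%:E)%E.
  rewrite -ge0_integralZl_EFin; [|exact: measurable_dom| | |exact: ltW].
  - by apply: eq_integral => x _; rewrite -EFinM mulrCA.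
  - by move=> x dx; rewrite lee_fin mulr_ge0 ?G0//; case/andP: (phi01 x dx).
  - by apply/measurable_EFinP; apply: measurable_funM; [exact: mphi|exact: mG].
apply: le_trans (lee_wpmul2l _ (iG n phi wphi)) _; first by rewrite lee_fin ltW.
by rewrite -EFinM lee_fin mul1r le_eqVlt; apply/orP; left; apply/eqP; ring.
Qed.

End Pieces.

Section TruncBound.
Context {R : realType}.
Local Notation line := (lebesgue_line R).

(** The first term belongs to the part of [f] below [l], supported on the whole domain of measure
    [2 = 2 / 2 ^ 0]. The term of index [k] belongs to the values between [dyad l k] and
    [dyad l k.+1], on a set of measure at most [2 / 2 ^ m k]. *)
Definition level_bound (l : R) (m : nat -> nat) (z : nat -> bool) (n : nat) : \bar R :=
  ((l * kappa n 0)%:E +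
   \sum_(0 <= k <oo) (dyad l k.+1 * ((z k)%:R * 2 ^- m k) * kappa n (m k))%:E)%E.

Variables (e l : R) (f : line -> R[i]) (r : line -> R).
Hypotheses (e0 : 0 < e) (l0 : 0 < l) (mf : cmeasurable f).
Hypothesis mr : measurable_fun dom r.
Hypothesis rf : forall x, dom x -> `|r x| <= cabs (f x).
Hypothesis ir : mu.-integrable dom (EFin \o r).

(** The levels are those of [cabs (f x)] and not of [r], so that the real and the imaginary part of
    [f] share the same level sets and exponents. *)
Let cut J (x : line) : R := r x * (1 - \1_(lset f (dyad l J)) x).
Let piece k (x : line) : R :=
  r x * (\1_(lset f (dyad l k)) x - \1_(lset f (dyad l k.+1)) x).

Let mi k : measurable_fun dom (\1_(lset f (dyad l k)) : line -> R).
Proof. by case: (bmf_lset (dyad l k) mf). Qed.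

Let dyad_le k p : (k <= p)%N -> dyad l k <= dyad l p.
Proof. by move=> kp; rewrite /dyad ler_pM2l// ler_weXn2l// ler1n. Qed.

Let notin_lset k x : dom x -> x \notin lset f (dyad l k) -> `|r x| <= dyad l k.
Proof.
move=> dx xk; rewrite (le_trans (rf dx))// leNgt; apply/negP => h.
by move/negP: xk; apply; apply/mem_set; split.
Qed.

Let lset_sub k x : x \in lset f (dyad l k.+1) -> x \in lset f (dyad l k).
Proof.
move=> /set_mem[dx /= h]; apply/mem_set; split => //=.
by apply: le_lt_trans h; exact: dyad_le.
Qed.

Let mcut J : measurable_fun dom (cut J).
Proof.
apply: measurable_funM; first exact: mr.
by apply: measurable_funB; [exact: measurable_cst|exact: mi].
Qed.

Let cut_le J x : dom x -> `|cut J x| <= dyad l J.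
Proof.
move=> dx; rewrite /cut indicE; case: (boolP (x \in _)) => xJ.
  by rewrite subrr mulr0 normr0 ltW// dyad_gt0.
by rewrite subr0 mulr1 notin_lset.
Qed.

Let bcut J : bmf (cut J).
Proof. by split; [exact: mcut|exists (dyad l J) => x; exact: cut_le]. Qed.

Let piece_le k x : dom x -> `|piece k x| <= dyad l k.+1 * \1_(lset f (dyad l k)) x.
Proof.
move=> dx; rewrite /piece !indicE.
case: (boolP (x \in lset f (dyad l k.+1))) => xk1.
  by rewrite (lset_sub xk1) subrr mulr0 normr0 mulr1 ltW// dyad_gt0.
rewrite subr0 normrM [X in _ * X]ger0_norm ?ler0n// ler_wpM2r ?ler0n//.
exact: notin_lset.
Qed.

Let piece_le' k x : dom x -> `|piece k x| <= dyad l k.+1.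
Proof.
move=> dx; rewrite (le_trans (piece_le k dx))// ler_piMr ?(ltW (dyad_gt0 _ l0))// lern1 leq_b1.
Qed.

Let bpiece k : bmf (piece k).
Proof.
split; last by exists (dyad l k.+1) => x; exact: piece_le'.
apply: measurable_funM; first exact: mr.
by apply: measurable_funB; exact: mi.
Qed.

Let cutS J : cut J.+1 = (fun x => cut J x + piece J x).
Proof. by apply/funext => x; rewrite /cut /piece; ring. Qed.

(** For fixed [e] the integrands are dominated by [e^-1 * |r|], and at each point the cut is
    inactive from some [J] on. *)
Let hat_cut_cvg x : hat_trunc e (cut J) x @[J --> \oo] --> hat_trunc e r x.
Proof.
rewrite /hat_trunc; apply: cvgMr; rewrite /Rintegral.
pose g (t : line) := (Num.sqrt (delta t) * r t * cutoff_inv e x t)%:E.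
pose gJ J (t : line) := (Num.sqrt (delta t) * cut J t * cutoff_inv e x t)%:E.
have bC : bmf (cutoff_inv e x) by exact: bmf_cutoff_inv.
have ms := @measurable_sqrt_delta R.
have mg : measurable_fun dom g.
  apply/measurable_EFinP; apply: measurable_funM; last by case: bC.
  by apply: measurable_funM; [exact: ms|exact: mr].
have mgJ J : measurable_fun dom (gJ J).
  apply/measurable_EFinP; apply: measurable_funM; last by case: bC.
  by apply: measurable_funM; [exact: ms|exact: mcut].
have iG : mu.-integrable dom (fun t => e^-1%:E * `|(r t)%:E|)%E.
  by apply: integrableZl; [exact: measurable_dom|exact: (integrable_abse ir)].
have sd t : dom t -> `|Num.sqrt (delta t)| <= 1.
  move=> dt; rewrite ger0_norm ?sqrtr_ge0// -[leRHS]sqrtr1 ler_wsqrtr//.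
  by rewrite /delta gerBl sqr_ge0.
have dom_le J t : dom t -> (`|gJ J t| <= e^-1%:E * `|(r t)%:E|)%E.
  move=> dt; rewrite /gJ -EFinM lee_fin normrM [leLHS]mulrC ler_pM//.
    exact: cutoff_inv_bound.
  rewrite normrM -[leRHS]mul1r ler_pM ?sd//.
  rewrite /cut normrM ler_piMr// indicE; case: (_ \in _); rewrite ?subrr ?subr0 ?normr0 ?normr1//.
have gcvg t : dom t -> gJ J t @[J --> \oo] --> g t.
  move=> dt; apply: cvg_near_cst.
  exists (Num.bound (cabs (f t) / l)) => // J /= JN.
  rewrite /gJ /g /cut indicE memNset ?subr0 ?mulr1// => -[_ /=].
  apply/negP; rewrite -leNgt /dyad -ler_pdivrMl// mulrC.
  have h : cabs (f t) / l <= (Num.bound (cabs (f t) / l))%:R.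
    by rewrite ltW// archi_boundP// divr_ge0 ?cabs_ge0// ltW.
  rewrite (le_trans h)// -natrX ler_nat (leq_trans JN)// ltnW// ltn_expl//.
have [ig _ cg] := @dominated_convergence _ _ _ mu dom measurable_dom gJ g
  (fun t => e^-1%:E * `|(r t)%:E|)%E mgJ mg (aeW _ gcvg) iG
  (aeW _ (fun t J dt => dom_le J t dt)).
apply: fine_cvg; rewrite fineK; first exact: cg.
by apply: integrable_fin_num; [exact: measurable_dom|exact: ig].
Qed.

(** The majorants of all pieces are summed pointwise; the sum may be infinite at some points, hence
    values in [\bar R]. The bound holds for each [cut J] by subadditivity and passes to [r] in the
    limit. *)
Lemma trunc_bound (m : nat -> nat) (z : nat -> bool) :
  (forall k, dist f (dyad l k) <= (z k)%:R * (2 / 2 ^+ m k)) ->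
  exists G : line -> \bar R, [/\ measurable_fun dom G,
    (forall x, dom x -> (0 <= G x)%E),
    (forall x, dom x -> ((`|hat_trunc e r x|)%:E <= G x)%E) &
    forall n (phi : line -> R), weight_le phi (2 / 2 ^+ n) ->
    (\int[mu]_(x in dom) ((phi x)%:E * G x) <= 1000%:E * level_bound l m z n)%E].
Proof.
move=> zm.
have low1 : \int[mu]_(x in dom) `|cut 0 x| <= l * (true%:R * (2 / 2 ^+ 0)).
  rewrite mul1r expr0 divr1.
  apply: (@le_trans _ _ (\int[mu]_(x in dom) l)).
    apply: le_Rintegral_bmf; [by apply: bmf_norm; exact: bcut|exact: bmf_cst|].
    by move=> x dx; rewrite (le_trans (cut_le 0 dx))// /dyad expr0 mulr1.
  rewrite Rintegral_cst; last exact: measurable_dom.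
  by rewrite [X in fine X](_ : _ = 2%:E)//; exact: mu_dom.
have low2 x : dom x -> `|cut 0 x| <= l.
  by move=> dx; rewrite (le_trans (cut_le 0 dx))// /dyad expr0 mulr1.
have [G0 [mG0 pG0 hG0 iG0]] := piece_bound0 e0 l0 (bcut 0) low2 low1.
have ex k : exists G : line -> R, [/\ measurable_fun dom G, (forall x, dom x -> 0 <= G x),
    (forall x, dom x -> `|hat_trunc e (piece k) x| <= G x) &
    forall n (phi : line -> R), weight_le phi (2 / 2 ^+ n) ->
    (\int[mu]_(x in dom) (phi x * G x)%:E <=
      (1000 * dyad l k.+1 * ((z k)%:R * 2 ^- m k) * kappa n (m k))%:E)%E].
  apply: (piece_bound0 e0 (dyad_gt0 k.+1 l0) (bpiece k)); first by move=> x; exact: piece_le'.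
  apply: (@le_trans _ _ (\int[mu]_(x in dom) (dyad l k.+1 * \1_(lset f (dyad l k)) x))).
    apply: le_Rintegral_bmf; [by apply: bmf_norm; exact: bpiece| |by move=> x; exact: piece_le].
    by apply: bmfM; [exact: bmf_cst|exact: bmf_lset].
  rewrite RintegralZ_bmf; last exact: bmf_lset.
  rewrite ler_pM2l ?dyad_gt0//; apply: le_trans (zm k).
  rewrite -lee_fin EFin_Rintegral_bmf; last exact: bmf_lset.
  rewrite integral_indic; [|exact: measurable_dom|exact: measurable_lset].
  have -> : lset f (dyad l k) `&` dom = lset f (dyad l k) by rewrite /lset setIAC setIid.
  by rewrite -mu_lset.
have [G hG] := choice ex.
have Gk0 k x : dom x -> (0 <= (G k x)%:E)%E.
  by move=> dx; rewrite lee_fin; case: (hG k) => _ h _ _; exact: h.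
have mGk k : measurable_fun dom (fun x => (G k x)%:E).
  by apply/measurable_EFinP; case: (hG k).
have mS : measurable_fun dom (fun x => \sum_(0 <= k <oo) (G k x)%:E)%E.
  by apply: ge0_emeasurable_sum => [k x dx _|k _]; [exact: Gk0|exact: mGk].
have S0 x : dom x -> (0 <= \sum_(0 <= k <oo) (G k x)%:E)%E.
  by move=> dx; apply: nneseries_ge0 => k _ _; exact: Gk0.
exists (fun x => (G0 x)%:E + \sum_(0 <= k <oo) (G k x)%:E)%E; split.
- by apply: emeasurable_funD; [exact/measurable_EFinP|exact: mS].
- by move=> x dx; rewrite adde_ge0 ?S0// lee_fin pG0.
- move=> x dx.
  have hJ J : ((`|hat_trunc e (cut J) x|)%:E <= (G0 x)%:E + \sum_(0 <= k <oo) (G k x)%:E)%E.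
    apply: (@le_trans _ _ ((G0 x)%:E + \sum_(0 <= k < J) (G k x)%:E)%E); last first.
      by rewrite leeD2l//; apply: nneseries_lim_ge => k _ _; exact: Gk0.
    elim: J => [|J IH]; first by rewrite big_geq// adde0 lee_fin hG0.
    rewrite cutS hat_truncD; [|exact: e0|exact: bcut|exact: bpiece].
    rewrite big_nat_recr//= addeA.
    apply: (@le_trans _ _ ((`|hat_trunc e (cut J) x|)%:E + (`|hat_trunc e (piece J) x|)%:E)%E).
      by rewrite -EFinD lee_fin ler_normD.
    apply: leeD => //; rewrite lee_fin; case: (hG J) => _ _ h _; exact: h.
  have := S0 x dx; case ES : (\sum_(0 <= k <oo) (G k x)%:E)%E hJ => [y| |]// hJ _; last by rewrite leey.
  rewrite -EFinD lee_fin; 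
  have cn : `|hat_trunc e (cut J) x| @[J --> \oo] --> `|hat_trunc e r x|.
    by apply: cvg_norm; exact: hat_cut_cvg.
  rewrite -(cvg_lim (@Rhausdorff R) cn); apply: limr_le; first by apply/cvg_ex; eexists; exact: cn.
  by apply: nearW => J; have := hJ J; rewrite -EFinD lee_fin.
move=> n phi w; have [mphi phi01 _] := w.
have phi0 x : dom x -> 0 <= phi x by move=> /phi01/andP[].
have -> : (\int[mu]_(x in dom) ((phi x)%:E * ((G0 x)%:E + \sum_(0 <= k <oo) (G k x)%:E)) =
   \int[mu]_(x in dom) ((phi x * G0 x)%:E + \sum_(0 <= k <oo) (phi x * G k x)%:E))%E.
  apply: eq_integral => x /set_mem dx.
  rewrite ge0_muleDr ?S0 ?lee_fin ?pG0// -nneseriesZl; last by move=> k _; exact: Gk0.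
  by rewrite EFinM; congr (_ + _)%E; apply: eq_eseriesr => k _; rewrite EFinM.
have mpG k : measurable_fun dom (fun x => (phi x * G k x)%:E).
  by apply/measurable_EFinP; apply: measurable_funM; [exact: mphi|case: (hG k)].
have pG k x : dom x -> (0 <= (phi x * G k x)%:E)%E.
  by move=> dx; rewrite lee_fin mulr_ge0 ?phi0// -lee_fin Gk0.
rewrite ge0_integralD; [|exact: measurable_dom|by move=> x dx; rewrite lee_fin mulr_ge0 ?phi0 ?pG0
  |by apply/measurable_EFinP; apply: measurable_funM; [exact: mphi|exact: mG0]
  |by move=> x dx; apply: nneseries_ge0 => k _ _; exact: pG
  |by apply: ge0_emeasurable_sum => [k x dx _|k _]; [exact: pG|exact: mpG]].
rewrite integral_nneseries; [|exact: measurable_dom|exact: mpG|exact: pG].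
have T0 k : (0 <= (dyad l k.+1 * ((z k)%:R * 2 ^- m k) * kappa n (m k))%:E)%E.
  by rewrite lee_fin !mulr_ge0 ?kappa_ge0 ?invr_ge0 ?exprn_ge0// ltW// dyad_gt0.
rewrite /level_bound ge0_muleDr; [|by rewrite lee_fin mulr_ge0 ?kappa_ge0// ltW
  |by apply: nneseries_ge0 => k _ _; exact: T0].
apply: leeD.
  apply: (le_trans (iG0 n phi w)); rewrite -EFinM lee_fin expr0 invr1 !mulr1.
  by rewrite mulrA.
rewrite -nneseriesZl; last by move=> k _; exact: T0.
apply: lee_nneseries => k _ => [_|].
  by apply: integral_ge0 => x dx; exact: pG.
by case: (hG k) => _ _ _ h; apply: (le_trans (h n phi w)); rewrite -EFinM lee_fin !mulrA.
Qed.

End TruncBound.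

(** * The principal value *)

Section PrincipalValue.
Context {R : realType}.
Local Notation line := (lebesgue_line R).
Variable r : line -> R.
Hypothesis mr : measurable_fun dom r.
Hypothesis ir : mu.-integrable dom (EFin \o r).

Let q : line -> R := (fun t => Num.sqrt (delta t) * r t) \_ dom.

Let mq : measurable_fun [set: line] q.
Proof.
apply/(measurable_restrictT _ measurable_dom).
by apply: measurable_funM; [exact: measurable_sqrt_delta|exact: mr].
Qed.

Let sqrt_delta_le1 (t : R) : dom t -> `|Num.sqrt (delta t)| <= 1.
Proof.
move=> dt; rewrite ger0_norm ?sqrtr_ge0// -[leRHS]sqrtr1 ler_wsqrtr//.
by rewrite /delta gerBl sqr_ge0.
Qed.

Let arg e (x t : line) : \bar R := (Num.sqrt (delta t) * r t * cutoff_inv e x t)%:E.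

Let marg e x : 0 < e -> measurable_fun dom (arg e x).
Proof.
move=> e0; apply/measurable_EFinP; apply: measurable_funM; last by case: (bmf_cutoff_inv x e0).
by apply: measurable_funM; [exact: measurable_sqrt_delta|exact: mr].
Qed.

Let iarg_dom e : mu.-integrable dom (fun t => e^-1%:E * `|(r t)%:E|)%E.
Proof. by apply: integrableZl; [exact: measurable_dom|exact: (integrable_abse ir)]. Qed.

Let arg_le e e' x t : 0 < e -> e <= e' -> dom t -> (`|arg e' x t| <= e^-1%:E * `|(r t)%:E|)%E.
Proof.
move=> e0 ee dt; have e'0 := lt_le_trans e0 ee.
rewrite /arg -EFinM lee_fin normrM [leLHS]mulrC ler_pM//.
  by rewrite (le_trans (cutoff_inv_bound _ _ e'0))// lef_pV2.
by rewrite normrM ler_piMl// sqrt_delta_le1.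
Qed.

Let iarg e x : 0 < e -> mu.-integrable dom (arg e x).
Proof.
move=> e0; apply: (le_integrable measurable_dom _ _ (iarg_dom e)); first exact: marg.
move=> t dt; apply: (le_trans (arg_le x e0 (lexx e) dt)).
by rewrite [leRHS]gee0_abs// mule_ge0// lee_fin invr_ge0 ltW.
Qed.

(** After extension by zero the integrand is jointly measurable in both variables, and Tonelli's
    theorem applies to its positive and negative parts separately. *)
Lemma measurable_hat_trunc e : 0 < e -> measurable_fun dom (hat_trunc e r : line -> R).
Proof.
move=> e0; apply: measurable_funM; first exact: measurable_rsqrt_delta.
pose g (z : line * line) : \bar R := (q z.2 * cutoff_inv e z.1 z.2)%:E.
have m1 : measurable_fun [set: line * line] (fun z => z.1 : R).
  exact: (measurableT_comp (@measurable_id_line R setT) measurable_fst).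
have m2 : measurable_fun [set: line * line] (fun z => z.2 : R).
  exact: (measurableT_comp (@measurable_id_line R setT) measurable_snd).
have m12 : measurable_fun [set: line * line] (fun z => z.2 - z.1 : R).
  by apply: measurable_funB; [exact: m2|exact: m1].
have mg : measurable_fun [set: line * line] g.
  apply/measurable_EFinP; apply: measurable_funM.
    exact: (measurableT_comp mq measurable_snd).
  rewrite /cutoff_inv; apply: measurable_fun_ifT.
  - apply: measurable_fun_ltr; first exact: measurable_cst.
    exact: (measurableT_comp (@normr_measurable R setT) m12).
  - exact: measurable_funV m12.
  - exact: measurable_cst.
have mgp : measurable_fun [set: line * line] g^\+%E by exact: measurable_funepos.
have mgn : measurable_fun [set: line * line] g^\-%E by exact: measurable_funeneg.
have p0 z : (0 <= g^\+%E z)%E by exact: funepos_ge0.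
have n0 z : (0 <= g^\-%E z)%E by exact: funeneg_ge0.
have mP : measurable_fun [set: line] (fubini_F (@completed_lebesgue_measure R) g^\+%E).
  by apply: measurable_fun_fubini_tonelli_F; [exact: mgp|exact: p0].
have mN : measurable_fun [set: line] (fubini_F (@completed_lebesgue_measure R) g^\-%E).
  by apply: measurable_fun_fubini_tonelli_F; [exact: mgn|exact: n0].
have mD : measurable_fun [set: line] (fun x : line =>
   fubini_F (@completed_lebesgue_measure R) g^\+%E x - fubini_F (@completed_lebesgue_measure R) g^\-%E x)%E.
  by apply: emeasurable_funB; [exact: mP|exact: mN].
have mF := measurableT_comp (fine_measurable measurableT) mD.
apply: (measurable_funS measurableT (subsetT dom)).
apply: (eq_measurable_fun _ _ mF) => x _ /=.
rewrite /Rintegral integral_mkcond.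
rewrite [X in _ = fine (integral _ _ X)](_ : _ = fun t => g (x, t)); first last.
  apply/funext => t; rewrite /g /q !patchE.
  by case: ifPn => //; rewrite mul0r.
rewrite integralE /fubini_F; congr (fine (_ - _)); apply: eq_integral => t _.
- by rewrite !funeposE.
- by rewrite !funenegE.
Qed.

(** Right continuity in the truncation parameter, due to the strict inequality in [cutoff_inv]. It
    allows the limit at [0] to be tested on rational parameters. *)
Lemma hat_trunc_right_cvg (e : R) (p : nat -> R) x : 0 < e -> (forall n, e < p n) ->
  p n @[n --> \oo] --> e -> hat_trunc (p n) r x @[n --> \oo] --> hat_trunc e r x.
Proof.
move=> e0 pe cp; rewrite /hat_trunc; apply: cvgMr; rewrite /Rintegral.
have acvg t : dom t -> arg (p n) x t @[n --> \oo] --> arg e x t.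
  move=> dt; apply: cvg_near_cst; rewrite /arg /cutoff_inv.
  have [et|te] := ltP e `|t - x|; last first.
    by apply: nearW => n; rewrite ltNge (le_trans te)//= ltW.
  have : \forall n \near \oo, p n < `|t - x| by apply: (cvgr_lt _ cp).
  by apply: filterS => n ->.
have [_ _ cg] := @dominated_convergence _ _ _ mu dom measurable_dom (fun n => arg (p n) x) (arg e x)
  (fun t => e^-1%:E * `|(r t)%:E|)%E
  (fun n => marg x (lt_trans e0 (pe n))) (marg x e0) (aeW _ acvg) (iarg_dom e)
  (aeW _ (fun t n dt => arg_le x e0 (ltW (pe n)) dt)).
apply: fine_cvg; rewrite fineK; first exact: cg.
by apply: integrable_fin_num; [exact: measurable_dom|exact: iarg].
Qed.

(** The positive rationals, indexed by pairs of naturals so that conditions on them become countable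
    intersections. *)
Definition frac (a b : nat) : R := a.+1%:R / b.+1%:R.

Lemma frac_gt0 a b : 0 < frac a b.
Proof. by rewrite divr_gt0. Qed.

Lemma frac_between (x y : R) : 0 < x -> x < y -> exists a b, x < frac a b < y.
Proof.
move=> x0 xy; have d0 : 0 < y - x by rewrite subr_gt0.
pose b := Num.bound (y - x)^-1.
have hb : (y - x)^-1 < b.+1%:R.
  by rewrite (lt_trans (archi_boundP _)) ?invr_ge0 ?(ltW d0)// ltr_nat.
have b0 : 0 < b.+1%:R :> R by [].
pose a := Num.truncn (x * b.+1%:R).
have /andP[a1 a2] := truncn_itv (mulr_ge0 (ltW x0) (ltW b0)).
exists a, b; rewrite /frac ltr_pdivlMr// a2 /= ltr_pdivrMr//.
rewrite -natr1 (le_lt_trans (lerD a1 (lexx _)))// -ltrBrDl -mulrBl.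
by rewrite mulrC -ltr_pdivrMr// div1r.
Qed.

(** A Cauchy condition for the rational parameter [frac a b] against the reference parameter
    [1 / (N + 2)], which lies below [1 / (N + 1)]. Larger parameters impose only membership in
    [dom]. *)
Definition pv_osc (k N a b : nat) : set line :=
  if frac a b < N.+1%:R^-1 then
    dom `&` [set x : line | `|hat_trunc (frac a b) r x - hat_trunc N.+2%:R^-1 r x| <= k.+1%:R^-1]
  else dom.

Definition pv_set : set line :=
  \bigcap_k \bigcup_N \bigcap_a \bigcap_b pv_osc k N a b.

Lemma measurable_pv_set : measurable pv_set.
Proof.
apply: bigcapT_measurable => k; apply: bigcupT_measurable => N.
apply: bigcapT_measurable => a; apply: bigcapT_measurable => b.
rewrite /pv_osc; case: ifPn => _; last exact: measurable_dom.
have m : measurable_fun dom (fun x : line =>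
    `|hat_trunc (frac a b) r x - hat_trunc N.+2%:R^-1 r x|).
  apply: (measurableT_comp (@normr_measurable R setT)).
  apply: measurable_funB; apply: measurable_hat_trunc; [exact: frac_gt0|by rewrite invr_gt0].
exact: (m measurable_dom _ (measurable_itv `]-oo, (k.+1%:R^-1 : R)])).
Qed.

Let natinv_small (d : R) : 0 < d -> exists N, N.+1%:R^-1 < d.
Proof.
move=> d0; exists (Num.bound d^-1).
rewrite -[X in _ < X]invrK ltf_pV2 ?posrE ?invr_gt0//.
by rewrite (lt_trans (archi_boundP _)) ?invr_ge0 ?(ltW d0)// ltr_nat.
Qed.

(** Cauchy's criterion. A real parameter below [1 / (N + 1)] is approached from the right by
    rational ones below the same bound, and the condition passes to it by right continuity. *)
Lemma pv_setP (x : R) : pv_set x <-> dom x /\ cvg (hat_trunc e r x @[e --> 0^'+]).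
Proof.
split=> [px|[dx cx] k _].
  split.
    have [N _ /(_ 0 I 0 I)] := px 0 I.
    by rewrite /pv_osc; case: ifP => // _ [].
  apply/cauchy_cvgP/cauchy_exP => eps eps0.
  have [k hk] := natinv_small eps0.
  have [N _ hN] := px k I.
  exists (hat_trunc N.+2%:R^-1 r x).
  have N0 : 0 < N.+1%:R^-1 :> R by rewrite invr_gt0.
  exists N.+1%:R^-1 => //= e; rewrite /ball /= sub0r normrN => eN e0.
  rewrite gtr0_norm// in eN.
  have exq n : exists p : R, [/\ e < p, p < e + n.+1%:R^-1 &
      `|hat_trunc p r x - hat_trunc N.+2%:R^-1 r x| <= k.+1%:R^-1].
    have lt : e < Num.min N.+1%:R^-1 (e + n.+1%:R^-1).
      by rewrite lt_min eN ltrDl invr_gt0 ltr0n.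
    have [a [b]] := frac_between e0 lt; rewrite lt_min => /and3P[ep pN pn].
    exists (frac a b); split => //.
    by have := hN a I b I; rewrite /pv_osc pN => -[].
  have [p hp] := choice exq.
  have pcvg : p n @[n --> \oo] --> e.
    apply/cvgrPdist_lt => eta eta0; have [M hM] := natinv_small eta0.
    exists M => // n /= Mn; have [p1 p2 _] := hp n.
    rewrite distrC gtr0_norm ?subr_gt0// ltrBlDl (lt_le_trans p2)// lerD2l ltW//.
    by apply: le_lt_trans hM; rewrite lef_pV2 ?posrE// ler_nat.
  have cv : `|hat_trunc (p n) r x - hat_trunc N.+2%:R^-1 r x| @[n --> \oo] -->
      `|hat_trunc e r x - hat_trunc N.+2%:R^-1 r x|.
    apply: cvg_norm; apply: cvgB; last exact: cvg_cst.
    by apply: hat_trunc_right_cvg => // n; case: (hp n).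
  rewrite distrC (le_lt_trans _ hk)// -(cvg_lim (@Rhausdorff R) cv); apply: limr_le.
    by apply/cvg_ex; eexists; exact: cv.
  by apply: nearW => n; case: (hp n).
have k0 : 0 < (k.+1%:R^-1 / 2 : R) by rewrite divr_gt0.
have /cvgrPdist_lt/(_ _ k0)[d /= d0 hd] := cx.
have [N hN] := natinv_small d0.
have close (e : R) : 0 < e -> e < d ->
    `|lim (hat_trunc e r x @[e --> 0^'+]) - hat_trunc e r x| < k.+1%:R^-1 / 2.
  by move=> e0 ed; apply: hd => //; rewrite /ball /= sub0r normrN gtr0_norm.
exists N => // a _ b _; rewrite /pv_osc; case: ifPn => // pN; split => //=.
have c1 := close _ (frac_gt0 a b) (lt_trans pN hN).
have N2 : N.+2%:R^-1 < d.
  by rewrite (lt_trans _ hN)// ltf_pV2 ?posrE// ltr_nat.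
have c2 := close _ (_ : 0 < N.+2%:R^-1) N2.
rewrite (le_trans (ler_distD (lim (hat_trunc e r x @[e --> 0^'+])) _ _))//.
rewrite [X in X + _]distrC [leRHS]splitr lerD ?ltW//.
by apply: c2; rewrite invr_gt0.
Qed.

Lemma hat_trunc_seq_cvg (x l : R) : hat_trunc e r x @[e --> 0^'+] --> l ->
  hat_trunc n.+1%:R^-1 r x @[n --> \oo] --> l.
Proof.
move=> /cvgrPdist_lt h; apply/cvgrPdist_lt => eps eps0.
have [d /= d0 hd] := h _ eps0; have [N hN] := natinv_small d0.
exists N => // n /= Nn; apply: hd; last by rewrite invr_gt0.
rewrite /ball /= sub0r normrN gtr0_norm ?invr_gt0//.
by apply: le_lt_trans hN; rewrite lef_pV2 ?posrE// ler_nat.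
Qed.

End PrincipalValue.

Section ComplexLimits.
Context {R : realType}.

Lemma cabsE (a b : R) : cabs (Complex a b) = Num.sqrt (a ^+ 2 + b ^+ 2).
Proof. by []. Qed.

Lemma cabs_le_add (a b : R) : cabs (Complex a b) <= `|a| + `|b|.
Proof.
rewrite cabsE -[leRHS]ger0_norm ?addr_ge0// -sqrtr_sqr ler_wsqrtr//.
by rewrite sqrrD !real_normK ?num_real// addrAC lerDl mulrn_wge0// mulr_ge0.
Qed.

Lemma normr_le_cabs (a b : R) : (`|a| <= cabs (Complex a b)) * (`|b| <= cabs (Complex a b)).
Proof.
by rewrite cabsE -!sqrtr_sqr; split; rewrite ler_wsqrtr// ?lerDl ?lerDr sqr_ge0.
Qed.

Lemma cvg_complex (T : Type) (F : set_system T) (FF : Filter F) (u v : T -> R) (a b : R) :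
  ((Complex (u t) (v t) : R[i]^o) @[t --> F] --> (Complex a b : R[i]^o)) <->
  (u t @[t --> F] --> a) /\ (v t @[t --> F] --> b).
Proof.
have distE t : `|(Complex a b : R[i]^o) - Complex (u t) (v t)| =
    (cabs (Complex (a - u t) (b - v t)))%:C%C by [].
split=> [/cvgrPdist_lt h|[/cvgrPdist_lt hu /cvgrPdist_lt hv]].
  split; apply/cvgrPdist_lt => eps eps0.
    have e0 : 0 < (eps%:C%C : R[i]) by rewrite ltcR.
    have := h _ e0; apply: filterS => t; rewrite distE ltcR.
    by move=> h1; exact: le_lt_trans (normr_le_cabs (a - u t) (b - v t)).1 h1.
  have e0 : 0 < (eps%:C%C : R[i]) by rewrite ltcR.
  have := h _ e0; apply: filterS => t; rewrite distE ltcR.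
  by move=> h1; exact: le_lt_trans (normr_le_cabs (a - u t) (b - v t)).2 h1.
(* A positive element of [R[i]] has zero imaginary part, so the radius is real. *)
apply/cvgrPdist_lt => -[c d]; rewrite ltcE /= => /andP[/eqP -> c0].
have c2 : 0 < c / 2 by rewrite divr_gt0.
near=> t.
have tu : `|a - u t| < c / 2 by near: t; exact: hu.
have tv : `|b - v t| < c / 2 by near: t; exact: hv.
rewrite distE -[Complex c 0]/(c%:C%C) ltcR (le_lt_trans (cabs_le_add _ _))//.
by rewrite [c]splitr ltrD.
Unshelve. all: by end_near. Qed.

End ComplexLimits.

Section HilbertHat.
Context {R : realType}.
Local Notation line := (lebesgue_line R).

Lemma Rintegral_cutoff (r : line -> R) (x e : R) : 0 < e -> dom x ->
  mu.-integrable dom (EFin \o r) ->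
  \int[mu]_(t in [set` `](-1 : R), (x - e)[ ]) (r t / (t - x)) +
  \int[mu]_(t in [set` `](x + e), (1 : R)[ ]) (r t / (t - x)) =
  \int[mu]_(t in dom) (r t * cutoff_inv e x t).
Proof.
move=> e0 dx ir.
set A : set line := [set` `](-1 : R), (x - e)[ ]; set B : set line := [set` `](x + e), (1 : R)[ ].
have mA : measurable A by exact: measurable_itv_line.
have mB : measurable B by exact: measurable_itv_line.
have /andP[x1 x2] := (domP x).1 dx.
have pE : (fun t : line => r t / (t - x)) \_ (A `|` B) = (fun t => r t * cutoff_inv e x t) \_ dom.
  apply/funext => t; rewrite !patchE.
  have -> : (t \in A `|` B) = (t \in @dom R) && (e < `|t - x|).
    apply/idP/andP => [/set_mem|[/set_mem dt]].
      rewrite /A /B /= !in_itv /= => -[/andP[t1 t2]|/andP[t1 t2]]; split.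
      - by apply/mem_set/domP; rewrite t1 /=; lra.
      - by rewrite distrC ltr_normr; apply/orP; left; lra.
      - by apply/mem_set/domP; rewrite t2 andbT; lra.
      - by rewrite ltr_normr; apply/orP; left; lra.
    have /andP[t1 t2] := (domP t).1 dt.
    rewrite ltr_normr => /orP[h|h]; apply/mem_set; [right|left]; rewrite /A /B /= in_itv /=; apply/andP; split; lra.
  case: (t \in dom) => //=; rewrite /cutoff_inv.
  by case: ifP; rewrite ?mulr0.
have iAB : mu.-integrable (A `|` B) (EFin \o (fun t : line => r t / (t - x))).
  apply/(integrable_mkcond _ (measurableU _ _ mA mB)).
  have -> : (EFin \o (fun t : line => r t / (t - x))) \_ (A `|` B) =
      (EFin \o (fun t => r t * cutoff_inv e x t)) \_ dom.
    have pEe (h : line -> R) (D : set line) : (EFin \o h) \_ D = EFin \o (h \_ D).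
      by apply/funext => t; rewrite /= !patchE; case: ifP.
    by rewrite !pEe pE.
  apply/(integrable_mkcond _ measurable_dom).
  have -> : EFin \o (fun t => r t * cutoff_inv e x t) =
      ((EFin \o cutoff_inv e x) \* (EFin \o r))%E.
    by apply/funext => t; rewrite /= -EFinM mulrC.
  apply: integrableMr; [exact: measurable_dom|by case: (bmf_cutoff_inv x e0)| |exact: ir].
  exists e^-1; split; first exact: num_real.
  by move=> y ey t _; rewrite /= (le_trans (cutoff_inv_bound x t e0))// ltW.
rewrite -Rintegral_setU//; last first.
  rewrite disj_set2E; apply/eqP; apply/seteqP; split => // t [].
  by rewrite /A /B /= !in_itv /= => /andP[t1 t2] /andP[t3 t4]; lra.
by rewrite Rintegral_mkcond pE -Rintegral_mkcond.
Qed.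

Lemma truncated_hilbert_hat (f : line -> R[i]) (x e : R) : 0 < e -> dom x ->
  mu.-integrable dom (EFin \o (fun t => complex.Re (f t))) ->
  mu.-integrable dom (EFin \o (fun t => complex.Im (f t))) ->
  truncated_hilbert (fun t : R => (Num.sqrt (1 - t ^+ 2))%:C%C * f t) x e =
  Complex (pi^-1 * Num.sqrt (delta x) * hat_trunc e (fun t => complex.Re (f t)) x)
          (pi^-1 * Num.sqrt (delta x) * hat_trunc e (fun t => complex.Im (f t)) x).
Proof.
move=> e0 dx iRe iIm; have d0 := sqrt_delta_gt0 dx.
have int r : mu.-integrable dom (EFin \o r) ->
    mu.-integrable dom (EFin \o (fun t : line => Num.sqrt (delta t) * r t)).
  move=> ir; apply: (integrableMr measurable_dom (h := fun t : line => Num.sqrt (delta t)) _ _ ir).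
    exact: measurable_sqrt_delta.
  case: (@bmf_sqrt_delta R) => _ [M hM]; exists M; split; first exact: num_real.
  by move=> y My t dt; rewrite /= (le_trans (hM t dt))// ltW.
have hE r : mu.-integrable dom (EFin \o r) ->
  pi^-1 * Num.sqrt (delta x) * hat_trunc e r x =
  pi^-1 * (\int[mu]_(t in [set` `](-1 : R), (x - e)[ ]) (Num.sqrt (delta t) * r t / (t - x)) +
  \int[mu]_(t in [set` `](x + e), (1 : R)[ ]) (Num.sqrt (delta t) * r t / (t - x))).
  move=> ir; rewrite (Rintegral_cutoff e0 dx (int _ ir)) /hat_trunc -mulrA mulVKf ?gt_eqF//.
have kE (z : R[i]) (s y : R) : s%:C%C * z / y%:C%C =
    Complex (s * complex.Re z / y) (s * complex.Im z / y).
  case: z => a b; rewrite -fmorphV /=; apply/eqP; rewrite eq_complex /=.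
  by apply/andP; split; apply/eqP; ring.
rewrite !hE// /truncated_hilbert /cintegral.
have eRe : (fun t : line => complex.Re ((Num.sqrt (1 - t ^+ 2))%:C%C * f t / (t - x)%:C%C)) =
    fun t => Num.sqrt (delta t) * complex.Re (f t) / (t - x).
  by apply/funext => t; rewrite kE.
have eIm : (fun t : line => complex.Im ((Num.sqrt (1 - t ^+ 2))%:C%C * f t / (t - x)%:C%C)) =
    fun t => Num.sqrt (delta t) * complex.Im (f t) / (t - x).
  by apply/funext => t; rewrite kE.
cbv beta zeta; rewrite eRe eIm.
apply/eqP; rewrite eq_complex /=.
by apply/andP; split; apply/eqP; ring.
Qed.

Definition hat_pv (r : line -> R) (x : R) : R :=
  - pi^-1 * lim (hat_trunc e r x @[e --> 0^'+]).

Lemma hilbert_hatE (f : line -> R[i]) (x : R) : dom x ->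
  mu.-integrable dom (EFin \o (fun t => complex.Re (f t))) ->
  mu.-integrable dom (EFin \o (fun t => complex.Im (f t))) ->
  cvg (hat_trunc e (fun t => complex.Re (f t)) x @[e --> 0^'+]) ->
  cvg (hat_trunc e (fun t => complex.Im (f t)) x @[e --> 0^'+]) ->
  hilbert_hat f x = Complex (hat_pv (fun t => complex.Re (f t)) x)
                            (hat_pv (fun t => complex.Im (f t)) x).
Proof.
move=> dx iRe iIm cRe cIm; have d0 := sqrt_delta_gt0 dx.
rewrite /hilbert_hat /finite_hilbert.
set lr := lim (hat_trunc e (fun t => complex.Re (f t)) x @[e --> 0^'+]) in cRe *.
pose li := lim (hat_trunc e (fun t => complex.Im (f t)) x @[e --> 0^'+]).
pose c := pi^-1 * Num.sqrt (delta x).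
have cv : (truncated_hilbert (fun t : R => (Num.sqrt (1 - t ^+ 2))%:C%C * f t) x e : R[i]^o)
     @[e --> 0^'+] --> (Complex (c * lr) (c * li) : R[i]^o).
  apply: (@cvg_trans _ ((Complex (c * hat_trunc e (fun t => complex.Re (f t)) x)
     (c * hat_trunc e (fun t => complex.Im (f t)) x) : R[i]^o) @[e --> (0:R)^'+])).
    apply: near_eq_cvg; near=> e; rewrite truncated_hilbert_hat//.
  by apply/cvg_complex; split; apply: cvgMr; [exact: cRe|exact: cIm].
rewrite (cvg_lim _ cv); last exact: norm_hausdorff.
rewrite /hat_pv -/lr -/li /c; apply/eqP; rewrite eq_complex /= -/(delta x).
have s0 : Num.sqrt (delta x) != 0 by rewrite gt_eqF.
move: (Num.sqrt (delta x)) s0 (pi^-1 : R) => s s0 p.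
by apply/andP; split; apply/eqP; field.
Unshelve. all: by end_near. Qed.

(** The default value of [lim] in the absence of a limit is [0]. If the complex truncations
    converged, so would both parts, since [pi^-1 * sqrt (delta x)] does not vanish. *)
Lemma hilbert_hat_dvg (f : line -> R[i]) (x : R) : dom x ->
  mu.-integrable dom (EFin \o (fun t => complex.Re (f t))) ->
  mu.-integrable dom (EFin \o (fun t => complex.Im (f t))) ->
  ~ (cvg (hat_trunc e (fun t => complex.Re (f t)) x @[e --> 0^'+]) /\
     cvg (hat_trunc e (fun t => complex.Im (f t)) x @[e --> 0^'+])) ->
  hilbert_hat f x = 0.
Proof.
move=> dx iRe iIm ncv; have d0 := sqrt_delta_gt0 dx.
rewrite /hilbert_hat /finite_hilbert dvgP ?mulr0// => cv; apply: ncv.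
pose c := pi^-1 * Num.sqrt (delta x).
have c0 : c != 0 by rewrite mulf_neq0 ?gt_eqF// invr_gt0 pi_gt0.
set L : R[i]^o := lim _ in cv.
have : (Complex (c * hat_trunc e (fun t => complex.Re (f t)) x)
     (c * hat_trunc e (fun t => complex.Im (f t)) x) : R[i]^o) @[e --> (0:R)^'+] --> L.
  apply: cvg_trans cv; apply: near_eq_cvg; near=> e; rewrite truncated_hilbert_hat//.
case: L {cv} => a b /cvg_complex[ca cb].
have divc (r : line -> R) (l : R) : (c * hat_trunc e r x) @[e --> (0:R)^'+] --> l -> cvg (hat_trunc e r x @[e --> 0^'+]).
  move=> h; apply/cvg_ex; exists (c^-1 * l).
  have -> : (fun e => hat_trunc e r x) = (fun e => c^-1 * (c * hat_trunc e r x)).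
    by apply/funext => e; rewrite mulKf.
  exact: cvgMr.
by split; [exact: divc ca|exact: divc cb].
Unshelve. all: by end_near. Qed.

End HilbertHat.

(** * Boundedness *)

Section LimInf.
Context {R : realType}.
Implicit Types (u v : (\bar R) ^nat).

Lemma le_limn_einf u v : (forall n, (u n <= v n)%E) -> (limn_einf u <= limn_einf v)%E.
Proof.
move=> uv; rewrite !limn_einf_lim; apply: lee_lim; [exact: is_cvg_einfs|exact: is_cvg_einfs|].
apply: nearW => n; apply/ereal_infP => _ [k nk <-].
by apply: le_trans (uv k); apply: ereal_inf_lbound; exists k.
Qed.

Lemma limn_einf_le u (c : \bar R) : (forall n, (u n <= c)%E) -> (limn_einf u <= c)%E.
Proof.
move=> uc; apply: (le_trans (le_limn_einf uc)).
by rewrite (cvg_limn_einf_sup (@cvg_cst _ c nat \oo _)).1.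
Qed.

End LimInf.

(** * Integrability of functions in [L(log L)^alpha] *)

Section Levels.
Context {R : realType}.
Local Notation line := (lebesgue_line R).
Implicit Types (f h : line -> R[i]) (l : R).

Lemma le_dyad_sum l (y : R) : 0 < l ->
  (y%:E <= l%:E + \sum_(0 <= k <oo) (dyad l k * (dyad l k < y)%R%:R)%:E)%E.
Proof.
move=> l0.
have u0 k : (0 <= (dyad l k * (dyad l k < y)%R%:R)%:E)%E.
  by rewrite lee_fin mulr_ge0// ltW// dyad_gt0.
have ex : exists k, y <= dyad l k.
  exists (Num.bound (y / l)); rewrite /dyad -ler_pdivrMl// mulrC.
  have [y0|y0] := leP 0 y; last by rewrite (@le_trans _ _ 0)// pmulr_lle0 ?invr_gt0// ltW.
  rewrite (@le_trans _ _ (Num.bound (y / l))%:R)//; last by rewrite -natrX ler_nat ltnW// ltn_expl.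
  by rewrite ltW// archi_boundP// divr_ge0// ltW.
have [K yK Kmin] := ex_minnP ex.
apply: (@le_trans _ _ (dyad l K)%:E); first by rewrite lee_fin.
rewrite -sum_dyad EFinD leeD2l//.
apply: le_trans (nneseries_lim_ge K (fun k _ _ => u0 k)).
rewrite sumEFin lee_fin !big_nat; apply: ler_sum => k /andP[_ kK].
suff -> : dyad l k < y by rewrite mulr1.
by rewrite ltNge; apply/negP => /Kmin; rewrite leqNgt kK.
Qed.

(** [z k] records whether the level set has positive measure; if so, [m k] brackets this measure
    within a factor 2. The maximal measure [2], outside the range of [dyadic_bracket], gets the
    exponent [0]. *)
Lemma exists_dyadic_exponents f l : cmeasurable f ->
  exists (m : nat -> nat) (z : nat -> bool), forall k,
    dist f (dyad l k) <= (z k)%:R * (2 / 2 ^+ m k) /\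
    (z k -> 2 ^- m k <= dist f (dyad l k)).
Proof.
move=> mf.
suff /choice[mz hmz] : forall k, exists mz : nat * bool,
    dist f (dyad l k) <= mz.2%:R * (2 / 2 ^+ mz.1) /\ (mz.2 -> 2 ^- mz.1 <= dist f (dyad l k)).
  by exists (fun k => (mz k).1), (fun k => (mz k).2).
move=> k; have := dist_ge0 f (dyad l k); have := dist_le2 (dyad l k) mf.
move: (dist f _) => d d2 d0.
have [dp|dn] := ltP 0 d; last first.
  by exists (0%N, false); rewrite /= mul0r.
have [dlt|dge] := ltP d 2; last first.
  by exists (0%N, true); rewrite /= mul1r expr0 divr1 invr1; split => // _; lra.
have [n [n1 n2]] := dyadic_bracket dp dlt.
exists (n, true); rewrite /= mul1r; split; first exact: ltW.
by move=> _; rewrite (le_trans _ n1)// exprS invfM mulVKf.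
Qed.

(** Pointwise, [cabs f] is at most [1] plus the sum of the dyadic levels lying below it. The
    integral of that sum is bounded through [norm_lower], the weight [(m + 1) ^ alpha] being at
    least 1; the equality of the integrals of [cabs f] and of its rearrangement is avoided. *)
Lemma L1_norm_lty (alpha : R) f : 0 <= alpha -> LlogL alpha f -> (L1_norm f < +oo)%E.
Proof.
move=> a0 [mf nf]; have l1 k := dyad_gt0 (l := 1 : R) k ltr01.
have [m [z hmz]] := exists_dyadic_exponents 1 mf.
have mE k : mu (dom `&` lset f (dyad 1 k)) = (dist f (dyad 1 k))%:E.
  by rewrite setIA setIid; exact: mu_lset.
have i0 (B : set line) x : (0 <= (\1_B x)%:E :> \bar R)%E by rewrite lee_fin indicE ler0n.
pose F k (x : line) : \bar R := ((dyad (1 : R) k)%:E * (\1_(lset f (dyad 1 k)) x)%:E)%E.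
have F0 k x : (0 <= F k x)%E by rewrite mule_ge0 ?i0// lee_fin ltW.
have mi k : measurable_fun dom (fun x : line => (\1_(lset f (dyad 1 k)) x)%:E : \bar R).
  by apply/measurable_EFinP; apply: measurable_indic; exact: measurable_lset.
have mF k : measurable_fun dom (F k).
  by apply: emeasurable_funM; [exact: measurable_cst|exact: mi].
have mSF : measurable_fun dom (fun x => \sum_(0 <= k <oo) F k x)%E.
  by apply: ge0_emeasurable_sum => [k x _ _|k _]; [exact: F0|exact: mF].
apply: (@le_lt_trans _ _ (\int[mu]_(x in dom) (1%:E + \sum_(0 <= k <oo) F k x))%E).
  apply: ge0_le_integral_nomeas => x dx; first by rewrite lee_fin cabs_ge0.
  apply: (le_trans (le_dyad_sum _ ltr01)); rewrite leeD2l//.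
  apply: lee_nneseries => k _ => [_|]; first by rewrite lee_fin mulr_ge0 ?(ltW (l1 k)).
  rewrite /F -EFinM lee_fin ler_wpM2l ?(ltW (l1 k))// indicE ler_nat.
  case: (boolP (_ < _)) => // h.
  by rewrite (mem_set (_ : lset f (dyad 1 k) x)).
rewrite ge0_integralD; [|exact: measurable_dom|by []|exact: measurable_cst
  |by move=> x _; apply: nneseries_ge0|exact: mSF].
apply: lte_add_pinfty.
  by rewrite integral_cst ?mul1e; [exact: mu_dom_lty|exact: measurable_dom].
rewrite integral_nneseries; [|exact: measurable_dom|exact: mF|by []].
apply: (@le_lt_trans _ _ ((4 * 2 `^ alpha)%:E * LlogL_norm alpha f)%E); last first.
  by rewrite lte_mul_pinfty// lee_fin mulr_ge0// powR_ge0.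
apply: nneseries_le => [k|J]; first by apply: integral_ge0 => x _; exact: F0.
apply: (@le_trans _ _ ((4 * 2 `^ alpha)%:E * (\sum_(0 <= k < J) (z k)%:R *
    (dyad 1 k / 2 * 2 ^- m k * ((m k).+1%:R / 2) `^ alpha))%:E)%E); last first.
  rewrite lee_wpmul2l ?lee_fin ?mulr_ge0 ?powR_ge0//.
  by apply: norm_lower => // k; case: (hmz k).
rewrite -EFinM (eq_bigr (fun k => (dyad 1 k * dist f (dyad 1 k))%:E)); last first.
  move=> k _; rewrite /F ge0_integralZl_EFin; [|exact: measurable_dom|by move=> x _; exact: i0
    |exact: mi|exact: ltW].
  rewrite integral_indic; [|exact: measurable_dom|exact: measurable_lset].
  by rewrite [RHS]EFinM; congr (_ * _)%E; rewrite setIC; exact: mE.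
rewrite sumEFin lee_fin mulr_sumr; apply: ler_sum => k _.
have [h _] := hmz k.
apply: (@le_trans _ _ (dyad 1 k * ((z k)%:R * (2 / 2 ^+ m k)))).
  by rewrite ler_wpM2l ?(ltW (l1 k)).
have -> : 4 * 2 `^ alpha * ((z k)%:R * (dyad 1 k / 2 * 2 ^- m k * ((m k).+1%:R / 2) `^ alpha)) =
  dyad 1 k * ((z k)%:R * (2 / 2 ^+ m k)) * (2 `^ alpha * ((m k).+1%:R / 2) `^ alpha).
  by field; rewrite expf_neq0.
rewrite ler_peMr ?mulr_ge0 ?(ltW (l1 k))// -powRM ?divr_ge0// mulrC divfK//.
have := @ge0_ler_powR _ alpha a0 1 (m k).+1%:R; rewrite powR1 !nnegrE ler1n; exact.
Qed.

Lemma integrable_Re_Im (alpha : R) f : 0 <= alpha -> LlogL alpha f ->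
  mu.-integrable dom (EFin \o (fun t : line => complex.Re (f t))) /\
  mu.-integrable dom (EFin \o (fun t : line => complex.Im (f t))).
Proof.
move=> a0 Lf; have nf := L1_norm_lty a0 Lf; have [[mr mi] _] := Lf.
have red (r : line -> R) : measurable_fun dom r -> (forall x, `|r x| <= cabs (f x)) ->
    mu.-integrable dom (EFin \o r).
  move=> mer rf; apply/integrableP; split; first exact/measurable_EFinP.
  apply: le_lt_trans nf; apply: ge0_le_integral_nomeas => x _; first by rewrite abse_ge0.
  by rewrite /= lee_fin.
split; apply: red => // x; case: (f x) => a b /=.
- exact: (normr_le_cabs a b).1.
- exact: (normr_le_cabs a b).2.
Qed.

End Levels.

Lemma limn_einf_scaled_norms (R : realType) (a b : R^nat) (la lb p : R) :
  a @ \oo --> la -> b @ \oo --> lb ->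
  limn_einf (fun j => (p * (`|a j| + `|b j|))%:E) = (p * (`|la| + `|lb|))%:E.
Proof.
move=> ca cb; apply: (cvg_limn_einf_sup _).1; apply: cvg_EFin; first exact: nearW.
by apply: cvgMr; apply: cvgD; [exact: cvg_norm ca|exact: cvg_norm cb].
Qed.

Section HatBound.
Context {R : realType}.
Local Notation line := (lebesgue_line R).
Variable f : line -> R[i].
Hypothesis mf : cmeasurable f.
Local Notation fr := (fun t : line => complex.Re (f t)).
Local Notation fi := (fun t : line => complex.Im (f t)).
Hypothesis iRe : mu.-integrable dom (EFin \o fr).
Hypothesis iIm : mu.-integrable dom (EFin \o fi).

Let hat_cvg : set line := pv_set fr `&` pv_set fi.

Let measurable_hat_cvg : measurable hat_cvg.
Proof.
by apply: measurableI; [exact: (measurable_pv_set mf.1)|exact: (measurable_pv_set mf.2)].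
Qed.

Let hat_cvgP (x : line) : hat_cvg x ->
  cvg (hat_trunc e fr x @[e --> 0^'+]) /\ cvg (hat_trunc e fi x @[e --> 0^'+]).
Proof.
move=> [hr hi].
split; [exact: proj2 ((pv_setP mf.1 iRe x).1 hr)|exact: proj2 ((pv_setP mf.2 iIm x).1 hi)].
Qed.

Lemma hat_pv_cvg (r : line -> R) (x : R) : cvg (hat_trunc e r x @[e --> 0^'+]) ->
  (- pi^-1 * hat_trunc n.+1%:R^-1 r x) @[n --> \oo] --> hat_pv r x.
Proof. by move=> cv; apply: cvgMr; apply: hat_trunc_seq_cvg. Qed.

Let hilbert_hat_cvg (x : line) : dom x -> hat_cvg x ->
  hilbert_hat f x = Complex (hat_pv fr x) (hat_pv fi x).
Proof. by move=> dx /hat_cvgP[cr ci]; exact: (hilbert_hatE dx iRe iIm cr ci). Qed.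

Let hilbert_hat_eq0 (x : line) : dom x -> ~ hat_cvg x -> hilbert_hat f x = 0.
Proof.
move=> dx ncv; apply: (hilbert_hat_dvg dx iRe iIm) => -[cr ci]; apply: ncv.
by split; [exact: ((pv_setP mf.1 iRe x).2 (conj dx cr))|exact: ((pv_setP mf.2 iIm x).2 (conj dx ci))].
Qed.

(** On the measurable set [hat_cvg] each part is a limit of truncations along [1 / (n + 1)];
    elsewhere the value is [0]. Multiplication by the indicator of this set makes it a limit on all
    of [dom]. *)
Lemma cmeasurable_hilbert_hat : cmeasurable (hilbert_hat f).
Proof.
have red (r : line -> R) : measurable_fun dom r ->
    (forall x, hat_cvg x -> cvg (hat_trunc e r x @[e --> 0^'+])) ->
    measurable_fun dom (fun x => \1_hat_cvg x * hat_pv r x).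
  move=> mr cr.
  apply: (@measurable_fun_cvg _ _ _ _
    (fun n (x : line) => \1_hat_cvg x * (- pi^-1 * hat_trunc n.+1%:R^-1 r x))).
    move=> n; apply: measurable_funM; first exact: measurable_indic.
    apply: measurable_funM; first exact: measurable_cst.
    by apply: (measurable_hat_trunc mr); rewrite invr_gt0.
  move=> x dx; rewrite indicE; case: (boolP (x \in hat_cvg)) => [/set_mem hx|_].
    by apply: cvgMr; apply: hat_pv_cvg; exact: cr.
  rewrite mul0r; under eq_fun do rewrite mul0r; exact: cvg_cst.
split.
- apply: (eq_measurable_fun _ _ (red _ mf.1 (fun x hx => (hat_cvgP hx).1))) => x /set_mem dx.
  rewrite indicE; case: (boolP (x \in hat_cvg)) => [/set_mem hx|/negP hx].
    by rewrite hilbert_hat_cvg//= mul1r.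
  by rewrite hilbert_hat_eq0 ?mul0r// => h; apply: hx; exact: mem_set.
- apply: (eq_measurable_fun _ _ (red _ mf.2 (fun x hx => (hat_cvgP hx).2))) => x /set_mem dx.
  rewrite indicE; case: (boolP (x \in hat_cvg)) => [/set_mem hx|/negP hx].
    by rewrite hilbert_hat_cvg//= mul1r.
  by rewrite hilbert_hat_eq0 ?mul0r// => h; apply: hx; exact: mem_set.
Qed.

(** Fatou's lemma is applied to the majorants, which vary with the truncation parameter while their
    bounds do not. The two equal summands stand for the real and the imaginary part; the factor
    [pi^-1 <= 1] is dropped. *)
Lemma hilbert_hat_bound l (m : nat -> nat) (z : nat -> bool) n (phi : line -> R) : 0 < l ->
  (forall k, dist f (dyad l k) <= (z k)%:R * (2 / 2 ^+ m k)) ->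
  weight_le phi (2 / 2 ^+ n) ->
  (\int[mu]_(x in dom) (phi x * cabs (hilbert_hat f x))%:E <=
   1000%:E * level_bound l m z n + 1000%:E * level_bound l m z n)%E.
Proof.
move=> l0 zm wphi; have [mphi phi01 _] := wphi.
have e0 j : 0 < (j.+1%:R^-1 : R) by rewrite invr_gt0.
have Rf x : dom x -> `|fr x| <= cabs (f x).
  by move=> _; case: (f x) => a b; exact: (normr_le_cabs a b).1.
have If x : dom x -> `|fi x| <= cabs (f x).
  by move=> _; case: (f x) => a b; exact: (normr_le_cabs a b).2.
have /choice[Gr hGr] := fun j => trunc_bound (e0 j) l0 mf mf.1 Rf iRe zm.
have /choice[Gi hGi] := fun j => trunc_bound (e0 j) l0 mf mf.2 If iIm zm.
pose F j x := ((phi x)%:E * Gr j x + (phi x)%:E * Gi j x)%E.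
have mp : measurable_fun dom (fun x => (phi x)%:E : \bar R) by exact/measurable_EFinP.
have p0 x : dom x -> (0 <= (phi x)%:E :> \bar R)%E.
  by move=> dx; have /andP[? _] := phi01 x dx; rewrite lee_fin.
have G0 j x : dom x -> (0 <= (phi x)%:E * Gr j x)%E /\ (0 <= (phi x)%:E * Gi j x)%E.
  move=> dx; have [_ g1 _ _] := hGr j; have [_ g2 _ _] := hGi j.
  by split; apply: mule_ge0; rewrite ?p0 ?g1 ?g2.
have mG j : measurable_fun dom (fun x => (phi x)%:E * Gr j x)%E.
  by have [g _ _ _] := hGr j; apply: emeasurable_funM; [exact: mp|exact: g].
have mG' j : measurable_fun dom (fun x => (phi x)%:E * Gi j x)%E.
  by have [g _ _ _] := hGi j; apply: emeasurable_funM; [exact: mp|exact: g].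
apply: (@le_trans _ _ (\int[mu]_(x in dom) limn_einf (F^~ x))%E).
  apply: ge0_le_integral_nomeas => x dx.
    by have /andP[? _] := phi01 x dx; rewrite lee_fin mulr_ge0// cabs_ge0.
  have [hx|hx] := pselect (hat_cvg x); last first.
    rewrite hilbert_hat_eq0// [cabs 0]/cabs ComplexField.Normc.normc0 mulr0.
    apply: (@le_trans _ _ (limn_einf (fun=> 0%E))).
      by rewrite (cvg_limn_einf_sup (@cvg_cst _ (0%E : \bar R) nat \oo _)).1.
    by apply: le_limn_einf => j; have [? ?] := G0 j x dx; exact: adde_ge0.
  have [/hat_pv_cvg cr /hat_pv_cvg ci] := hat_cvgP hx.
  apply: (@le_trans _ _ (phi x * (`|hat_pv fr x| + `|hat_pv fi x|))%:E).
    rewrite lee_fin hilbert_hat_cvg// ler_wpM2l ?cabs_le_add//.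
    by have /andP[] := phi01 x dx.
  rewrite -(limn_einf_scaled_norms _ cr ci); apply: le_limn_einf => j.
  have [_ _ g1 _] := hGr j; have [_ _ g2 _] := hGi j.
  have pile (y : R) : `|- pi^-1 * y| <= `|y|.
    rewrite normrM ler_piMl// normrN gtr0_norm ?invr_gt0 ?pi_gt0//.
    by rewrite invf_le1 ?pi_gt0// (le_trans _ (pi_ge2 R))// ler1n.
  rewrite mulrDr EFinD /F; apply: leeD; rewrite EFinM lee_wpmul2l ?p0//.
  - by apply: le_trans (g1 x dx); rewrite lee_fin.
  - by apply: le_trans (g2 x dx); rewrite lee_fin.
apply: le_trans (fatou _ _ _ _) _.
- exact: measurable_dom.
- by move=> j; apply: emeasurable_funD; [exact: mG|exact: mG'].
- by move=> j x dx; have [? ?] := G0 j x dx; exact: adde_ge0.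
apply: limn_einf_le => j.
have [_ _ _ h1] := hGr j; have [_ _ _ h2] := hGi j.
rewrite ge0_integralD; [|exact: measurable_dom|by move=> x dx; exact: (G0 j x dx).1|exact: mG
  |by move=> x dx; exact: (G0 j x dx).2|exact: mG'].
by apply: leeD; [exact: (h1 n phi wphi)|exact: (h2 n phi wphi)].
Qed.

End HatBound.

Section Boundedness.
Context {R : realType}.
Local Notation line := (lebesgue_line R).
Implicit Types (f h : line -> R[i]) (l : R) (m : nat -> nat) (z : nat -> bool).

Lemma level_bound_ge0 l m z n : 0 <= l -> (0 <= level_bound l m z n)%E.
Proof.
move=> l0; apply: adde_ge0; first by rewrite lee_fin mulr_ge0// kappa_ge0.
apply: nneseries_ge0 => k _ _.
by rewrite lee_fin !mulr_ge0 ?invr_ge0 ?exprn_ge0 ?kappa_ge0.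
Qed.

(** Interchanging the sums, the summation over [n] comes first and gives [(m k + 1) ^ (1 + beta)] by
    [sum_wstep_kappa]; the summation over [k] is then [norm_lower]. In [4 * 2 ^ (1 + beta)], one
    factor 2 comes from [dyad l k.+1], one from [dyad l k / 2], and the power from the halved
    logarithm. *)
Lemma sum_wstep_level_bound (beta : R) : 0 <= beta -> exists2 C : R, 0 <= C &
  forall f l m z, cmeasurable f -> 0 < l ->
  (forall k, z k -> 2 ^- m k <= dist f (dyad l k)) ->
  (\sum_(0 <= n <oo) ((wstep beta n)%:E * level_bound l m z n) <=
   (C * l)%:E + (C * (4 * 2 `^ (1 + beta)))%:E * LlogL_norm (1 + beta) f)%E.
Proof.
move=> b0; have [C C0 hC] := sum_wstep_kappa b0; exists C => // f l m z mf l0 hz.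
have w0 n : 0 <= wstep beta n by exact: wstep_ge0.
pose a k := dyad l k.+1 * ((z k)%:R * 2 ^- m k).
have d0 k : 0 <= dyad l k by exact: ltW (dyad_gt0 k l0).
have a0 k : 0 <= a k.
  by apply: mulr_ge0; [exact: d0|rewrite mulr_ge0 ?invr_ge0 ?exprn_ge0].
pose A n : \bar R := (l * (wstep beta n * kappa n 0))%:E.
pose B n k : \bar R := (a k * (wstep beta n * kappa n (m k)))%:E.
have A0 n : (0 <= A n)%E by rewrite lee_fin !mulr_ge0 ?kappa_ge0// ltW.
have B0 n k : (0 <= B n k)%E.
  by rewrite lee_fin; apply: mulr_ge0; [exact: a0|rewrite mulr_ge0 ?kappa_ge0].
have -> : (\sum_(0 <= n <oo) ((wstep beta n)%:E * level_bound l m z n) =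
    \sum_(0 <= n <oo) A n + \sum_(0 <= k <oo) \sum_(0 <= n <oo) B n k)%E.
  rewrite (nneseries_interchange (a := fun k n => B n k))//.
  rewrite -nneseriesD => [|n _ _|n _ _]; [|exact: A0|by apply: nneseries_ge0].
  apply: eq_eseriesr => n _; rewrite /level_bound ge0_muleDr; last 2 first.
  - by rewrite lee_fin mulr_ge0 ?kappa_ge0// ltW.
  - by apply: nneseries_ge0 => k _ _; rewrite lee_fin mulr_ge0 ?kappa_ge0// a0.
  congr (_ + _)%E; first by rewrite -EFinM /A; congr _%:E; ring.
  rewrite -nneseriesZl => [|k _]; last by rewrite lee_fin mulr_ge0 ?kappa_ge0// a0.
  by apply: eq_eseriesr => k _; rewrite -EFinM /B /a; congr _%:E; ring.
apply: leeD.
  apply: nneseries_le => // N; rewrite sumEFin lee_fin -mulr_sumr mulrC ler_wpM2r ?(ltW l0)//.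
  by have := hC 0%N N; rewrite powR1 mulr1.
pose b k := (z k)%:R * (dyad l k / 2 * 2 ^- m k * ((m k).+1%:R / 2) `^ (1 + beta)).
apply: (@le_trans _ _ (\sum_(0 <= k <oo) (C * (4 * 2 `^ (1 + beta)) * b k)%:E)%E).
  apply: lee_nneseries => k _ => [_|]; first by apply: nneseries_ge0.
  apply: nneseries_le => // N; rewrite sumEFin lee_fin -mulr_sumr.
  apply: (@le_trans _ _ (a k * (C * (m k).+1%:R `^ (1 + beta)))); first by rewrite ler_wpM2l.
  have -> : ((m k).+1%:R : R) `^ (1 + beta) = 2 `^ (1 + beta) * ((m k).+1%:R / 2) `^ (1 + beta).
    by rewrite -powRM ?divr_ge0// mulrC divfK.
  rewrite /a /b dyadS; move: (_ `^ _) (_ `^ _) (dyad l k) (2 ^- m k) => p q d s.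
  by rewrite le_eqVlt; apply/orP; left; apply/eqP; field.
have b1 k : 0 <= C * (4 * 2 `^ (1 + beta)) * b k.
  apply: mulr_ge0; first by rewrite !mulr_ge0 ?powR_ge0.
  apply: mulr_ge0 => //; apply: mulr_ge0; last exact: powR_ge0.
  by apply: mulr_ge0; [rewrite divr_ge0|rewrite invr_ge0 exprn_ge0].
apply: nneseries_le => [k|N]; first by rewrite lee_fin.
rewrite sumEFin -mulr_sumr EFinM lee_wpmul2l ?lee_fin ?mulr_ge0 ?powR_ge0//.
by apply: norm_lower => //; rewrite addr_ge0.
Qed.

Lemma hilbert_hat_norms (beta : R) : 0 <= beta -> exists (A B : R), [/\ 0 <= A, 0 <= B &
  forall f l, LlogL (1 + beta) f -> 0 < l ->
  (LlogL_norm beta (hilbert_hat f) <= (A * l)%:E + B%:E * LlogL_norm (1 + beta) f)%E /\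
  (L1_norm (hilbert_hat f) <= (A * l)%:E + B%:E * LlogL_norm (1 + beta) f)%E].
Proof.
move=> b0; have [C C0 hC] := sum_wstep_level_bound b0.
have b1 : 0 <= 1 + beta by rewrite addr_ge0.
have [t tE] : exists t : R, t = 1000%:R by exists 1000%:R.
have t0 : 0 <= t by rewrite tE ler0n.
(* [2] pays for the term [l * sn n] of [norm_upper], [4] comes from [level_sum], and [t + t] from
   [hilbert_hat_bound]. *)
pose c := 2 + 4 * (t + t); have c0 : 0 <= c by rewrite /c; lra.
exists (c * C), (c * (C * (4 * 2 `^ (1 + beta)))); split.
- exact: mulr_ge0.
- by rewrite mulr_ge0// mulr_ge0// mulr_ge0 ?powR_ge0.
move=> f l Lf l0; have [mf _] := Lf; have [iRe iIm] := integrable_Re_Im b1 Lf.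
have mh := cmeasurable_hilbert_hat mf iRe iIm.
have [m [z hmz]] := exists_dyadic_exponents l mf.
have w0 n : 0 <= wstep beta n by exact: wstep_ge0.
pose L n := level_bound l m z n.
have L0 n : (0 <= L n)%E by apply: level_bound_ge0; exact: ltW.
have hS := hC f l m z mf l0 (fun k => (hmz k).2).
set S := (\sum_(0 <= n <oo) _)%E in hS.
have fin : (c%:E * S <= (c * C * l)%:E + (c * (C * (4 * 2 `^ (1 + beta))))%:E * LlogL_norm (1 + beta) f)%E.
  apply: (@le_trans _ _ (c%:E * ((C * l)%:E + (C * (4 * 2 `^ (1 + beta)))%:E * LlogL_norm (1 + beta) f))%E).
    by rewrite lee_wpmul2l ?lee_fin.
  rewrite ge0_muleDr; last 2 first.
  - by rewrite lee_fin mulr_ge0// ltW.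
  - rewrite mule_ge0 ?lee_fin ?mulr_ge0 ?powR_ge0//.
    by apply: integral_ge0 => x _; rewrite mule_ge0 ?rearr_ge0// lee_fin powR_ge0.
  by rewrite muleA -!EFinM -[c * C * l]mulrA.
pose Q n := (t%:E * L n + t%:E * L n)%E.
have tL n : (0 <= t%:E * L n)%E by rewrite mule_ge0.
have hQ n phi : weight_le phi (2 / 2 ^+ n) ->
    (\int[mu]_(x in dom) (phi x * cabs (hilbert_hat f x))%:E <= Q n)%E.
  by rewrite /Q tE; exact: (hilbert_hat_bound mf iRe iIm l0 (fun k => (hmz k).1)).
have cL n (x : \bar R) : (x <= 2%:E * L n)%E -> (x + 4%:E * Q n <= c%:E * L n)%E.
  have -> : c%:E = (2%:E + 4%:E * (t%:E + t%:E))%E by [].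
  move=> xL; rewrite ge0_muleDl ?lee_fin ?mulr_ge0 ?addr_ge0//.
  apply: leeD => //; rewrite -muleA lee_wpmul2l ?lee_fin// ge0_muleDl ?lee_fin//.
(* Since [1/2 <= 3/4], the contribution of the values of the transform below [l] is absorbed by the
   first term of [level_bound]. *)
have kap n : ((l * (2 / 2 ^+ n))%:E <= 2%:E * L n)%E.
  apply: (@le_trans _ _ (2%:E * (l * kappa n 0)%:E)%E); last first.
    rewrite lee_wpmul2l ?lee_fin// /L /level_bound leeDl//.
    apply: nneseries_ge0 => k _ _.
    by rewrite lee_fin !mulr_ge0 ?invr_ge0 ?exprn_ge0 ?kappa_ge0 ?(ltW l0).
  rewrite -EFinM lee_fin mulrCA ler_wpM2l// ler_wpM2l ?(ltW l0)// /kappa leqn0 subn0.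
  case: n => [|n] /=; first by rewrite expr0 invr1.
  by rewrite -exprVn lerXn2r ?nnegrE ?invr_ge0//; lra.
split; apply: le_trans fin.
- apply: (le_trans (norm_upper b0 mh l0 hQ)).
  rewrite -nneseriesZl => [|n _]; last by rewrite mule_ge0 ?lee_fin.
  apply: lee_nneseries => n _ => [_|].
    by rewrite mule_ge0 ?lee_fin// adde_ge0 ?mule_ge0 ?adde_ge0// lee_fin !mulr_ge0 ?invr_ge0 ?exprn_ge0 ?(ltW l0).
  by rewrite muleCA lee_wpmul2l ?lee_fin//; apply: cL.
(* The constant [1] has mass [2 = 2 / 2 ^ 0], so testing with it at [n = 0] gives the [L1] norm
   directly; the term [n = 0] alone suffices because [wstep beta 0 = 2 ^ beta >= 1]. *)
- have w1 : weight_le (fun=> 1 : R) (2 / 2 ^+ 0 : R).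
    split; [exact: measurable_cst|by move=> x _; rewrite ler01 lexx|].
    rewrite integral_cst ?mul1e; last exact: measurable_dom.
    by rewrite expr0 divr1; rewrite le_eqVlt; apply/orP; left; apply/eqP; exact: mu_dom.
  have h0 := hQ 0%N _ w1.
  apply: (@le_trans _ _ (Q 0%N)).
    by apply: le_trans h0; under eq_integral do rewrite mul1r.
  have S0 : (L 0%N <= S)%E.
    have u0 n : (0 <= (wstep beta n)%:E * level_bound l m z n)%E by rewrite mule_ge0 ?L0 ?lee_fin.
    apply: le_trans (nneseries_lim_ge 1 (fun n _ _ => u0 n)).
    rewrite big_nat1 -[leLHS]mul1e lee_wpmul2r ?L0// lee_fin /wstep subr0 /wlevel.
    have := @ge0_ler_powR _ beta b0 1 2; rewrite powR1 !nnegrE; apply => //; lra.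
  apply: (@le_trans _ _ (c%:E * L 0%N)%E); last by rewrite lee_wpmul2l ?lee_fin.
  apply: le_trans (cL 0%N 0%E _); last by rewrite mule_ge0 ?lee_fin.
  rewrite add0e -[leLHS]mul1e lee_wpmul2r ?adde_ge0// lee_fin; lra.
Qed.

(** The starting level [l] is a free parameter; letting it tend to 0 removes the inhomogeneous term
    [A * l]. *)
Lemma hilbert_hat_bounded (beta : R) : 0 <= beta -> exists2 B : R, 0 <= B &
  forall f, LlogL (1 + beta) f ->
  [/\ cmeasurable (hilbert_hat f),
      (LlogL_norm beta (hilbert_hat f) <= B%:E * LlogL_norm (1 + beta) f)%E &
      (L1_norm (hilbert_hat f) <= B%:E * LlogL_norm (1 + beta) f)%E].
Proof.
move=> b0; have [A [B [A0 B0 h]]] := hilbert_hat_norms b0; exists B; [exact: B0|move=> f Lf].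
have b1 : 0 <= 1 + beta by rewrite addr_ge0.
have A1 : 0 < A + 1 by rewrite ltr_wpDl.
have lim (x y : \bar R) : (forall l, 0 < l -> (x <= (A * l)%:E + y)%E) -> (x <= y)%E.
  move=> hx; apply/lee_addgt0Pr => e e0.
  apply: (le_trans (hx (e / (A + 1)) (divr_gt0 e0 A1))).
  rewrite addeC leeD2l// lee_fin mulrA ler_pdivrMr// mulrC ler_wpM2l ?(ltW e0)//.
  by rewrite lerDl.
have [iRe iIm] := integrable_Re_Im b1 Lf; have [mf _] := Lf.
split; first exact: (cmeasurable_hilbert_hat mf iRe iIm).
- by apply: lim => l l0; exact: (h f l Lf l0).1.
- by apply: lim => l l0; exact: (h f l Lf l0).2.
Qed.

End Boundedness.

Theorem proposition4p5 (R : realType) :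
  (forall beta : R, 0 <= beta ->
     maps_boundedly hilbert_hat
       (LlogL (1 + beta)) (LlogL_norm (1 + beta))
       (LlogL beta) (LlogL_norm beta)) /\
  maps_boundedly (@hilbert_hat R)
    (LlogL 1) (LlogL_norm 1) L1 L1_norm.
Proof.
split=> [beta b0|].
  have [B B0 h] := hilbert_hat_bounded b0; exists B => f Lf; have [mh hn _] := h f Lf.
  split; [split; [exact: mh|apply: (le_lt_trans hn)]|exact: hn].
  by rewrite lte_mul_pinfty ?lee_fin//; case: Lf.
have [B B0] := hilbert_hat_bounded (lexx (0 : R)); rewrite addr0 => h.
exists B => f Lf; have [mh _ hn] := h f Lf.
split; [split; [exact: mh|apply: (le_lt_trans hn)]|exact: hn].
by rewrite lte_mul_pinfty ?lee_fin//; case: Lf.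
Qed.
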